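(* Let $n\ge 2$ and $d\in\{1,\ldots,n-1\}$, and assume that $d$ divides $n$. The functions $\mu_n(\cdot|1)_{\min(d,1)},\ldots,\mu_n(\cdot|n-d)_{\min(d,n-d)}$ (that is, the functions $\mu_n(\cdot|e)_{\min(d,e)}$ for $1\le e\le n-d$) are smoothly independent on $\bigcap_{e=1}^{n-d}\mathcal{I}_n(d,e)_{\min(d,e)}$.
   Context: Norms on $\mathbb{R}^n$ and its exterior powers are Euclidean (the standard basis of each exterior power being orthonormal). A subspace of $\mathbb{R}^n$ is rational if it has a basis of vectors with rational coordinates; $\mathcal{R}_n(e)$ is the set of rational subspaces of dimension $e$ of $\mathbb{R}^n$. The height of $B\in\mathcal{R}_n(e)$ is $H(B)=\|X_1\wedge\cdots\wedge X_e\|$ for any $\mathbb{Z}$-basis $X_1,\ldots,X_e$ of $B\cap\mathbb{Z}^n$ (equivalently, the Euclidean norm of a vector of Plücker coordinates of $B$ with coprime integer entries). Put $g(d,e,n)=\max(0,d+e-n)$. For $1\le j\le \min(d,e)-g(d,e,n)$, a subspace $A$ of dimension $d$ of $\mathbb{R}^n$ is $(e,j)$-irrational if $\dim(A\cap B)<j+g(d,e,n)$ for all $B\in\mathcal{R}_n(e)$; $\mathcal{I}_n(d,e)_j$ is the set of all $(e,j)$-irrational subspaces of dimension $d$ of $\mathbb{R}^n$. For nonzero $X,Y\in\mathbb{R}^n$, $\omega(X,Y)=\|X\wedge Y\|/(\|X\|\,\|Y\|)$. For subspaces $A,B$ of dimensions $d,e$, define inductively $\omega_1(A,B)=\min\{\omega(X,Y):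 X\in A\setminus\{0\},Y\in B\setminus\{0\}\}$, attained at $(X_1,Y_1)$, and, for $j<\min(d,e)$, $\omega_{j+1}(A,B)=\min\{\omega(X,Y): X\in A_j\setminus\{0\},Y\in B_j\setminus\{0\}\}$, attained at $(X_{j+1},Y_{j+1})$, where $A_j$ (resp. $B_j$) is the orthogonal complement of $\mathrm{Span}(X_1,\ldots,X_j)$ in $A$ (resp. of $\mathrm{Span}(Y_1,\ldots,Y_j)$ in $B$). Set $\psi_j(A,B)=\omega_{j+g(d,e,n)}(A,B)$. For $d,e\in\{1,\ldots,n-1\}$, $1\le j\le\min(d,e)-g(d,e,n)$ and $A\in\mathcal{I}_n(d,e)_j$, the exponent $\mu_n(A|e)_j\in[0,+\infty]$ is the supremum of the set of $\mu>0$ such that there are infinitely many $B\in\mathcal{R}_n(e)$ with $\psi_j(A,B)\le H(B)^{-\mu}$. For a set $W$ and functions $f_1,\ldots,f_k:W\to\mathbb{R}\cup\{+\infty\}$, we say $f_1,\ldots,f_k$ are smoothly independent on $W$ if there is no (smooth) submersion $h:\mathbb{R}^k\to\mathbb{R}$ such that for all $w\in W$: $(f_1(w),\ldots,f_k(w))\in\mathbb{R}^k\Rightarrow h(f_1(w),\ldots,f_k(w))=0$. *)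

(* Defs.v *)
From HB Require Import structures.
From mathcomp Require Import all_boot all_order all_algebra.
From mathcomp Require Import all_classical all_reals all_analysis.

Set Implicit Arguments.
Unset Strict Implicit.
Unset Printing Implicit Defensive.

Import Order.TTheory GRing.Theory Num.Theory.
Import numFieldNormedType.Exports.

Local Open Scope classical_set_scope.
Local Open Scope ring_scope.

Section Euclidean.
Variables (R : realType) (n : nat).

(* The norm of 'rV[R]_n provided by the library is the sup norm, hence the
   explicit Euclidean one. *)
Definition dot (X Y : 'rV[R]_n) : R := \sum_(i < n) X 0 i * Y 0 i.

Definition enorm (X : 'rV[R]_n) : R := Num.sqrt (dot X X).

Definition increasing_idx e (f : {ffun 'I_e -> 'I_n}) : bool :=
  [forall i : 'I_e, forall j : 'I_e, (i < j)%N ==> (f i < f j)%N].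

(* Euclidean norm of X_1 /\ ... /\ X_e, where X_1, ..., X_e are the rows of M:
   its coordinate on the basis vector e_(f 0) /\ ... /\ e_(f (e-1)), f
   increasing, is the minor of M on the columns f 0 < ... < f (e-1). *)
Definition wedge_norm e (M : 'M[R]_(e, n)) : R :=
  Num.sqrt (\sum_(f : {ffun 'I_e -> 'I_n} | increasing_idx f)
              (\det (colsub f M)) ^+ 2).

Definition omega_vect (X Y : 'rV[R]_n) : R :=
  wedge_norm (col_mx X Y) / (enorm X * enorm Y).

End Euclidean.

Section Subspaces.
Variables (R : realType) (n : nat).
Implicit Types A B : {vspace 'rV[R]_n}.

Definition rational_subspace B : Prop :=
  exists s : seq 'rV[rat]_n, basis_of B [seq map_mx ratr X | X <- s].

Definition rational_subspaces (e : nat) : set {vspace 'rV[R]_n} :=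
  [set B | rational_subspace B /\ \dim B = e].

(* The rows of M form a Z-basis of the intersection of B with Z^n. *)
Definition is_Zbasis e (M : 'M[int]_(e, n)) B : Prop :=
  injective (fun c : 'rV[int]_e => c *m M) /\
  (forall v : 'rV[int]_n,
     map_mx intr v \in B <-> exists c : 'rV[int]_e, v = c *m M).

(* For rational B, Z-bases exist and the norm does not depend on the one
   chosen, so [xget] selects the common value. *)
Definition height B : R :=
  xget 0 [set wedge_norm (map_mx intr M : 'M[R]_(\dim B, n)) |
            M in [set M : 'M[int]_(\dim B, n) | is_Zbasis M B]].

Definition gdef (d e : nat) : nat := (d + e - n)%N.

Definition irrational_subspaces (d e j : nat) : set {vspace 'rV[R]_n} :=
  [set A | \dim A = d /\
     forall B, rational_subspaces e B -> (\dim (A :&: B) < j + gdef d e)%N].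

Definition orth_in A (s : seq 'rV[R]_n) : set 'rV[R]_n :=
  [set X | X \in A /\ forall Z, Z \in span s -> dot X Z = 0].

Definition omega_minimizer (S T : set 'rV[R]_n) (P : 'rV[R]_n * 'rV[R]_n) :
  Prop :=
  [/\ S P.1 /\ P.1 != 0, T P.2 /\ P.2 != 0 &
      forall X Y, S X -> X != 0 -> T Y -> Y != 0 ->
        omega_vect P.1 P.2 <= omega_vect X Y].

(* [next_pair A B s] is (X_(j+1), Y_(j+1)), where s lists the j previous pairs.
   The values omega_vect X_j Y_j do not depend on the minimizers selected. *)
Definition next_pair A B (s : seq ('rV[R]_n * 'rV[R]_n)) :
  'rV[R]_n * 'rV[R]_n :=
  xget (0, 0)
    [set P | omega_minimizer (orth_in A (unzip1 s)) (orth_in B (unzip2 s)) P].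

Fixpoint first_pairs A B (j : nat) : seq ('rV[R]_n * 'rV[R]_n) :=
  if j is i.+1 then
    let s := first_pairs A B i in rcons s (next_pair A B s)
  else [::].

(* Meaningful for 1 <= j <= min (\dim A) (\dim B). *)
Definition omega (j : nat) A B : R :=
  let P := next_pair A B (first_pairs A B j.-1) in omega_vect P.1 P.2.

Definition psi (j : nat) A B : R := omega (j + gdef (\dim A) (\dim B)) A B.

(* The exponent lies in [0, +oo]: an empty set has supremum 0, not -oo. *)
Definition mu_exponent (e j : nat) A : \bar R :=
  maxe 0%E (ereal_sup [set m%:E | m in [set m : R | 0 < m /\
    infinite_set [set B | rational_subspaces e B /\
                          psi j A B <= height B `^ (- m)]]]).

End Subspaces.

Section SmoothIndependence.
Variables (R : realType) (k : nat).
Implicit Type h : 'rV[R]_k -> R.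

Definition iter_partial (s : seq 'I_k) h : 'rV[R]_k -> R :=
  foldr (fun i g => fun x => 'D_(delta_mx 0 i) g x) h s.

(* C^oo: h and all its iterated partial derivatives are differentiable. *)
Definition smooth h : Prop :=
  forall (s : seq 'I_k) (x : 'rV[R]_k), differentiable (iter_partial s h) x.

Definition submersion h : Prop :=
  smooth h /\ forall (x : 'rV[R]_k) (y : R), exists v, 'd h x v = y.

Definition smoothly_independent (T : Type) (W : set T) (f : 'I_k -> T -> \bar R) :
  Prop :=
  ~ exists h : 'rV[R]_k -> R, submersion h /\
      forall w, W w ->
        forall x : 'rV[R]_k, (forall i, f i w = (x 0 i)%:E) -> h x = 0.

End SmoothIndependence.

(* Main.v *)
Require Import Defs.
From mathcomp Require Import all_boot all_order all_algebra fingroup perm.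
From mathcomp Require Import all_classical all_reals all_analysis.
From mathcomp Require Import ring lra zify.

Set Implicit Arguments.
Unset Strict Implicit.
Unset Printing Implicit Defensive.

Import Order.TTheory GRing.Theory Num.Theory.
Import numFieldNormedType.Exports.

Local Open Scope classical_set_scope.
Local Open Scope ring_scope.

(** The subspace A is built from binary expansions, and its exponents are computed
    exactly.

    Put N = n - d, a multiple of d, and let a_0 < a_1 < ... be integers growing at
    least geometrically. In R^(d + N), with coordinates x_i (i < d) and y_t (t < N),
    let A be defined by y_t = xi_t x_(t mod d), where xi_t is the sum of the numbers
    2^-(a_k) over the k congruent to t modulo N. Truncating the expansions after the
    step k gives an integer vector of norm about 2^(a_k), close to the generator of A
    of index k mod d, with a relative error about 2^-(a_(k + d)). The e consecutive
    truncations K <= k < K + e span a rational subspace of height about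
    2^(a_K + ... + a_(K + min(d, e) - 1)), and the last principal sine of this
    subspace and A is about 2^-(a_(K + max(d, e))).

    Nothing does essentially better. If B is close to A, the Liouville inequality
    ([liouville], when e >= d) or the small integer generators of B
    ([small_generators], when e <= d) show that B satisfies the same linear equations
    as truncations. These equations involve irreducible fractions with denominators
    2^(a_k), so that the integer points of B satisfy divisibility conditions, and
    these bound the height from below ([height_window], [close_bounds]). For
    a_k close to alpha_k, the exponent in dimension e is therefore the largest limit
    value of alpha_(K + max(d, e)) / (alpha_K + ... + alpha_(K + min(d, e) - 1))
    ([mu_exponent_value]). The passage between principal sines and distances is
    [near_of_principal] and [omega_le_of_near].

    Take alpha with alpha_(k + N) = lambda alpha_k. If the successive ratios increase
    over a period, the quotient above is largest when K + max(d, e) is a multiple of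
    N, for all e simultaneously ([alpha_window]). With y_k = alpha_k / alpha_N, the
    inverse of the exponent in dimension e is then the sum of y_k over a window of
    length min(d, e) in [0, N). These N linear forms are independent
    ([window_mx_unit]), and the parameters y range over an open set; hence the
    exponents take all values in an open set ([spectrum_interior]). A function that
    vanishes on an open set has zero differential there, so it is not a
    submersion. *)

(** * Euclidean geometry and the Lagrange identity *)
Section Euclid.
Variables (R : realType) (n : nat).
Implicit Types X Y Z : 'rV[R]_n.

Lemma dotC X Y : dot X Y = dot Y X.
Proof. by apply: eq_bigr => i _; rewrite mulrC. Qed.

Lemma dotDl X Y Z : dot (X + Y) Z = dot X Z + dot Y Z.
Proof. by rewrite -big_split; apply: eq_bigr => i _; rewrite mxE mulrDl. Qed.

Lemma dotZl a X Y : dot (a *: X) Y = a * dot X Y.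
Proof. by rewrite /dot mulr_sumr; apply: eq_bigr => i _; rewrite mxE mulrA. Qed.

Lemma dotDr X Y Z : dot Z (X + Y) = dot Z X + dot Z Y.
Proof. by rewrite dotC dotDl !(dotC Z). Qed.

Lemma dotZr a X Y : dot X (a *: Y) = a * dot X Y.
Proof. by rewrite dotC dotZl dotC. Qed.

Lemma dotNl X Y : dot (- X) Y = - dot X Y.
Proof. by rewrite -scaleN1r dotZl mulN1r. Qed.

Lemma dotNr X Y : dot X (- Y) = - dot X Y.
Proof. by rewrite dotC dotNl dotC. Qed.

Lemma dot0l X : dot 0 X = 0.
Proof. by rewrite -(scale0r 0) dotZl mul0r. Qed.

Lemma dot_suml (I : Type) (r : seq I) (F : I -> 'rV[R]_n) Z :
  dot (\sum_(i <- r) F i) Z = \sum_(i <- r) dot (F i) Z.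
Proof.
elim: r => [|i r IH]; first by rewrite !big_nil dot0l.
by rewrite !big_cons dotDl IH.
Qed.

Lemma dot_ge0 X : 0 <= dot X X.
Proof. by apply: sumr_ge0 => i _; rewrite -expr2 sqr_ge0. Qed.

Lemma dot_eq0 X : (dot X X == 0) = (X == 0).
Proof.
apply/eqP/eqP => [|->]; last by rewrite dot0l.
move=> h; apply/rowP => i; rewrite mxE.
have /psumr_eq0P /(_ i isT)/eqP : \sum_(i < n) X 0 i * X 0 i = 0 := h.
by rewrite mulf_eq0 orbb => H; apply/eqP/H => j _; rewrite -expr2 sqr_ge0.
Qed.

Lemma dot_gt0 X : (0 < dot X X) = (X != 0).
Proof. by rewrite lt0r dot_eq0 dot_ge0 andbT. Qed.

Lemma enorm_ge0 X : 0 <= enorm X.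
Proof. exact: sqrtr_ge0. Qed.

Lemma enorm_sqr X : enorm X ^+ 2 = dot X X.
Proof. by rewrite sqr_sqrtr // dot_ge0. Qed.

Lemma enorm_eq0 X : (enorm X == 0) = (X == 0).
Proof. by rewrite -sqrf_eq0 enorm_sqr dot_eq0. Qed.

Lemma enorm_gt0 X : (0 < enorm X) = (X != 0).
Proof. by rewrite lt0r enorm_eq0 enorm_ge0 andbT. Qed.

Lemma enormZ a X : enorm (a *: X) = `|a| * enorm X.
Proof.
by rewrite /enorm dotZl dotZr mulrA -expr2 sqrtrM ?sqr_ge0// sqrtr_sqr.
Qed.

Lemma det2 (M : 'M[R]_(1 + 1)) :
  \det M = M ord0 ord0 * M ord_max ord_max - M ord0 ord_max * M ord_max ord0.
Proof.
rewrite (expand_det_row _ ord0) !big_ord_recl big_ord0 /cofactor !det_mx11 !mxE /=.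
have -> : lift ord0 ord0 = ord_max :> 'I_(1 + 1) by apply: val_inj.
have -> : lift ord_max ord0 = ord0 :> 'I_(1 + 1) by apply: val_inj.
by rewrite !expr0 ?expr1 !mul1r addr0 mulN1r mulrN.
Qed.

(** The increasing maps from two indices are the pairs p with p.1 < p.2; this
    turns the wedge norm of two vectors into an ordinary double sum. *)
Lemma sum_sqr_wedge2 X Y :
  \sum_(f : {ffun 'I_(1 + 1) -> 'I_n} | increasing_idx f)
     (\det (colsub f (col_mx X Y))) ^+ 2 =
  \sum_(p : 'I_n * 'I_n | (p.1 < p.2)%N)
     (X 0 p.1 * Y 0 p.2 - X 0 p.2 * Y 0 p.1) ^+ 2.
Proof.
pose h (p : 'I_n * 'I_n) : {ffun 'I_(1 + 1) -> 'I_n} :=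
  [ffun i => if i == ord0 then p.1 else p.2].
pose i0 : 'I_(1 + 1) := ord0; pose i1 : 'I_(1 + 1) := ord_max.
have h0 p : h p i0 = p.1 by rewrite ffunE.
have h1 p : h p i1 = p.2 by rewrite ffunE.
have i01 (i : 'I_(1 + 1)) : i = i0 \/ i = i1.
  by case: i => [[|[|]]//= ?]; [left|right]; apply: val_inj.
rewrite (reindex_onto h (fun f => (f i0, f i1))); last first.
  move=> f _; apply/ffunP => i; rewrite ffunE.
  by case: (i01 i) => ->.
apply: eq_big => [p|p _].
  rewrite h0 h1 -surjective_pairing eqxx andbT.
  apply/forallP/idP => [H|H i].
    by have /forallP/(_ i1)/implyP := H i0; rewrite h0 h1; apply.
  apply/forallP => j; apply/implyP.
  by case: (i01 i) (i01 j) => -> [] ->; rewrite ?h0 ?h1.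
congr (_ ^+ 2); rewrite det2 -/i0 -/i1.
have -> : i0 = lshift 1 (ord0 : 'I_1) by apply: val_inj.
have -> : i1 = rshift 1 (ord0 : 'I_1) by apply: val_inj.
rewrite !mxE !(unsplitK (inl ord0)) !(unsplitK (inr ord0)) !ffunE /= ?ord1; ring.
Qed.

(** Summing the squared 2 x 2 minors over all ordered pairs counts each of them
    twice, and the full double sum factors. *)
Lemma lagrange_identity X Y :
  wedge_norm (col_mx X Y) ^+ 2 = dot X X * dot Y Y - dot X Y ^+ 2.
Proof.
rewrite /wedge_norm sqr_sqrtr; last by apply: sumr_ge0 => i _; rewrite sqr_ge0.
rewrite sum_sqr_wedge2.
pose F (p : 'I_n * 'I_n) := (X 0 p.1 * Y 0 p.2 - X 0 p.2 * Y 0 p.1) ^+ 2.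
rewrite -/F.
have swap : \sum_(p : 'I_n * 'I_n | (p.2 < p.1)%N) F p
          = \sum_(p : 'I_n * 'I_n | (p.1 < p.2)%N) F p.
  rewrite (reindex_inj (h := fun p : 'I_n * 'I_n => (p.2, p.1))) /=.
    by apply: eq_bigr => p _; rewrite /F /= -sqrrN opprB.
  by move=> [a b] [c e] [-> ->].
have tot : \sum_p F p = (\sum_(p : 'I_n * 'I_n | (p.1 < p.2)%N) F p) *+ 2.
  rewrite (bigID (fun p : 'I_n * 'I_n => (p.1 < p.2)%N)) /= mulr2n.
  congr (_ + _); rewrite -[RHS]swap.
  rewrite (bigID (fun p : 'I_n * 'I_n => (p.2 < p.1)%N)) /=.
  rewrite [X in _ + X]big1 ?addr0.
    apply: eq_bigl => p.
    by case: ltngtP.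
  move=> [a b] /=; rewrite -!leqNgt => /andP[h1 h2].
  have -> : a = b by apply: val_inj; apply/eqP; rewrite eqn_leq h1 h2.
  by rewrite /F /= subrr expr0n.
suff : \sum_p F p = (dot X X * dot Y Y - dot X Y ^+ 2) *+ 2.
  by rewrite tot => /eqP; rewrite eqrMn2r /= => /eqP.
have -> : \sum_p F p = \sum_i \sum_j ((X 0 i * X 0 i) * (Y 0 j * Y 0 j)
   + (Y 0 i * Y 0 i) * (X 0 j * X 0 j)
   - (X 0 i * Y 0 i) * (X 0 j * Y 0 j) *+ 2).
  rewrite pair_bigA; apply: eq_bigr => p _; rewrite /F/=; ring.
under eq_bigr => i _ do rewrite sumrB big_split /= sumrMnl -!mulr_sumr.
rewrite sumrB big_split /= sumrMnl -!mulr_suml.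
by rewrite -![\sum_i _]/(dot _ _); ring.
Qed.

Lemma cauchy_schwarz X Y : dot X Y ^+ 2 <= dot X X * dot Y Y.
Proof. by rewrite -subr_ge0 -lagrange_identity sqr_ge0. Qed.

Lemma dot_le_enorm X Y : dot X Y <= enorm X * enorm Y.
Proof.
apply: le_trans (ler_norm _) _.
rewrite -(@ler_pXn2r _ 2) ?nnegrE ?mulr_ge0 ?enorm_ge0//.
by rewrite exprMn !enorm_sqr real_normK ?num_real// cauchy_schwarz.
Qed.

Lemma enormD X Y : enorm (X + Y) <= enorm X + enorm Y.
Proof.
rewrite -(@ler_pXn2r _ 2) ?nnegrE ?addr_ge0 ?enorm_ge0//.
rewrite sqrrD !enorm_sqr dotDl !dotDr (dotC Y X).
have := dot_le_enorm X Y; lra.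
Qed.

Lemma enorm_sum (I : Type) (r : seq I) (F : I -> 'rV[R]_n) :
  enorm (\sum_(i <- r) F i) <= \sum_(i <- r) enorm (F i).
Proof.
elim: r => [|i r IH]; first by rewrite !big_nil /enorm dot0l sqrtr0.
by rewrite !big_cons; apply: le_trans (enormD _ _) _; rewrite lerD2l.
Qed.

Lemma coord_le_enorm X i : `|X 0 i| <= enorm X.
Proof.
rewrite -sqrtr_sqr ler_sqrt ?dot_ge0// /dot (bigD1 i)//= -expr2 lerDl.
by apply: sumr_ge0 => j _; rewrite -expr2 sqr_ge0.
Qed.

Lemma enorm_le_sum X : enorm X <= \sum_i `|X 0 i|.
Proof.
have -> : X = \sum_i X 0 i *: delta_mx 0 i by exact: row_sum_delta.
apply: le_trans (enorm_sum _ _) _.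
apply: ler_sum => i _; rewrite enormZ.
have -> : enorm (delta_mx 0 i : 'rV[R]_n) = 1.
  rewrite /enorm /dot (bigD1 i)//= big1 ?addr0; first by rewrite mxE !eqxx mulr1 sqrtr1.
  by move=> j ji; rewrite mxE eqxx /= (negPf ji) mul0r.
by rewrite mulr1 -row_sum_delta.
Qed.

(** [omega_vect] is the sine of the angle, so minimizing it amounts to maximizing
    the squared cosine; all later arguments use the latter. *)
Lemma omega_vect_sqr X Y : X != 0 -> Y != 0 ->
  omega_vect X Y ^+ 2 = 1 - dot X Y ^+ 2 / (dot X X * dot Y Y).
Proof.
rewrite -!dot_gt0 => X0 Y0.
rewrite /omega_vect expr_div_n lagrange_identity exprMn !enorm_sqr.
by rewrite mulrBl mulfV // mulf_neq0 // gt_eqF.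
Qed.

Lemma omega_vect_ge0 X Y : 0 <= omega_vect X Y.
Proof. by rewrite divr_ge0 ?mulr_ge0 ?enorm_ge0 // sqrtr_ge0. Qed.

Lemma omega_vectC X Y : omega_vect X Y = omega_vect Y X.
Proof.
rewrite /omega_vect [enorm Y * _]mulrC; congr (_ / _).
apply/eqP; rewrite -(@eqrXn2 _ 2) ?sqrtr_ge0//.
by rewrite !lagrange_identity (dotC Y X) [dot Y Y * _]mulrC.
Qed.

Lemma omega_vect_le X Y X' Y' : X != 0 -> Y != 0 -> X' != 0 -> Y' != 0 ->
  (omega_vect X Y <= omega_vect X' Y') =
  (dot X' Y' ^+ 2 / (dot X' X' * dot Y' Y') <= dot X Y ^+ 2 / (dot X X * dot Y Y)).
Proof.
move=> *; rewrite -(@ler_pXn2r _ 2) ?nnegrE ?omega_vect_ge0// !omega_vect_sqr//.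
by rewrite lerD2l lerN2.
Qed.

End Euclid.

(** * Orthogonal projections *)
Section Projection.
Variables (R : realType) (n : nat).
Implicit Types (X Y Z : 'rV[R]_n) (A B : {vspace 'rV[R]_n}).

Lemma dot_mulmx X Y : (X *m Y^T) 0 0 = dot X Y.
Proof. by rewrite mxE; apply: eq_bigr => i _; rewrite !mxE. Qed.

Lemma vspace_rows B : exists M : 'M[R]_(\dim B, n),
  (forall Z, Z \in B <-> exists c, Z = c *m M) /\
  (forall c : 'rV_(\dim B), c *m M = 0 -> c = 0).
Proof.
pose M := \matrix_(i < \dim B) (vbasis B)`_i.
have ME (c : 'rV_(\dim B)) : c *m M = \sum_i c 0 i *: (vbasis B)`_i.
  by rewrite mulmx_sum_row; apply: eq_bigr => i _; rewrite rowK.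
exists M; split=> [Z|c].
  split=> [ZB|[c ->]].
    exists (\row_i coord (vbasis B) i Z).
    by rewrite ME [LHS](coord_vbasis ZB); apply: eq_bigr => i _; rewrite mxE.
  rewrite ME; apply: memv_suml => i _; apply: memvZ.
  by apply: vbasis_mem; apply: mem_nth; rewrite size_tuple.
rewrite ME => h; apply/rowP => i; rewrite mxE.
have /freeP := basis_free (vbasisP B).
by move=> /(_ (fun i => c 0 i)); apply.
Qed.

(** The Gram matrix of independent rows is invertible: a vector c of its kernel
    has c M of norm zero. *)
Lemma mulmxTr_unit e (M : 'M[R]_(e, n)) :
  (forall c : 'rV_e, c *m M = 0 -> c = 0) -> M *m M^T \in unitmx.
Proof.
move=> Minj; rewrite -row_free_unit -kermx_eq0; apply/rowV0P => c /sub_kermxP cG.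
apply: Minj; apply/eqP; rewrite -dot_eq0 -dot_mulmx.
by rewrite trmx_mul mulmxA -(mulmxA c) cG mul0mx mxE.
Qed.

(** With G the Gram matrix of a row basis M, the projection is X M^T G^-1 M. *)
Lemma orthogonal_projection B X :
  exists2 Y, Y \in B & forall Z, Z \in B -> dot (X - Y) Z = 0.
Proof.
have [M [MB Minj]] := vspace_rows B.
have Gu := mulmxTr_unit Minj.
exists (X *m M^T *m invmx (M *m M^T) *m M); first by apply/MB; eexists.
move=> Z /MB[c ->]; rewrite -dot_mulmx trmx_mul mulmxA mulmxBl.
by rewrite -(mulmxA _ M) mulmxKV // subrr mul0mx mxE.
Qed.

Lemma exists_orth A (s : seq 'rV[R]_n) : (size s < \dim A)%N ->
  exists X, [/\ X \in A, X != 0 & forall Z, Z \in s -> dot X Z = 0].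
Proof.
move=> sA; have [M [MA Minj]] := vspace_rows A.
pose S : 'M[R]_(size s, n) := \matrix_i s`_i.
have : ~~ row_free (M *m S^T).
  rewrite -row_leq_rank -ltnNge; apply: leq_ltn_trans sA.
  exact: rank_leq_col.
rewrite -kermx_eq0 => /rowV0Pn[c /sub_kermxP cMS c0].
exists (c *m M); split; first by apply/MA; eexists.
  by apply: contra c0 => /eqP/Minj ->.
move=> Z Zs; have [i <-] : exists i : 'I_(size s), row i S = Z.
  exists (Ordinal (etrans (index_mem Z s) Zs)).
  by rewrite rowK nth_index.
rewrite -dot_mulmx tr_row -[c *m M *m _]/(c *m M *m _).
have -> : col i S^T = S^T *m delta_mx i 0 by rewrite colE.
by rewrite mulmxA -(mulmxA c) cMS mul0mx mxE.
Qed.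

Lemma orth_span (s : seq 'rV[R]_n) X :
  (forall Z, Z \in s -> dot X Z = 0) <->
  (forall Z, Z \in (span s)%VS -> dot X Z = 0).
Proof.
split=> h Z Zs; last by apply: h; exact: memv_span.
have -> : Z = \sum_i coord (in_tuple s) i Z *: s`_i.
  exact: (@coord_span _ _ _ (in_tuple s)).
rewrite dotC dot_suml big1 // => i _.
by rewrite dotZl dotC h ?mulr0 // mem_nth.
Qed.

Lemma mem_vspace_orth A X :
  (forall Z, (forall W, W \in A -> dot W Z = 0) -> dot X Z = 0) -> X \in A.
Proof.
move=> h; have [Y YA XY] := orthogonal_projection A X.
have XY' Z : Z \in A -> dot Z (X - Y) = 0 by move=> ZA; rewrite dotC XY.
suff /eqP : dot (X - Y) (X - Y) == 0 by move/eqP; rewrite dot_eq0 subr_eq0 => /eqP->.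
by rewrite {1}dotDl dotNl h // XY' // subr0.
Qed.

Lemma orth_inE A s X :
  orth_in A s X <-> X \in A /\ forall Z, Z \in s -> dot X Z = 0.
Proof. by split=> -[XA /orth_span]. Qed.

(** The sets [orth_in A s] are all of this form, which makes it clear that they
    are linear and closed. *)
Definition polar (Q : set 'rV[R]_n) : set 'rV[R]_n :=
  [set X | forall Z, Q Z -> dot X Z = 0].

Lemma orth_in_polar A s : exists Q, orth_in A s = polar Q.
Proof.
exists [set Z | (forall W, W \in A -> dot W Z = 0) \/ Z \in s].
apply/seteqP; split=> X; rewrite orth_inE.
  by move=> [XA Xs] Z [h|]; [exact: h|exact: Xs].
move=> h; split; first by apply: mem_vspace_orth => Z hZ; apply: h; left.
by move=> Z Zs; apply: h; right.
Qed.

Lemma polarZ Q a X : polar Q X -> polar Q (a *: X).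
Proof. by move=> h Z /h XZ; rewrite dotZl XZ mulr0. Qed.

Lemma polarD Q X Y : polar Q X -> polar Q Y -> polar Q (X + Y).
Proof. by move=> hX hY Z QZ; rewrite dotDl hX // hY // addr0. Qed.

End Projection.

(** * Pairs of minimal angle *)
Section Minimizers.
Variables (R : realType) (n : nat).
Implicit Types (X Y Z : 'rV[R]_n).

Lemma continuous_dot (T : topologicalType) (f g : T -> 'rV[R]_n) :
  continuous f -> continuous g -> continuous (fun x => dot (f x) (g x)).
Proof.
move=> cf cg x; rewrite /dot.
apply: (@cvg_big R^o 'I_n (fun x y => x + y) 0 xpredT _ _ (nbhs x) _
   (fun i y => f y 0 i * g y 0 i)) => [|i _]; first exact: (@add_continuous R^o).
apply: cvgM.
  exact: (cvg_comp _ _ (cf x) (@coord_continuous _ 1 n 0 i (f x))).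
exact: (cvg_comp _ _ (cg x) (@coord_continuous _ 1 n 0 i (g x))).
Qed.

Lemma closed_polar (Q : set 'rV[R]_n) : closed (polar Q).
Proof.
have -> : polar Q = \bigcap_(Z in Q) ((fun X => dot X Z) @^-1` [set 0]).
  by apply/seteqP; split=> X h Z QZ; apply: h.
apply: closed_bigI => Z _; apply: preimage_closed; last exact: closed_eq.
move=> X _; apply: (@continuous_dot _ id (fun=> Z)) => Y; [exact: cvg_id|apply: cvg_cst]; exact: nbhs_filter.
Qed.

Definition unit_polar (Q : set 'rV[R]_n) := polar Q `&` [set X | dot X X = 1].

Lemma compact_unit_polar Q : compact (unit_polar Q).
Proof.
apply: bounded_closed_compact.
  exists 1; split=> // M M1 X [_ X1]; apply: le_trans (ltW M1).
  rewrite /Num.norm /= mx_normrE; apply/bigmax_leP; split=> // -[i j] _ /=.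
  rewrite ord1; apply: le_trans (coord_le_enorm _ _) _.
  by rewrite /enorm X1 sqrtr1.
apply: closedI; first exact: closed_polar.
apply: (@preimage_closed _ _ (fun X => dot X X) [set 1]); last exact: closed_eq.
by move=> X _; apply: (@continuous_dot _ id id) => Y; exact: cvg_id.
Qed.

Lemma unit_polar_normalize Q X : polar Q X -> X != 0 ->
  unit_polar Q ((enorm X)^-1 *: X).
Proof.
move=> QX X0; split; first exact: polarZ.
rewrite /= dotZl dotZr -enorm_sqr mulrA -expr2 -exprMn mulVf ?expr1n //.
by rewrite enorm_eq0.
Qed.

(** By homogeneity it suffices to maximize the scalar product on a product of two
    unit spheres, which is compact; replacing x by -x shows that the maximum is
    also the maximum of the absolute value. *)
Lemma minimizer_exists (Q Q' : set 'rV[R]_n) X0 Y0 :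
  polar Q X0 -> X0 != 0 -> polar Q' Y0 -> Y0 != 0 ->
  exists P, omega_minimizer (polar Q) (polar Q') P.
Proof.
move=> QX0 X00 QY0 Y00.
have K0 : unit_polar Q `*` unit_polar Q' !=set0.
  by exists ((enorm X0)^-1 *: X0, (enorm Y0)^-1 *: Y0); split;
    exact: unit_polar_normalize.
have Kc : compact (unit_polar Q `*` unit_polar Q').
  by apply: compact_setX; exact: compact_unit_polar.
pose f (p : 'rV[R]_n * 'rV[R]_n) := dot p.1 p.2.
have [|P] := compact_EVT_max (f := f) K0 Kc.
  apply: continuous_subspaceT; apply: continuous_dot => p.
    exact: cvg_fst.
  exact: cvg_snd.
rewrite inE => -[[QP1 P1] [QP2 P2]] maxP.
have nz Z : dot Z Z = 1 -> Z != 0.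
  by move=> Z1; rewrite -dot_eq0 Z1 oner_eq0.
exists P; split; [by split=> //; exact: nz|by split=> //; exact: nz|].
move=> X Y QX X_neq0 QY Y_neq0.
rewrite omega_vect_le ?(nz _ P1) ?(nz _ P2)// P1 P2 mulr1 divr1.
pose x := (enorm X)^-1 *: X; pose y := (enorm Y)^-1 *: Y.
have [Qx x1] := unit_polar_normalize QX X_neq0.
have [Qy y1] := unit_polar_normalize QY Y_neq0.
have -> : dot X Y ^+ 2 / (dot X X * dot Y Y) = dot x y ^+ 2.
  rewrite /x /y dotZl dotZr !exprMn !exprVn !enorm_sqr invfM.
  by ring.
have h1 : dot x y <= dot P.1 P.2.
  by apply: (maxP (x, y)); rewrite inE; split; split.
have h2 : - dot x y <= dot P.1 P.2.
  rewrite -dotNl; apply: (maxP (- x, y)); rewrite inE; split; split=> //=.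
    by rewrite -scaleN1r; apply: polarZ.
  by rewrite dotNl dotNr opprK.
have : (dot P.1 P.2 - dot x y) * (dot P.1 P.2 + dot x y) >= 0.
  by apply: mulr_ge0; lra.
lra.
Qed.

(** First order condition at a minimal pair: moving P.1 in a direction X
    orthogonal to it must not decrease the angle, which forces X to be orthogonal
    to P.2 as well. *)
Lemma minimizer_orth (Q Q' : set 'rV[R]_n) P X :
  omega_minimizer (polar Q) (polar Q') P -> polar Q X -> dot X P.1 = 0 ->
  dot X P.2 = 0.
Proof.
move=> [[QP1 P1] [QP2 P2] minP] QX XP1.
have [-> | X0] := eqVneq X 0; first by rewrite dot0l.
set c := dot P.1 P.2; set b := dot X P.2.
have P1p : 0 < dot P.1 P.1 by rewrite dot_gt0.
have P2p : 0 < dot P.2 P.2 by rewrite dot_gt0.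
have Xp : 0 < dot X X by rewrite dot_gt0.
(* The direction P.1 + t X with the optimal t = b |P.1|^2 / (c |X|^2), scaled so
   that no division by c is needed. *)
set Z := (c * dot X X) *: P.1 + (b * dot P.1 P.1) *: X.
have QZ : polar Q Z by apply: polarD; apply: polarZ.
have ZZ : dot Z Z = (c * dot X X) ^+ 2 * dot P.1 P.1
                  + (b * dot P.1 P.1) ^+ 2 * dot X X.
  rewrite /Z !(dotDl, dotDr, dotZl, dotZr) (dotC P.1 X) XP1; ring.
have ZP2 : dot Z P.2 = c ^+ 2 * dot X X + b ^+ 2 * dot P.1 P.1.
  by rewrite /Z !(dotDl, dotZl) -/b -/c; ring.
have [Z0|Z0] := eqVneq Z 0.
  have : c ^+ 2 * dot X X + b ^+ 2 * dot P.1 P.1 = 0 by rewrite -ZP2 Z0 dot0l.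
  move=> h; have := mulr_ge0 (sqr_ge0 c) (ltW Xp).
  have := mulr_ge0 (sqr_ge0 b) (ltW P1p) => h1 h2.
  have /eqP : b ^+ 2 * dot P.1 P.1 = 0 by lra.
  by rewrite mulf_eq0 sqrf_eq0 (gt_eqF P1p) orbF => /eqP.
have := minP Z P.2 QZ Z0 QP2 P2.
have Zp : 0 < dot Z Z by rewrite dot_gt0.
rewrite omega_vect_le // -/c ZP2 !invfM !mulrA ler_pM2r ?invr_gt0//.
rewrite ler_pdivrMr // [_ / dot P.1 P.1 * _]mulrAC ler_pdivlMr // ZZ.
set p := dot P.1 P.1 in P1p *; set x := dot X X in Xp *.
have -> : c ^+ 2 * ((c * x) ^+ 2 * p + (b * p) ^+ 2 * x) =
  p * (c ^+ 2 * x) * (c ^+ 2 * x + b ^+ 2 * p) by ring.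
move=> h.
have T0 : 0 < c ^+ 2 * x + b ^+ 2 * p.
  have T1 : 0 <= c ^+ 2 * x + b ^+ 2 * p.
    by apply: addr_ge0; apply: mulr_ge0; rewrite ?sqr_ge0 ?ltW.
  rewrite lt0r T1 andbT.
  apply/eqP => h0; move: Zp; rewrite ZZ.
  have -> : (c * x) ^+ 2 * p + (b * p) ^+ 2 * x = p * x * (c ^+ 2 * x + b ^+ 2 * p) by ring.
  by rewrite h0 mulr0 ltxx.
move: h; rewrite -subr_ge0.
have -> : p * (c ^+ 2 * x) * (c ^+ 2 * x + b ^+ 2 * p)
   - (c ^+ 2 * x + b ^+ 2 * p) ^+ 2 * p =
   - (b ^+ 2 * (p ^+ 2 * (c ^+ 2 * x + b ^+ 2 * p))) by ring.
rewrite oppr_ge0 pmulr_lle0 ?mulr_gt0 ?exprn_gt0// => h.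
apply/eqP; rewrite -sqrf_eq0; apply/eqP/le_anti; rewrite h sqr_ge0 //.
Qed.

End Minimizers.

(** * Principal pairs and one-sided distances between subspaces *)
Section PrincipalPairs.
Variables (R : realType) (n : nat).
Implicit Types (X Y Z : 'rV[R]_n) (A B : {vspace 'rV[R]_n}).
Implicit Types s : seq ('rV[R]_n * 'rV[R]_n).
Local Notation pnth s i := (nth (0, 0) s i).

(** One-sided relative distance: A lies within delta of B. For dim A <= dim B the
    least such delta is comparable to the largest principal sine. *)
Definition near_sub (delta : R) A B :=
  forall X, X \in A -> exists2 Y, Y \in B & enorm (X - Y) <= delta * enorm X.

(** The relation satisfied by [first_pairs]; stating it for an arbitrary list makes
    it symmetric in A and B, whereas the pairs selected for (A, B) and for (B, A)
    need not correspond to each other. *)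
Definition principal A B s := forall j, (j < size s)%N ->
  omega_minimizer (orth_in A (unzip1 (take j s))) (orth_in B (unzip2 (take j s)))
    (pnth s j).

Definition swap_pair (P : 'rV[R]_n * 'rV[R]_n) := (P.2, P.1).

Lemma principal_swap A B s : principal A B s -> principal B A (map swap_pair s).
Proof.
move=> pr j; rewrite size_map => js.
have -> : unzip1 (take j (map swap_pair s)) = unzip2 (take j s).
  by rewrite -map_take /unzip1 -map_comp.
have -> : unzip2 (take j (map swap_pair s)) = unzip1 (take j s).
  by rewrite -map_take /unzip2 -map_comp.
rewrite (nth_map (0, 0)) //=; case: (pr j js) => h1 h2 h3.
by split=> //= X Y *; rewrite !(omega_vectC _ (_.1)) (omega_vectC X) h3.
Qed.

Lemma mem_unzip_take (f : 'rV[R]_n * 'rV[R]_n -> 'rV[R]_n) s i j :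
  (i < j)%N -> (j <= size s)%N -> f (pnth s i) \in map f (take j s).
Proof.
move=> ij js; apply: map_f; rewrite -(nth_take _ ij) mem_nth //.
by rewrite size_takel.
Qed.

Lemma orth_in_take (f : 'rV[R]_n * 'rV[R]_n -> 'rV[R]_n) A s i j :
  (i <= j)%N -> orth_in A (map f (take j s)) `<=` orth_in A (map f (take i s)).
Proof.
move=> ij X /orth_inE[XA Xs]; apply/orth_inE; split=> // Z Zs; apply: Xs.
move: Zs; rewrite -(take_takel _ ij) map_take; exact: mem_take.
Qed.

Section Principal.
Variables (A B : {vspace 'rV[R]_n}) (s : seq ('rV[R]_n * 'rV[R]_n)).
Hypothesis pr : principal A B s.

Lemma pr_mem j : (j < size s)%N ->
  [/\ (pnth s j).1 \in A, (pnth s j).1 != 0, (pnth s j).2 \in B & (pnth s j).2 != 0].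
Proof. by move=> /pr[[/orth_inE[? _] ?] [/orth_inE[? _] ?] _]. Qed.

Lemma pr_orth1 i j : (i < j)%N -> (j < size s)%N ->
  dot (pnth s j).1 (pnth s i).1 = 0.
Proof.
move=> ij js; have [[/orth_inE[_ h] _] _ _] := pr js.
by apply: h; apply: (mem_unzip_take fst) => //; exact: ltnW.
Qed.

(** The pairs are chosen in decreasing sets, hence the minima increase; in
    particular the last one bounds all the others. *)
Lemma pr_mono i j : (i <= j)%N -> (j < size s)%N ->
  omega_vect (pnth s i).1 (pnth s i).2 <= omega_vect (pnth s j).1 (pnth s j).2.
Proof.
move=> ij js; have [_ _ h] := pr (leq_ltn_trans ij js).
have [[h1 ?] [h2 ?] _] := pr js.
by apply: h => //; [exact: (orth_in_take ij h1)|exact: (orth_in_take ij h2)].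
Qed.

(** The vectors on one side are orthogonal to the earlier ones on the other side,
    by the first order condition. *)
Lemma pr_cross i j : (i < j)%N -> (j < size s)%N ->
  dot (pnth s j).1 (pnth s i).2 = 0.
Proof.
move=> ij js; have h := pr (ltn_trans ij js).
have [Q QE] := orth_in_polar A (unzip1 (take i s)).
have [Q' QE'] := orth_in_polar B (unzip2 (take i s)).
rewrite QE QE' in h; apply: (minimizer_orth h); last exact: pr_orth1.
have [[h1 _] _ _] := pr js.
by rewrite -QE; exact: (orth_in_take (ltnW ij) h1).
Qed.

(** When they are as many as the dimension of A, the first vectors of the pairs
    form an orthogonal basis of A, and each component of X has norm at most the
    norm of X. *)
Lemma pr_expand X : size s = \dim A -> X \in A -> exists c : nat -> R,
  X = \sum_(i < size s) c i *: (pnth s i).1 /\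
  forall i : 'I_(size s), `|c i| * enorm (pnth s i).1 <= enorm X.
Proof.
move=> sA XA; pose t := unzip1 s.
have st : size t = size s by rewrite size_map.
have tE i : (i < size s)%N -> t`_i = (pnth s i).1.
  by move=> lti; rewrite (nth_map (0, 0)).
have torth i j : (i < size s)%N -> (j < size s)%N -> i != j ->
    dot t`_i t`_j = 0.
  move=> li lj; rewrite !tE // neq_ltn => /orP[ij|ji]; last exact: pr_orth1.
  by rewrite dotC pr_orth1.
have tdot (c : nat -> R) j : (j < size s)%N ->
    dot (\sum_(i < size s) c i *: t`_i) t`_j = c j * dot t`_j t`_j.
  move=> js; rewrite dot_suml (bigD1 (Ordinal js)) //= dotZl big1 ?addr0 // => i ij.
  by rewrite dotZl torth ?mulr0.
have tpos j : (j < size s)%N -> 0 < dot t`_j t`_j.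
  by move=> js; rewrite tE // dot_gt0; have [] := pr_mem js.
have free_t : free t.
  apply/(@freeP _ _ _ (in_tuple t)) => k /= k0 i.
  have is_ : (i < size s)%N by rewrite -st.
  have := tdot (fun j => if insub j is Some j then k j else 0) i is_.
  rewrite -st (eq_bigr (fun i => k i *: t`_i)); last first.
    by move=> j _; rewrite valK.
  rewrite k0 dot0l valK => /esym/eqP; rewrite mulf_eq0.
  by rewrite (gt_eqF (tpos _ is_)) orbF => /eqP.
have basis_t : basis_of A t.
  rewrite basisEfree free_t /= st sA leqnn andbT.
  apply/span_subvP => _ /mapP[P Ps ->].
  by have [] := pr_mem (etrans (index_mem P s) Ps); rewrite nth_index.
have Xt : X \in <<t>>%VS by rewrite (span_basis basis_t).
pose c i := if insub i is Some j then coord (in_tuple t) j X else 0.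
have XE : X = \sum_(i < size s) c i *: t`_i.
  rewrite -st [LHS](@coord_span _ _ _ (in_tuple t)) //.
  by apply: eq_bigr => i _; rewrite /c valK.
exists c; split.
  by rewrite [LHS]XE; apply: eq_bigr => i _; rewrite tE.
move=> i; rewrite -tE //; have ti := tpos _ (ltn_ord i).
have eti : 0 < enorm t`_i by rewrite enorm_gt0 -dot_gt0.
rewrite -(ler_pM2r eti) -mulrA -expr2 enorm_sqr.
rewrite -[X in _ * X](ger0_norm (ltW ti)) -normrM -tdot // -XE.
rewrite ler_norml dot_le_enorm andbT lerNl -dotNl.
apply: le_trans (dot_le_enorm _ _) _.
by rewrite -scaleN1r enormZ normrN1 mul1r.
Qed.

Lemma omega_vect_proj X Y : X != 0 -> Y != 0 ->
  enorm (X - (dot X Y / dot Y Y) *: Y) = omega_vect X Y * enorm X.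
Proof.
move=> X0 Y0; apply/eqP; rewrite -(@eqrXn2 _ 2) ?enorm_ge0 //; last first.
  by rewrite mulr_ge0 ?enorm_ge0 ?omega_vect_ge0.
rewrite exprMn omega_vect_sqr // !enorm_sqr; move: X0 Y0; rewrite -!dot_gt0.
move=> X0 Y0; rewrite -scaleNr !(dotDl, dotDr, dotZl, dotZr) (dotC Y X).
by apply/eqP; field; rewrite !gt_eqF.
Qed.

(** Expand X in the orthogonal basis of A and move each component to the line of
    its partner in B: each move costs at most the last sine. *)
Lemma near_of_principal k : size s = k.+1 -> \dim A = k.+1 ->
  near_sub (k.+1%:R * omega_vect (pnth s k).1 (pnth s k).2) A B.
Proof.
move=> sk dA X XA; have sA : size s = \dim A by rewrite dA.
have [c [XE cX]] := pr_expand sA XA.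
set w := omega_vect _ _.
pose Y i := (dot (pnth s i).1 (pnth s i).2 / dot (pnth s i).2 (pnth s i).2)
             *: (pnth s i).2.
exists (\sum_(i < size s) c i *: Y i).
  apply: memv_suml => i _; do 2 apply: memvZ.
  by have [] := pr_mem (ltn_ord i).
rewrite {1}XE -sumrB; apply: le_trans (enorm_sum _ _) _.
have -> : k.+1%:R * w * enorm X = \sum_(i < size s) w * enorm X.
  by rewrite sumr_const card_ord sk -mulrA mulr_natl.
apply: ler_sum => i _; have [iA i1 iB i2] := pr_mem (ltn_ord i).
rewrite -scalerBr enormZ omega_vect_proj // mulrCA.
apply: ler_pM; rewrite ?omega_vect_ge0 ?mulr_ge0 ?enorm_ge0 ?normr_ge0 //.
by apply: pr_mono; rewrite ?sk // -ltnS -sk.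
Qed.

(** The orthogonal projection W of the last vector X onto B is orthogonal to the
    earlier partners, hence admissible in the last minimization; and the sine of
    the angle between X and W is the relative distance from X to B. *)
Lemma omega_le_of_near k delta : size s = k.+1 -> near_sub delta A B ->
  omega_vect (pnth s k).1 (pnth s k).2 <= delta.
Proof.
move=> sk nAB; have ks : (k < size s)%N by rewrite sk.
have [XA X0 YB Y0] := pr_mem ks.
set X := (pnth s k).1 in XA X0 *; set Y := (pnth s k).2 in YB Y0 *.
have Xp : 0 < enorm X by rewrite enorm_gt0.
have [Z ZB XZ] := nAB X XA.
have [W WB XW] := orthogonal_projection B X.
have d0 : 0 <= delta.
  by rewrite -(pmulr_lge0 _ Xp); apply: le_trans (enorm_ge0 _) XZ.
have XWle : enorm (X - W) <= delta * enorm X.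
  apply: le_trans XZ.
  rewrite -(@ler_pXn2r _ 2) ?nnegrE ?enorm_ge0 // !enorm_sqr.
  have -> : X - Z = (X - W) + (W - Z) by rewrite addrA subrK.
  have ZW : W - Z \in B by rewrite memvB.
  have h0 := XW _ ZW.
  set U := X - W in h0 *; set V := W - Z in h0 *.
  have -> : dot (U + V) (U + V) = dot U U + dot V V.
    by rewrite dotDl !(dotDr U V) (dotC V U) h0 addr0 add0r.
  by rewrite lerDl dot_ge0.
have [W0|W0] := eqVneq W 0.
  apply: (@le_trans _ _ 1).
    rewrite -(@ler_pXn2r _ 2) ?nnegrE ?omega_vect_ge0 //.
    rewrite omega_vect_sqr // expr1n gerBl.
    by rewrite divr_ge0 ?sqr_ge0 ?mulr_ge0 ?dot_ge0.
  by move: XWle; rewrite W0 subr0 ler_pMl.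
have XWW : dot X W = dot W W.
  by apply/eqP; rewrite -subr_eq0 -dotNl -dotDl XW.
have [_ _ minP] := pr ks.
apply: le_trans (minP X W _ X0 _ W0) _.
- by have [[]] := pr ks.
- apply/orth_inE; split=> // V.
  rewrite /unzip2 map_take => /(nthP 0)[i].
  rewrite size_takel ?size_map ?(ltnW ks)// => ik <-.
  rewrite nth_take // (nth_map (0, 0)) ?(ltn_trans ik)//.
  have [_ _ iB _] := pr_mem (ltn_trans ik ks).
  have := XW _ iB; rewrite dotDl dotNl pr_cross // sub0r => /eqP.
  by rewrite oppr_eq0 => /eqP.
- have := omega_vect_proj X0 W0.
  rewrite XWW divff ?dot_eq0// scale1r => h.
  by move: XWle; rewrite h ler_pM2r.
Qed.

End Principal.

Lemma size_first_pairs A B j : size (first_pairs A B j) = j.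
Proof. by elim: j => //= j IH; rewrite size_rcons IH. Qed.

Lemma take_first_pairs A B i j : (i <= j)%N ->
  take i (first_pairs A B j) = first_pairs A B i.
Proof.
elim: j => [|j IH]; first by rewrite leqn0 => /eqP->.
rewrite leq_eqVlt => /orP[/eqP->|].
  by rewrite take_oversize // size_first_pairs.
rewrite ltnS => ij /=; rewrite -cats1 takel_cat ?size_first_pairs //.
exact: IH.
Qed.

Lemma nth_first_pairs A B i j : (i < j)%N ->
  pnth (first_pairs A B j) i = next_pair A B (first_pairs A B i).
Proof.
move=> ij; rewrite -(nth_take _ (ltnSn i)) take_first_pairs //=.
by rewrite nth_rcons size_first_pairs ltnn eqxx.
Qed.

Lemma principal_first_pairs A B j : (j <= \dim A)%N -> (j <= \dim B)%N ->
  principal A B (first_pairs A B j).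
Proof.
move=> jA jB i; rewrite size_first_pairs => ij.
rewrite nth_first_pairs // take_first_pairs ?(ltnW ij)//.
set s := first_pairs A B i.
have ss : size s = i by rewrite size_first_pairs.
apply: xgetPex.
have [Q QE] := orth_in_polar A (unzip1 s).
have [Q' QE'] := orth_in_polar B (unzip2 s).
have [X [XA X0 Xs]] := @exists_orth _ _ A (unzip1 s)
  ltac:(rewrite size_map ss; exact: leq_trans ij jA).
have [Y [YB Y0 Ys]] := @exists_orth _ _ B (unzip2 s)
  ltac:(rewrite size_map ss; exact: leq_trans ij jB).
rewrite QE QE'; apply: (@minimizer_exists _ _ Q Q' X Y) => //.
  by rewrite -QE; apply/orth_inE.
by rewrite -QE'; apply/orth_inE.
Qed.

Lemma omegaE A B j : omega j.+1 A B =
  omega_vect (pnth (first_pairs A B j.+1) j).1 (pnth (first_pairs A B j.+1) j).2.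
Proof. by rewrite nth_first_pairs. Qed.

Lemma omega_ge0 j A B : 0 <= omega j A B.
Proof. exact: omega_vect_ge0. Qed.

Lemma near_omega_le A B j : \dim A = j.+1 -> (j < \dim B)%N ->
  near_sub (j.+1%:R * omega j.+1 A B) A B.
Proof.
move=> dA dB; have pr : principal A B (first_pairs A B j.+1).
  by apply: principal_first_pairs; rewrite ?dA.
by rewrite omegaE; apply: near_of_principal => //; rewrite size_first_pairs.
Qed.

Lemma near_omega_ge A B j : \dim B = j.+1 -> (j < \dim A)%N ->
  near_sub (j.+1%:R * omega j.+1 A B) B A.
Proof.
move=> dB dA; have pr : principal A B (first_pairs A B j.+1).
  by apply: principal_first_pairs; rewrite ?dB.
have := near_of_principal (principal_swap pr) (k := j).
rewrite size_map size_first_pairs (nth_map (0, 0)) ?size_first_pairs //=.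
by rewrite omegaE omega_vectC; apply.
Qed.

Lemma omega_le_near A B j delta : (j < \dim A)%N -> (j < \dim B)%N ->
  near_sub delta A B -> omega j.+1 A B <= delta.
Proof.
move=> dA dB; have pr := principal_first_pairs dA dB.
by rewrite omegaE; apply: omega_le_of_near => //; rewrite size_first_pairs.
Qed.

Lemma omega_le_near_sym A B j delta : (j < \dim A)%N -> (j < \dim B)%N ->
  near_sub delta B A -> omega j.+1 A B <= delta.
Proof.
move=> dA dB; have pr := principal_first_pairs dA dB.
move=> /(omega_le_of_near (principal_swap pr) (k := j)).
rewrite size_map size_first_pairs (nth_map (0, 0)) ?size_first_pairs //=.
by rewrite omegaE omega_vectC; apply.
Qed.

End PrincipalPairs.

(** * Minors and wedge norms *)
Section Minors.
Variables (F : realType) (n : nat).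

(** Sorting: the position of f i in increasing order is the number of j with
    f j < f i. *)
Lemma inj_increasing e (f : 'I_e -> 'I_n) : injective f ->
  exists s : {perm 'I_e}, exists2 g : {ffun 'I_e -> 'I_n},
    increasing_idx g & forall i, f i = g (s i).
Proof.
move=> f_inj; pose below a := [pred j | (f j < f a)%N].
have below_lt a : (#|below a| < e)%N.
  rewrite -[X in (_ < X)%N](card_ord e); apply: proper_card.
  by apply/properP; split; [exact: subset_predT | exists a; rewrite ?inE // ltnn].
have below_sub a b : (f a <= f b)%N -> (#|below a| <= #|below b|)%N.
  move=> ab; apply: subset_leq_card; apply/fintype.subsetP => j; rewrite !inE => h.
  exact: leq_trans h ab.
have below_ltn a b : (f a < f b)%N -> (#|below a| < #|below b|)%N.
  move=> ab; apply: proper_card; apply/properP; split.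
    by apply/fintype.subsetP => j; rewrite !inE => h; exact: ltn_trans h ab.
  by exists a; rewrite inE ?ltnn.
pose r a := Ordinal (below_lt a).
have r_inj : injective r.
  move=> a b /(congr1 val) /= ab; apply: f_inj; apply: val_inj => /=.
  by case: (ltngtP (f a) (f b)) => // /below_ltn; rewrite ab ltnn.
exists (perm r_inj), [ffun i => f ((perm r_inj)^-1%g i)]; last first.
  by move=> i; rewrite ffunE permK.
apply/forallP => i; apply/forallP => j; apply/implyP => ij; rewrite !ffunE.
rewrite ltnNge; apply/negP => /below_sub.
have rE k : #|below ((perm r_inj)^-1%g k)| = k :> nat.
  by rewrite -[RHS](congr1 val (permKV (perm r_inj) k)) permE.
by rewrite !rE leqNgt ij.
Qed.

Lemma minor_le_wedge_norm e (M : 'M[F]_(e, n)) (f : 'I_e -> 'I_n) :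
  `|\det (colsub f M)| <= wedge_norm M.
Proof.
have [/injectiveP f_inj|/injectivePn[i [j ij fij]]] := boolP (injectiveb f); last first.
  rewrite -det_tr (determinant_alternate ij) ?normr0 ?sqrtr_ge0 // => k.
  by rewrite !mxE fij.
have [s [g gi fE]] := inj_increasing f_inj.
have -> : colsub f M = col_perm s (colsub g M).
  by apply/matrixP => i j; rewrite !mxE fE.
rewrite col_permE det_mulmx det_perm normrM normrX normrN1 expr1n mulr1.
rewrite -sqrtr_sqr ler_sqrt; last by apply: sumr_ge0 => k _; rewrite sqr_ge0.
rewrite (bigD1 g) //= lerDl; apply: sumr_ge0 => k _; exact: sqr_ge0.
Qed.

(** If the columns in D separate the combinations of the rows, they have full rank
    and contain an invertible square submatrix. *)
Lemma exists_minor e (M : 'M[F]_(e, n)) (D : pred 'I_n) :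
  (forall c : 'rV_e, (forall j, D j -> (c *m M) 0 j = 0) -> c = 0) ->
  exists2 f : 'I_e -> 'I_n, forall i, D (f i) & \det (colsub f M) != 0.
Proof.
move=> Minj; pose ev (k : 'I_#|D|) : 'I_n := enum_val k.
have full : row_full (colsub ev M)^T.
  rewrite /row_full mxrank_tr -/(row_free _) -kermx_eq0; apply/rowV0P => c.
  move=> /sub_kermxP h; apply: Minj => j Dj.
  have /rowP/(_ (enum_rank_in (Dj : j \in D) j)) := h.
  by rewrite mulmx_colsub !mxE /ev enum_rankK_in.
exists (fun i => ev (fullrankfun full i)) => [i|]; first exact: enum_valP.
have := fullrowsub_unit full; rewrite unitmxE unitfE -det_tr.
by congr (\det _ != 0); apply/matrixP => i j; rewrite !mxE.
Qed.

Lemma det_le_prod e (A : 'M[F]_e) (r : 'I_e -> F) :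
  (forall i j, `|A i j| <= r i) -> `|\det A| <= e`!%:R * \prod_i r i.
Proof.
move=> Ar; apply: le_trans (ler_norm_sum _ _ _) _.
have -> : e`!%:R * \prod_i r i = \sum_(s : {perm 'I_e}) \prod_i r i.
  by rewrite sumr_const card_Sn mulr_natl.
apply: ler_sum => s _; rewrite normrM normrX normrN1 expr1n mul1r normr_prod.
by apply: ler_prod => i _; rewrite normr_ge0 Ar.
Qed.

Lemma wedge_norm_le_prod e (M : 'M[F]_(e, n)) (r : 'I_e -> F) :
  (forall i, 0 <= r i) -> (forall i j, `|M i j| <= r i) ->
  wedge_norm M <= (#|{ffun 'I_e -> 'I_n}| * e`!)%:R * \prod_i r i.
Proof.
move=> r_ge0 Mr; set p := e`!%:R * \prod_i r i.
have p0 : 0 <= p by rewrite mulr_ge0 // prodr_ge0.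
rewrite natrM -mulrA -/p.
rewrite -(@ler_pXn2r _ 2) ?nnegrE ?sqrtr_ge0 ?mulr_ge0 ?prodr_ge0 //.
rewrite sqr_sqrtr; last by apply: sumr_ge0 => k _; rewrite sqr_ge0.
apply: (@le_trans _ _ (\sum_(f : {ffun 'I_e -> 'I_n}) p ^+ 2)).
  rewrite big_mkcond; apply: ler_sum => f _; case: ifP => _; last exact: sqr_ge0.
  rewrite -[leLHS]real_normK ?num_real // ler_pXn2r ?nnegrE //.
  by apply: det_le_prod => i j; rewrite mxE.
rewrite sumr_const [leRHS]exprMn -[leLHS]mulr_natl ler_wpM2r ?sqr_ge0 //.
by rewrite -natrX ler_nat; case: #|_| => // k; rewrite leq_pmulr.
Qed.

End Minors.

(** * Integer bases of rational subspaces *)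
Section Lattices.
Variables (R : realType) (n : nat).
Implicit Types (B : {vspace 'rV[R]_n}).
Local Notation real_mx := (map_mx (intr : int -> R)).

Definition row_basis e (M : 'M[R]_(e, n)) B :=
  (forall X, X \in B <-> exists c, X = c *m M) /\
  (forall c : 'rV_e, c *m M = 0 -> c = 0).

Lemma row_basis_unit e (U : 'M[R]_e) (M N : 'M[R]_(e, n)) B :
  U \in unitmx -> N = U *m M -> row_basis M B -> row_basis N B.
Proof.
move=> Uu -> [MB Minj]; split=> [X|c].
  rewrite MB; split=> -[c ->]; last by exists (c *m U); rewrite mulmxA.
  by exists (c *m invmx U); rewrite mulmxA mulmxKV.
by rewrite mulmxA => /Minj cU; rewrite -(mulmxK Uu c) cU mul0mx.
Qed.

Lemma row_basis_sub e (C : 'M[R]_e) (M N : 'M[R]_(e, n)) B :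
  row_basis N B -> N = C *m M -> C \in unitmx.
Proof.
move=> [_ Ninj] NE; rewrite -row_free_unit -kermx_eq0; apply/rowV0P => c.
by move=> /sub_kermxP cC; apply: Ninj; rewrite NE mulmxA cC mul0mx.
Qed.

Lemma row_basis_row e (M : 'M[R]_(e, n)) B i : row_basis M B -> row i M \in B.
Proof. by move=> [MB _]; apply/MB; exists (delta_mx 0 i); rewrite rowE. Qed.

Lemma row_basis_dim e (M : 'M[R]_(e, n)) B : row_basis M B -> \dim B = e.
Proof.
move=> [MB Minj]; have [M' [MB' Minj']] := vspace_rows B.
have sub e1 e2 (M1 : 'M[R]_(e1, n)) (M2 : 'M[R]_(e2, n)) :
  (forall X, X \in B <-> exists c, X = c *m M1) ->
  (forall X, X \in B <-> exists c, X = c *m M2) ->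
  (forall c : 'rV_e1, c *m M1 = 0 -> c = 0) -> (e1 <= e2)%N.
  move=> h1 h2 inj1.
  have : row_free M1.
    by rewrite -kermx_eq0; apply/rowV0P => c /sub_kermxP; exact: inj1.
  rewrite /row_free => /eqP <-.
  apply: leq_trans (mxrankS _) (rank_leq_row M2).
  apply/row_subP => i; apply/submxP; apply/h2.
  by apply/h1; exists (delta_mx 0 i); rewrite rowE.
apply/eqP; rewrite eqn_leq; apply/andP; split.
  exact: (sub _ _ M' M MB' MB Minj').
exact: (sub _ _ M M' MB MB' Minj).
Qed.

Lemma row_basis_inj e (M : 'M[R]_(e, n)) B B' :
  row_basis M B -> row_basis M B' -> B = B'.
Proof.
move=> [MB _] [MB' _]; apply/vspaceP => X.
by apply/idP/idP => [/MB/MB'|/MB'/MB].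
Qed.

Lemma row_basis_exists e (M : 'M[R]_(e, n)) :
  (forall c : 'rV_e, c *m M = 0 -> c = 0) -> exists B, row_basis M B.
Proof.
move=> Minj; exists (limg (linfun (mulmxr M : 'rV_e -> _))).
split=> // X; split=> [/memv_imgP[c _ ->]|[c ->]].
  by exists c; rewrite lfunE.
by apply/memv_imgP; exists c; rewrite ?memvf // lfunE.
Qed.

Lemma row_basis_vbasis (t : seq 'rV[R]_n) e (M : 'M[R]_(e, n)) B :
  size t = e -> (forall i : 'I_e, row i M = t`_i) -> basis_of B t -> row_basis M B.
Proof.
move=> te Mt bt; subst e.
have ME (c : 'rV_(size t)) : c *m M = \sum_i c 0 i *: t`_i.
  by rewrite mulmx_sum_row; apply: eq_bigr => i _; rewrite Mt.
split=> [X|c].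
  rewrite -(span_basis bt); split=> [XB|[c ->]].
    exists (\row_i coord (in_tuple t) i X).
    rewrite ME [LHS](@coord_span _ _ _ (in_tuple t)) //.
    by apply: eq_bigr => i _; rewrite mxE.
  rewrite ME; apply: memv_suml => i _; apply: memvZ.
  by apply: memv_span; apply: mem_nth.
rewrite ME => h; apply/rowP => i; rewrite mxE.
have /(@freeP _ _ _ (in_tuple t)) := basis_free bt.
by move=> /(_ (fun i => c 0 i)); apply.
Qed.

Lemma basis_row_basis e (M : 'M[R]_(e, n)) B :
  row_basis M B -> basis_of B [seq row i M | i <- enum 'I_e].
Proof.
move=> rb; have [MB Minj] := rb; rewrite basisEfree size_map size_enum_ord.
rewrite (row_basis_dim rb) leqnn andbT; apply/andP; split; last first.
  by apply/span_subvP => _ /mapP[i _ ->]; exact: row_basis_row.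
set t := map _ _.
have st : size t = e by rewrite size_map size_enum_ord.
apply/(@freeP _ _ _ (in_tuple t)) => k /= k0 i.
have := Minj (\row_j k (cast_ord (esym st) j)) _.
have ie : (i < e)%N by rewrite -st.
have tE (j : 'I_e) : t`_j = row j M.
  by rewrite (nth_map j) ?size_enum_ord // nth_ord_enum.
have -> : \row_j k (cast_ord (esym st) j) *m M = 0.
  rewrite mulmx_sum_row -[RHS]k0 (reindex (cast_ord st)) /=; last first.
    by exists (cast_ord (esym st)) => j _; rewrite ?cast_ordK ?cast_ordKV.
  by apply: eq_bigr => j _; rewrite mxE cast_ordK -tE.
move=> /(_ erefl)/rowP/(_ (Ordinal ie)); rewrite !mxE => <-.
by congr k; apply: val_inj.
Qed.

Lemma clear_denominators (X : 'rV[rat]_n) :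
  exists2 k : int, k != 0 &
    exists Z : 'rV[int]_n, map_mx intr Z = k%:~R *: X.
Proof.
exists (\prod_j denq (X 0 j)); first by apply/prodf_neq0 => j _; exact: denq_neq0.
exists (\row_j (numq (X 0 j) * \prod_(i | i != j) denq (X 0 i))).
apply/rowP => j; rewrite !mxE [in RHS](bigD1 j) //= !intrM mulrAC; congr (_ * _).
by rewrite [RHS]mulrC -{2}(divq_num_den (X 0 j)) divfK // intr_eq0 denq_neq0.
Qed.

Lemma rational_int_basis B : rational_subspace B ->
  exists P : 'M[int]_(\dim B, n), row_basis (real_mx P) B.
Proof.
move=> [s bs]; have ss : size s = \dim B by rewrite (@size_basis _ _ _ _ (in_tuple _) bs) size_map.
have [P0 P0E] : exists P : 'M[rat]_(\dim B, n), row_basis (map_mx ratr P) B.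
  exists (\matrix_(i < \dim B) s`_i).
  apply: (row_basis_vbasis _ _ bs); first by rewrite size_map.
  move=> i; rewrite (nth_map 0) ?ss //.
  by apply/rowP => j; rewrite !mxE.
have /choice[k hk] : forall i, exists k : int * 'rV[int]_n,
    k.1 != 0 /\ map_mx intr k.2 = k.1%:~R *: row i P0.
  by move=> i; have [k k0 [Z ZE]] := clear_denominators (row i P0); exists (k, Z).
exists (\matrix_i (k i).2).
have Uu : diag_mx (\row_i (k i).1%:~R) \in @unitmx R (\dim B).
  rewrite unitmxE det_diag unitfE; apply/prodf_neq0 => i _.
  by rewrite mxE intr_eq0; case: (hk i).
apply: (row_basis_unit Uu _ P0E); apply/matrixP => i j.
rewrite mul_diag_mx; case: (hk i) => _ /rowP /(_ j).
rewrite !mxE => /(congr1 (ratr : rat -> R)).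
by rewrite rmorphM /= !ratr_int.
Qed.

Lemma map_mx_ratr_intr e (P : 'M[int]_(e, n)) :
  map_mx ratr (map_mx intr P : 'M[rat]_(e, n)) = real_mx P.
Proof. by apply/matrixP => i j; rewrite !mxE ratr_int. Qed.

Lemma int_basis_rational e (P : 'M[int]_(e, n)) B :
  row_basis (real_mx P) B -> rational_subspace B.
Proof.
move=> /basis_row_basis bs; exists [seq row i (map_mx intr P) | i <- enum 'I_e].
rewrite -map_comp (eq_map (g := fun i => row i (real_mx P))) // => i /=.
by rewrite map_row map_mx_ratr_intr.
Qed.

Lemma vspace_dim_le B : (\dim B <= n)%N.
Proof. by have := dimvS (subvf B); rewrite dimvf /dim /= mul1n. Qed.

(** In the Smith form P = L D Q of an integer basis of B, the diagonal entries are
    nonzero because the rows are independent over the reals; the first rows of Q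
    then form a Z-basis of the integer points of B. *)
Lemma Zbasis_exists B : rational_subspace B ->
  exists M : 'M[int]_(\dim B, n), is_Zbasis M B.
Proof.
move=> /rational_int_basis[P rbP]; have [PB Pinj] := rbP.
set e := \dim B in P rbP PB Pinj *; have en : (e <= n)%N := vspace_dim_le B.
have [L Lu [Q Qu [d _ PE]]] := int_Smith_normal_form P.
set D := \matrix_(i, j) _ in PE.
pose pe : 'M[int]_(e, n) := pid_mx e; pose pe' : 'M[int]_(n, e) := pid_mx e.
have pee : pe *m pe' = 1%:M.
  by rewrite /pe /pe' mul_pid_mx minnn (minn_idPr en) pid_mx_1.
pose dd : 'rV[int]_e := \row_i d`_i.
have DE : D = diag_mx dd *m pe.
  apply/matrixP => i j; rewrite mul_diag_mx !mxE ltn_ord andbT.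
  by rewrite mulr_natr.
have LL' : real_mx L *m real_mx (invmx L) = 1%:M.
  by rewrite -map_mxM mulmxV // map_mx1.
have L'L : real_mx (invmx L) *m real_mx L = 1%:M.
  by rewrite -map_mxM mulVmx // map_mx1.
have d0 i : dd 0 i != 0.
  apply/eqP => di.
  have := Pinj (delta_mx 0 i *m real_mx (invmx L)).
  rewrite PE !map_mxM !mulmxA -(mulmxA _ _ (real_mx L)) L'L mulmx1.
  rewrite DE map_mxM !mulmxA -rowE.
  have -> : row i (real_mx (diag_mx dd)) = 0.
    move: di; rewrite mxE => di.
    by apply/rowP => j; rewrite !mxE di mul0rn.
  rewrite !mul0mx => /(_ erefl) /(congr1 (fun x => x *m real_mx L)).
  rewrite -mulmxA L'L mulmx1 mul0mx => /rowP/(_ i); rewrite !mxE !eqxx /=.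
  by move/eqP; rewrite oner_eq0.
pose dinv : 'rV[R]_e := \row_i ((dd 0 i)%:~R)^-1.
have dinvK : diag_mx dinv *m real_mx (diag_mx dd) = 1%:M.
  apply/matrixP => i j; have := d0 i; rewrite mul_diag_mx !mxE => di.
  case: (eqVneq i j) => [_|_] /=; last by rewrite mulr0n mulr0.
  by rewrite mulr1n mulVf // intr_eq0.
exists (pe *m Q); split.
  move=> c c' /(congr1 (fun x => x *m invmx Q)); rewrite !mulmxA !mulmxK //.
  by move=> /(congr1 (fun x => x *m pe')); rewrite -!mulmxA pee !mulmx1.
move=> v; split.
  move=> /PB[c vE].
  have [w wdef] : exists w, w = v *m invmx Q by eexists.
  exists (w *m pe'); rewrite mulmxA.
  suff -> : w *m pe' *m pe = w by rewrite wdef mulmxKV.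
  suff /matrixP h : real_mx (w *m pe' *m pe) = real_mx w.
    by apply/matrixP => i j; have := h i j; rewrite ![real_mx _ _ _]mxE => /intr_inj.
  have wE : real_mx w = c *m real_mx L *m real_mx (diag_mx dd) *m real_mx pe.
    rewrite wdef map_mxM vE PE DE !map_mxM !mulmxA -(mulmxA _ (real_mx Q)).
    by rewrite -map_mxM mulmxV // map_mx1 mulmx1.
  rewrite !map_mxM wE -!mulmxA; do 3 congr (_ *m _).
  by rewrite mulmxA -map_mxM pee map_mx1 mul1mx.
move=> [c ->]; apply/PB.
exists (real_mx c *m diag_mx dinv *m real_mx (invmx L)).
rewrite PE DE !map_mxM !mulmxA -(mulmxA _ _ (real_mx L)) L'L mulmx1.
by rewrite -(mulmxA _ _ (real_mx (diag_mx dd))) dinvK mulmx1.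
Qed.

(** Everything needed about the height: it is the wedge norm of some Z-basis, and
    such a basis is also a real basis. *)
Lemma height_basis B : rational_subspace B ->
  exists M : 'M[int]_(\dim B, n), [/\ row_basis (real_mx M) B,
    forall v : 'rV[int]_n, real_mx v \in B -> exists c, v = c *m M &
    height B = wedge_norm (real_mx M)].
Proof.
move=> rB; have [P rbP] := rational_int_basis rB.
have [M MB HM] : exists2 M : 'M[int]_(\dim B, n), is_Zbasis M B &
    height B = wedge_norm (real_mx M).
  have : [set wedge_norm (real_mx M) | M in
           [set M : 'M[int]_(\dim B, n) | is_Zbasis M B]] (height B).
    have [M MB] := Zbasis_exists rB.
    by apply: xgetPex; exists (wedge_norm (real_mx M)); exists M.
  by case=> M MB <-; exists M.
have MBv v : real_mx v \in B -> exists c, v = c *m M by move=> /(MB.2 v).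
exists M; split=> //.
have /choice[C hC] : forall i, exists c : 'rV_(\dim B), row i P = c *m M.
  by move=> i; apply: MBv; rewrite map_row; exact: row_basis_row.
have PE : P = (\matrix_i C i) *m M.
  by apply/row_matrixP => i; rewrite row_mul rowK.
have PE' : real_mx P = real_mx (\matrix_i C i) *m real_mx M by rewrite -map_mxM -PE.
have Cu := row_basis_sub rbP PE'.
apply: (row_basis_unit (U := invmx (real_mx (\matrix_i C i))) _ _ rbP).
  by rewrite unitmx_inv.
by rewrite PE' mulKmx.
Qed.

End Lattices.

(** * Heights of rational subspaces *)
Section Heights.
Variables (R : realType) (n : nat).
Implicit Types (B : {vspace 'rV[R]_n}).
Local Notation real_mx := (map_mx (intr : int -> R)).

Lemma minor_real_mx e p (M : 'M[int]_(e, p)) (f : 'I_e -> 'I_p) :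
  \det (colsub f (real_mx M)) = (\det (colsub f M))%:~R.
Proof. by rewrite -det_map_mx map_mxsub. Qed.

Lemma int_norm_ge1 (z : int) : (z%:~R : R) != 0 -> 1 <= `|z%:~R| :> R.
Proof. by rewrite intr_eq0 -intr_norm -[1]/(1%:~R) ler_int; lia. Qed.

Lemma height_ge1 B : rational_subspace B -> 1 <= height B.
Proof.
move=> /height_basis[M [[_ Minj] _ ->]].
have [|f _] := @exists_minor _ _ _ (real_mx M) predT.
  by move=> c h; apply: Minj; apply/rowP => j; rewrite h // mxE.
rewrite minor_real_mx => /int_norm_ge1 h.
by apply: le_trans h _; rewrite -minor_real_mx minor_le_wedge_norm.
Qed.

Lemma wedge_norm_mul e (C : 'M[R]_e) (M : 'M[R]_(e, n)) :
  wedge_norm (C *m M) = `|\det C| * wedge_norm M.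
Proof.
rewrite /wedge_norm -sqrtr_sqr -sqrtrM ?sqr_ge0 //; congr Num.sqrt.
rewrite mulr_sumr; apply: eq_bigr => f _.
by rewrite -mulmx_colsub det_mulmx exprMn.
Qed.

(** An integer basis is an integer matrix times a Z-basis, and the determinant of
    the former is a nonzero integer. *)
Lemma height_le_int_basis e (W : 'M[int]_(e, n)) B :
  row_basis (real_mx W) B -> height B <= wedge_norm (real_mx W).
Proof.
move=> rbW; have dB := row_basis_dim rbW; subst e.
have [M [rbM MB ->]] := height_basis (int_basis_rational rbW).
have /choice[C hC] : forall i, exists c : 'rV_(\dim B), row i W = c *m M.
  by move=> i; apply: MB; rewrite map_row; exact: row_basis_row.
have WE : W = (\matrix_i C i) *m M.
  by apply/row_matrixP => i; rewrite row_mul rowK.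
have WE' : real_mx W = real_mx (\matrix_i C i) *m real_mx M by rewrite -map_mxM -WE.
have := row_basis_sub rbW WE'.
rewrite unitmxE unitfE det_map_mx => /int_norm_ge1 h.
by rewrite WE' wedge_norm_mul det_map_mx ler_peMl // sqrtr_ge0.
Qed.

(** Liouville inequality: an integer point X outside B is at distance at least
    1 / ((dim B + 1) H(B)) from B, for the maximum norm. A maximal minor of X on top of a Z-basis is a
    nonzero integer; subtracting Y in B from X does not change it, and its expansion
    along the first row has coefficients bounded by the height. *)
Lemma liouville B (X : 'rV[int]_n) Y delta : rational_subspace B ->
  real_mx X \notin B -> Y \in B -> (forall j, `|(real_mx X - Y) 0 j| <= delta) ->
  1 <= (\dim B).+1%:R * (delta * height B).
Proof.
move=> rB XB YB XY; have [M [[MB Minj] _ HE]] := height_basis rB.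
set e := \dim B in M MB Minj HE *.
have [y YE] := (MB Y).1 YB.
pose N : 'M[int]_(1 + e, n) := col_mx X M.
have NE : real_mx N = col_mx (real_mx X) (real_mx M) by rewrite map_col_mx.
have [|f _] := @exists_minor _ _ _ (real_mx N) predT.
  move=> c h; have : c *m real_mx N = 0 by apply/rowP => j; rewrite h // mxE.
  rewrite NE -[c]hsubmxK mul_row_col [lsubmx c]mx11_scalar mul_scalar_mx.
  set c0 := lsubmx c 0 0 => h0.
  have c00 : c0 = 0.
    apply/eqP; apply: contraNT XB => c0_neq0; apply/MB.
    exists (- c0^-1 *: rsubmx c); rewrite -scalemxAl scaleNr -scalerN.
    have /eqP := h0; rewrite addrC addr_eq0 => /eqP ->.
    by rewrite opprK scalerA mulVf // scale1r.
  move: h0; rewrite c00 scale0r add0r => /Minj ->.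
  by rewrite -scalemx1 scale0r row_mx0.
move=> detN0.
have det1 : 1 <= `|\det (colsub f (real_mx N))|.
  by rewrite minor_real_mx; apply: int_norm_ge1; rewrite -minor_real_mx.
pose Z := real_mx X - Y.
pose N' : 'M[R]_(1 + e, n) := col_mx Z (real_mx M).
have N'E : N' = block_mx 1%:M (- y) 0 1%:M *m real_mx N.
  by rewrite NE mul_block_col !mul1mx mul0mx add0r /N' /Z YE mulNmx.
have detE : \det (colsub f (real_mx N)) = \det (colsub f N').
  by rewrite N'E -mulmx_colsub det_mulmx det_ublock !matrix.det1 !mul1r.
rewrite detE (expand_det_row _ ord0) in det1.
apply: le_trans det1 _; apply: le_trans (ler_norm_sum _ _ _) _.
have -> : e.+1%:R * (delta * height B) = \sum_(j < 1 + e) delta * height B.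
  by rewrite sumr_const card_ord mulr_natl.
apply: ler_sum => j _; rewrite normrM; apply: ler_pM => //.
  rewrite !mxE; have := XY (f j); rewrite -/Z.
  have -> : (ord0 : 'I_(1 + e)) = lshift e ord0 by apply: val_inj.
  by rewrite (unsplitK (inl ord0)).
rewrite /cofactor normrM normrX normrN1 expr1n mul1r HE.
have -> : row' ord0 (col' j (colsub f N')) = colsub (f \o lift j) (real_mx M).
  apply/matrixP => k l; rewrite !mxE.
  have -> : lift (ord0 : 'I_(1 + e)) k = rshift 1 k by apply: val_inj.
  by rewrite (unsplitK (inr k)) mxE.
exact: minor_le_wedge_norm.
Qed.

(** Cramer's rule: multiplying a Z-basis by the adjugate of one of its invertible
    maximal submatrices gives a matrix whose entries are again maximal minors. *)
Lemma small_generators B : rational_subspace B ->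
  exists2 P : 'M[int]_(\dim B, n), row_basis (real_mx P) B &
    forall i j, `|real_mx P i j| <= height B.
Proof.
move=> rB; have [M [rbM _ HE]] := height_basis rB.
have [|f _ detf] := @exists_minor _ _ _ (real_mx M) predT.
  by move=> c h; apply: rbM.2; apply/rowP => j; rewrite h // mxE.
pose P := \adj (colsub f M) *m M.
have PE : real_mx P = \adj (colsub f (real_mx M)) *m real_mx M.
  by rewrite map_mxM map_mx_adj map_mxsub.
exists P.
  apply: (row_basis_unit _ PE rbM); rewrite unitmxE unitfE.
  apply: contra detf => /eqP h.
  have := congr1 determinant (mul_mx_adj (colsub f (real_mx M))).
  rewrite det_mulmx h mulr0 det_scalar => /esym/eqP.
  by rewrite expf_eq0 => /andP[].
move=> i j; rewrite PE mxE.
pose f' k := if k == i then j else f k.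
suff -> : \sum_k (\adj (colsub f (real_mx M))) i k * real_mx M k j =
    \det (colsub f' (real_mx M)) by rewrite HE minor_le_wedge_norm.
rewrite (expand_det_col _ i); apply: eq_bigr => k _.
rewrite mulrC ![in LHS]mxE ![colsub _ _ _ _]mxE /f' eqxx !mxE; congr (_ * _).
congr (_ * \det _); apply/matrixP => a b; rewrite !mxE.
by rewrite eq_sym (negPf (neq_lift _ _)).
Qed.

(** Northcott property: such a subspace is spanned by integer vectors with bounded
    entries. *)
Lemma finite_bounded_height e (H : R) :
  finite_set [set B : {vspace 'rV[R]_n} | rational_subspaces e B /\ height B <= H].
Proof.
pose K := Num.bound `|H|.
pose conv (Q : 'M['I_(K + K).+1]_(e, n)) : 'M[R]_(e, n) :=
  map_mx (fun k : 'I_(K + K).+1 => (k : nat)%:R - K%:R) Q.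
pose F Q := xget 0%VS [set B | row_basis (conv Q) B].
apply: (@sub_finite_set _ _ (F @` setT)); last first.
  by apply: finite_image; exact: finite_finset.
move=> B [[rB dB] HB]; subst e.
have [P rbP Pb] := small_generators rB.
have Pi i j : (`|P i j| <= K)%N.
  have := le_trans (Pb i j) HB; rewrite mxE -intr_norm -natr_absz => h.
  rewrite ltnW // -(ltr_nat R); apply: le_lt_trans (le_trans h (ler_norm _)) _.
  exact: archi_boundP.
exists (\matrix_(i, j) inord (absz (P i j + Posz K))) => //.
have convE : conv (\matrix_(i, j) inord (absz (P i j + Posz K))) = real_mx P.
  apply/matrixP => i j; rewrite !mxE inordK; last by have := Pi i j; lia.
  have -> : (absz (P i j + Posz K))%:R = (P i j + Posz K)%:~R :> R.
    by rewrite natr_absz ger0_norm //; have := Pi i j; lia.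
  by rewrite intrD addrK.
rewrite /F convE; apply: (@xget_subset1 _ _ _ B) => //.
by move=> B1 B2; exact: row_basis_inj.
Qed.

(** If the integer points of B have their j-th coordinate divisible by 2^(w j), and
    if the coordinates in D determine the points of B, then some nonzero minor of a
    Z-basis has its columns in D and is divisible by the corresponding powers. *)
Lemma height_ge_pow2 B (D : pred 'I_n) (w : 'I_n -> nat) : rational_subspace B ->
  (forall X, X \in B -> (forall j, D j -> X 0 j = 0) -> X = 0) ->
  (forall v : 'rV[int]_n, real_mx v \in B ->
     forall j, D j -> (Posz (2 ^ w j) %| v ord0 j)%Z) ->
  exists f : 'I_(\dim B) -> 'I_n, [/\ injective f, forall i, D (f i) &
    2 ^+ (\sum_i w (f i)) <= height B].
Proof.
move=> rB BD Bdvd; have [M [[MB Minj] _ ->]] := height_basis rB.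
have [|f fD detf] := @exists_minor _ _ _ (real_mx M) D.
  by move=> c h; apply: Minj; apply: BD => //; apply/MB; exists c.
exists f; split=> //.
  apply/injectiveP; apply: contraNT detf => /injectivePn[i [j ij fij]].
  by rewrite -det_tr (determinant_alternate ij) // => k; rewrite !mxE fij.
pose Q : 'M[int]_(\dim B) := \matrix_(i, j) (M i (f j) %/ Posz (2 ^ w (f j)))%Z.
have ME : colsub f M = Q *m diag_mx (\row_j Posz (2 ^ w (f j))).
  apply/matrixP => i j; rewrite mul_mx_diag !mxE divzK //.
  have := Bdvd (row i M); rewrite map_row.
  have rMB : row i (real_mx M) \in B by apply/MB; exists (delta_mx 0 i); rewrite rowE.
  by move=> /(_ rMB (f j) (fD j)); rewrite mxE.
apply: le_trans (minor_le_wedge_norm _ f).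
move: detf; rewrite minor_real_mx ME det_mulmx det_diag intrM normrM mulf_eq0 negb_or.
move=> /andP[/int_norm_ge1 h _].
have -> : (\prod_i (\row_j Posz (2 ^ w (f j))) 0 i)%:~R = 2 ^+ (\sum_i w (f i)) :> R.
  rewrite rmorph_prod -prodrXr; apply: eq_bigr => i _.
  by rewrite mxE /= -pmulrn natrX.
by rewrite [X in _ * X]ger0_norm ?exprn_ge0 // ler_peMl ?exprn_ge0.
Qed.

End Heights.

(** * Lacunary binary expansions *)
Section LacunarySums.
Variables (R : realType) (N' : nat) (a : nat -> nat).
Hypothesis a_incr : forall k, (a k < a k.+1)%N.
Local Notation N := N'.+1.
Implicit Types (t : 'I_N).

(** Partial sum, over the steps j < k of the residue class t modulo N, of the
    binary expansion of [xi t]; the step j contributes 2^-(a j). *)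
Definition psum t k : R := \sum_(j < k) (j %% N == t)%N%:R / 2 ^+ a j.

Definition xi t : R := sup (range (psum t)).

Lemma a_ltn k k' : (k < k')%N -> (a k < a k')%N.
Proof.
elim: k' => // k' IH; rewrite ltnS leq_eqVlt => /orP[/eqP->|/IH h] //.
exact: ltn_trans h _.
Qed.

Lemma a_leq k k' : (k <= k')%N -> (a k <= a k')%N.
Proof. by rewrite leq_eqVlt => /orP[/eqP->//|/a_ltn/ltnW]. Qed.

Lemma psumS t k : psum t k.+1 = psum t k + (k %% N == t)%N%:R / 2 ^+ a k.
Proof. by rewrite /psum big_ord_recr. Qed.

Lemma psum0 t : psum t 0 = 0.
Proof. by rewrite /psum big_ord0. Qed.

Lemma pow2_gt0 m : 0 < 2 ^+ m :> R. Proof. exact: exprn_gt0. Qed.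

Lemma invpow2_gt0 m : 0 < (2 ^+ m)^-1 :> R. Proof. by rewrite invr_gt0 pow2_gt0. Qed.

Lemma psum_le t k k' : (k <= k')%N -> psum t k <= psum t k'.
Proof.
elim: k' => [|k' IH]; first by rewrite leqn0 => /eqP->.
rewrite leq_eqVlt => /orP[/eqP->//|/IH h]; apply: le_trans h _.
by rewrite psumS lerDl divr_ge0 // ltW ?pow2_gt0.
Qed.

Lemma psum_ge0 t k : 0 <= psum t k.
Proof. by rewrite -(psum0 t) psum_le. Qed.

(** The partial sums plus twice the next term decrease, as the terms at least
    halve; this traps the limit between the two monotone sequences. *)
Lemma psum_upper t k k' : (k <= k')%N ->
  psum t k' + 2 / 2 ^+ a k' <= psum t k + 2 / 2 ^+ a k.
Proof.
elim: k' => [|k' IH]; first by rewrite leqn0 => /eqP->.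
rewrite leq_eqVlt => /orP[/eqP->//|/IH h]; apply: le_trans _ h.
rewrite psumS -addrA lerD2l.
have h1 : (k' %% N == t)%N%:R / 2 ^+ a k' <= 1 / 2 ^+ a k' :> R.
  by rewrite ler_pM2r ?invpow2_gt0 // lern1 leq_b1.
have h2 : 2 / 2 ^+ a k'.+1 <= 1 / 2 ^+ a k' :> R.
  rewrite ler_pdivrMr ?pow2_gt0 // mulrAC ler_pdivlMr ?pow2_gt0 // mul1r -exprS.
  by rewrite ler_weXn2l // ler1n.
by apply: le_trans (lerD h1 h2) _; lra.
Qed.

Lemma psum_bounded t k k' : psum t k' <= psum t k + 2 / 2 ^+ a k.
Proof.
have [kk'|/ltnW k'k] := leqP k k'.
  apply: le_trans (psum_upper t kk'); rewrite lerDl.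
  by rewrite divr_ge0 // ltW ?pow2_gt0.
apply: le_trans (psum_le t k'k) _; rewrite lerDl.
by rewrite divr_ge0 // ltW ?pow2_gt0.
Qed.

Lemma xi_le t k : xi t <= psum t k + 2 / 2 ^+ a k.
Proof.
apply: ge_sup; first by exists (psum t 0); exists 0%N.
by move=> _ [k' _ <-]; exact: psum_bounded.
Qed.

Lemma xi_ge t k : psum t k <= xi t.
Proof.
apply: ub_le_sup; last by exists k.
by exists (psum t 0 + 2 / 2 ^+ a 0); move=> _ [k' _ <-]; exact: psum_bounded.
Qed.

Lemma psum_le2 t k : psum t k <= 2.
Proof.
apply: le_trans (psum_bounded t 0 k) _; rewrite psum0 add0r.
by rewrite ler_pdivrMr ?pow2_gt0 // ler_peMr // exprn_ege1 // ler1n.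
Qed.

Lemma xi_le2 t : xi t <= 2.
Proof.
apply: le_trans (xi_le t 0) _; rewrite psum0 add0r.
by rewrite ler_pdivrMr ?pow2_gt0 // ler_peMr // exprn_ege1 // ler1n.
Qed.

Lemma xi_ge0 t : 0 <= xi t.
Proof. by apply: le_trans (xi_ge t 0); rewrite psum0. Qed.

Lemma psum_gap t k k' : (k <= k')%N ->
  (forall j, (k <= j)%N -> (j < k')%N -> (j %% N)%N <> t) ->
  psum t k = psum t k'.
Proof.
elim: k' => [|k' IH]; first by rewrite leqn0 => /eqP->.
rewrite leq_eqVlt => /orP[/eqP->//|kk'] gap; rewrite psumS -IH //; last first.
  by move=> j kj jk'; apply: gap => //; exact: ltnW.
by have /eqP/negPf-> := gap k' kk' (ltnSn _); rewrite mul0r addr0.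
Qed.

(** The numerator of [psum t k.+1] over the denominator 2^(a k). *)
Definition pnum t k : nat := \sum_(j < k.+1) (j %% N == t)%N * 2 ^ (a k - a j).

Lemma pnumE t k : (pnum t k)%:R = 2 ^+ a k * psum t k.+1.
Proof.
rewrite /pnum /psum natr_sum mulr_sumr; apply: eq_bigr => j _.
rewrite natrM natrX mulrCA; congr (_ * _).
by rewrite expfB_cond ?pnatr_eq0 // a_leq // -ltnS.
Qed.

(** The last term of the numerator is 1 and the others are even. The oddness is
    what makes the fraction irreducible, hence the heights as large as possible. *)
Lemma pnum_odd k : odd (pnum (inZp k) k).
Proof.
rewrite /pnum big_ord_recr /= eqxx subnn mul1n expn0 oddD addbT.
rewrite -dvdn2; apply: dvdn_sum => j _.
by rewrite dvdn_mull // dvdn_exp // subn_gt0 a_ltn.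
Qed.

End LacunarySums.

(** * Residues along windows of consecutive integers *)
Section Residues.
Variable p : nat.
Implicit Types i : 'I_p.+1.

Lemma inZp_inj_window k k' : (k <= k')%N -> (k' < k + p.+1)%N ->
  inZp k = inZp k' :> 'I_p.+1 -> k = k'.
Proof.
move=> kk' k'd /(congr1 val) /= /eqP h.
have : (k' - k == 0 %[mod p.+1])%N.
  by rewrite -(eqn_modDr k) subnK // add0n eq_sym.
by rewrite mod0n modn_small; lia.
Qed.

Lemma inZp_window K i : exists2 k, (K <= k < K + p.+1)%N & inZp k = i.
Proof.
exists (K + (i + K * p) %% p.+1)%N; first by rewrite leq_addr ltn_add2l ltn_mod.
apply: val_inj => /=; rewrite modnDmr addnCA -{1}(muln1 K) -mulnDr add1n.
by rewrite addnC modnMDl modn_small.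
Qed.

End Residues.

(** * The subspace attached to a lacunary sequence *)
Section Construction.
Variables (R : realType) (d' N' : nat) (a : nat -> nat).
Local Notation d := d'.+1.
Local Notation N := N'.+1.
Hypothesis a_incr : forall k, (a k < a k.+1)%N.
Hypothesis dvd_dN : (d %| N)%N.
Local Notation V := 'rV[R]_(d + N).
Local Notation real_mx := (map_mx (intr : int -> R)).
Local Notation psum := (psum R a).
Local Notation xi := (xi R a).
Implicit Types (X Y Z : V) (B : {vspace V}) (i : 'I_d) (t : 'I_N).

(** The coordinates of R^(d + N) are split into d head coordinates x_i and N tail
    coordinates y_t. *)
Definition xc X i := X 0 (lshift N i).
Definition yc X t := X 0 (rshift d t).
Definition vec (x : 'I_d -> R) (y : 'I_N -> R) : V :=
  row_mx (\row_i x i) (\row_t y t).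

Lemma xc_vec x y i : xc (vec x y) i = x i.
Proof. by rewrite /xc row_mxEl mxE. Qed.

Lemma yc_vec x y t : yc (vec x y) t = y t.
Proof. by rewrite /yc row_mxEr mxE. Qed.

Lemma vec_ext X Y : (forall i, xc X i = xc Y i) -> (forall t, yc X t = yc Y t) ->
  X = Y.
Proof.
move=> hx hy; apply/rowP => k.
by case: (split_ordP k) => j ->; [exact: hx | exact: hy].
Qed.

Lemma xcZ c X i : xc (c *: X) i = c * xc X i. Proof. by rewrite /xc mxE. Qed.
Lemma ycZ c X t : yc (c *: X) t = c * yc X t. Proof. by rewrite /yc mxE. Qed.
Lemma xcB X Y i : xc (X - Y) i = xc X i - xc Y i. Proof. by rewrite /xc !mxE. Qed.
Lemma ycB X Y t : yc (X - Y) t = yc X t - yc Y t. Proof. by rewrite /yc !mxE. Qed.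

Lemma xc_mul e (c : 'rV[R]_e) (M : 'M[R]_(e, d + N)) i :
  xc (c *m M) i = \sum_j c 0 j * xc (row j M) i.
Proof. by rewrite /xc mxE; apply: eq_bigr => j _; rewrite !mxE. Qed.

Lemma yc_mul e (c : 'rV[R]_e) (M : 'M[R]_(e, d + N)) t :
  yc (c *m M) t = \sum_j c 0 j * yc (row j M) t.
Proof. by rewrite /yc mxE; apply: eq_bigr => j _; rewrite !mxE. Qed.

Lemma xc_le X i : `|xc X i| <= enorm X. Proof. exact: coord_le_enorm. Qed.
Lemma yc_le X t : `|yc X t| <= enorm X. Proof. exact: coord_le_enorm. Qed.

Lemma enorm_le X : enorm X <= \sum_i `|xc X i| + \sum_t `|yc X t|.
Proof. by apply: le_trans (enorm_le_sum X) _; rewrite big_split_ord. Qed.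

(** Step k of the construction modifies the coordinate of index k mod N of the tail,
    which belongs to the head coordinate of index k mod d. As d divides N, the column
    determines the row. *)
Definition rowi (k : nat) : 'I_d := inZp k.
Definition coli (k : nat) : 'I_N := inZp k.

Lemma rowi_coli k : rowi (coli k) = rowi k.
Proof. by apply: val_inj; rewrite /= modn_dvdm. Qed.

Lemma coliDN k : coli (k + N) = coli k.
Proof. by apply: val_inj; rewrite /= modnDr. Qed.

Lemma rowiDd k : rowi (k + d) = rowi k.
Proof. by apply: val_inj; rewrite /= modnDr. Qed.

Lemma rowiDN k : rowi (k + N) = rowi k.
Proof. by rewrite -rowi_coli coliDN rowi_coli. Qed.

Lemma rowi_inj k k' : (k <= k')%N -> (k' < k + d)%N -> rowi k = rowi k' -> k = k'.
Proof. exact: inZp_inj_window. Qed.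

Lemma coli_inj k k' : (k <= k')%N -> (k' < k + N)%N -> coli k = coli k' -> k = k'.
Proof. exact: inZp_inj_window. Qed.

Lemma coli_window K t : exists2 k, (K <= k < K + N)%N & coli k = t.
Proof. exact: inZp_window. Qed.

Lemma rowi_window K i : exists2 k, (K <= k < K + d)%N & rowi k = i.
Proof. exact: inZp_window. Qed.

Lemma leq_dN : (d <= N)%N. Proof. exact: dvdn_leq. Qed.

(** A window of length d starting at K contains exactly one step k of the row of u.
    A step after k and before u that modifies the column of u would be at most
    u - N, hence would be another step of this row in the window. *)
Lemma psum_frozen K k u : (K <= k < K + d)%N -> (k < u)%N -> (u < K + d + N)%N ->
  rowi k = rowi u -> psum (coli u) k.+1 = psum (coli u) u.
Proof.
move=> /andP[Kk kKd] ku uK rku; apply: psum_gap => // j kj ju jE.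
have juc : coli j = coli u by apply: val_inj.
have ju' : (j <= u - N)%N.
  rewrite leqNgt; apply/negP => h.
  have E : j = u by apply: coli_inj juc; lia.
  by move: ju; rewrite E ltnn.
have rkj : rowi k = rowi j by rewrite -(rowi_coli j) juc rowi_coli.
have E : k = j by apply: rowi_inj rkj; lia.
by move: kj; rewrite E ltnn.
Qed.

Lemma psum_row_frozen k k' t : rowi t = rowi k -> (k < k')%N -> (k' <= k + d)%N ->
  psum t k.+1 = psum t k'.
Proof.
move=> tk kk' k'd; apply: psum_gap => // j kj jk' jE.
have jt : coli j = t by apply: val_inj.
have rkj : rowi k = rowi j by rewrite -(rowi_coli j) jt.
have E : k = j by apply: rowi_inj rkj; lia.
by move: kj; rewrite E ltnn.
Qed.

Lemma xi_tail t k : 0 <= xi t - psum t k <= 2 / 2 ^+ a k.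
Proof. by rewrite subr_ge0 xi_ge //= lerBlDl xi_le. Qed.

Lemma xi_tail_ge u : (2 ^+ a u)^-1 <= xi (coli u) - psum (coli u) u.
Proof.
rewrite lerBrDl; apply: le_trans (xi_ge R a_incr (coli u) u.+1).
by rewrite psumS /= eqxx mul1r.
Qed.

(** The rows generate the subspace A of the points with y_t = xi_t x_(t mod d) for all t. *)
Definition A_mx : 'M[R]_(d, d + N) :=
  row_mx 1%:M (\matrix_(i, t) ((rowi t == i)%:R * xi t)).

Lemma xc_A_mx c i : xc (c *m A_mx) i = c 0 i.
Proof. by rewrite /xc mul_mx_row row_mxEl mulmx1. Qed.

Lemma yc_A_mx c t : yc (c *m A_mx) t = xi t * c 0 (rowi t).
Proof.
rewrite /yc mul_mx_row row_mxEr mxE (bigD1 (rowi t)) //= big1 ?addr0.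
  by rewrite mxE eqxx mul1r mulrC.
by move=> j jt; rewrite mxE eq_sym (negPf jt) mul0r mulr0.
Qed.

Definition Aspace : {vspace V} := limg (linfun (mulmxr A_mx : 'rV_d -> V)).

Lemma mem_Aspace X : X \in Aspace <-> forall t, yc X t = xi t * xc X (rowi t).
Proof.
split=> [/memv_imgP[c _ ->] t|h].
  by rewrite lfunE /= xc_A_mx yc_A_mx.
apply/memv_imgP; exists (\row_i xc X i); rewrite ?memvf // lfunE /=.
by apply: vec_ext => [i|t]; rewrite ?xc_A_mx ?yc_A_mx ?h mxE.
Qed.

Lemma dim_Aspace : \dim Aspace = d.
Proof.
apply: (@row_basis_dim _ _ _ A_mx); split=> [X|c h].
  split=> [/memv_imgP[c _ ->]|[c ->]]; first by exists c; rewrite lfunE.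
  by apply/memv_imgP; exists c; rewrite ?memvf // lfunE.
by apply/rowP => i; rewrite -xc_A_mx h mxE /xc mxE.
Qed.

(** The linear forms defining A, evaluated at X, are bounded by the distance from X
    to A, because the numbers xi_t are at most 2. *)
Lemma form_le_dist X Y t : Y \in Aspace ->
  `|yc X t - xi t * xc X (rowi t)| <= 3 * enorm (X - Y).
Proof.
move=> /mem_Aspace YA.
have -> : yc X t - xi t * xc X (rowi t) =
    yc (X - Y) t - xi t * xc (X - Y) (rowi t).
  by rewrite ycB xcB YA; ring.
apply: le_trans (ler_normB _ _) _; rewrite normrM (ger0_norm (xi_ge0 _ _ _)) //.
have h1 := yc_le (X - Y) t; have h2 := xc_le (X - Y) (rowi t).
have h3 : xi t * `|xc (X - Y) (rowi t)| <= 2 * enorm (X - Y).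
  by apply: ler_pM => //; [exact: xi_ge0 | exact: xi_le2].
lra.
Qed.

(** Truncation after step k of the generator of A attached to the row of k, scaled
    by 2^(a k) so as to be integral; it is at distance about 2^(a k - a (k + d))
    from A, the row being next modified at step k + d. *)
Definition truncv (k : nat) : V :=
  vec (fun i => (i == rowi k)%:R * 2 ^+ a k)
      (fun t => (rowi t == rowi k)%:R * (2 ^+ a k * psum t k.+1)).

Definition truncz (k : nat) : 'rV[int]_(d + N) :=
  row_mx (\row_i ((i == rowi k)%:R * 2 ^+ a k))
         (\row_t ((rowi t == rowi k)%:R * (pnum a t k)%:R)).

Lemma real_truncz k : real_mx (truncz k) = truncv k.
Proof.
rewrite /truncz map_row_mx /truncv /vec; congr row_mx; apply/rowP => j; rewrite !mxE.
  by rewrite rmorphM rmorphXn /= !rmorph_nat.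
by rewrite rmorphM /= !rmorph_nat pnumE.
Qed.

Definition unitv (t0 : 'I_N) : V := vec (fun=> 0) (fun t => (t == t0)%:R).

Definition unitz (t0 : 'I_N) : 'rV[int]_(d + N) := row_mx 0 (\row_t (t == t0)%:R).

Lemma real_unitz t0 : real_mx (unitz t0) = unitv t0.
Proof.
rewrite /unitz map_row_mx /unitv /vec; congr row_mx; apply/rowP => j; rewrite !mxE //.
by rewrite rmorph_nat.
Qed.

(** Two consecutive truncations in a row differ, up to scaling, by a standard basis
    vector. *)
Lemma unitv_truncv k : unitv (coli (k + d)) =
  truncv (k + d) - (2 ^+ a (k + d) / 2 ^+ a k) *: truncv k.
Proof.
have nz m : 2 ^+ m != 0 :> R by rewrite gt_eqF // pow2_gt0.
apply: vec_ext => [i|t].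
  by rewrite xcB xcZ !xc_vec rowiDd mulrCA divfK ?nz // subrr.
have cancel (b P Q s1 s2 : R) : Q != 0 ->
    b * (P * s1) - P / Q * (b * (Q * s2)) = b * (P * (s1 - s2)).
  by move=> Q0; field.
rewrite ycB ycZ !yc_vec rowiDd cancel //.
have [rt|rt] := eqVneq (rowi t) (rowi k); last first.
  rewrite mul0r; case: eqP => // tE; case/eqP: rt.
  by rewrite tE rowi_coli rowiDd.
rewrite (@psum_row_frozen k (k + d)) ?leqnn ?mul1r //; last by rewrite addnS ltnS leq_addr.
rewrite psumS addrAC subrr add0r mulrCA divff ?nz // mulr1.
by rewrite eq_sym.
Qed.

(** The vectors with 0 <= j < e span the same subspace as the truncations of the
    steps K <= k < K + e; from the index d on, a truncation is replaced by a
    standard basis vector, which does not contribute to the height. *)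
Definition genz (K j : nat) : 'rV[int]_(d + N) :=
  if (j < d)%N then truncz (K + j) else unitz (coli (K + j)).

Definition genv (K j : nat) : V :=
  if (j < d)%N then truncv (K + j) else unitv (coli (K + j)).

Lemma real_genz K j : real_mx (genz K j) = genv K j.
Proof. by rewrite /genz /genv; case: ifP; rewrite ?real_truncz ?real_unitz. Qed.

(** The linear equations satisfied by the truncations of the steps
    K <= k < K + m: on the columns of the later steps u, the coefficient is still
    the partial sum before u. For m >= d these are d + N - m equations, and they
    define the subspace generated by these truncations. *)
Definition frozen (K m : nat) B := forall X, X \in B ->
  forall u, (K + m <= u)%N -> (u < K + d + N)%N ->
    yc X (coli u) = psum (coli u) u * xc X (rowi u).

Lemma frozen_genv K m j u : (j < m)%N -> (d <= m)%N ->
  (K + m <= u)%N -> (u < K + d + N)%N ->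
  yc (genv K j) (coli u) = psum (coli u) u * xc (genv K j) (rowi u).
Proof.
move=> jm dm Kmu uK; rewrite /genv; case: ltnP => jd.
  rewrite yc_vec xc_vec rowi_coli.
  have [ru|] := eqVneq (rowi u) (rowi (K + j)); last by rewrite !mul0r mulr0.
  rewrite !mul1r mulrC; congr (_ * _); apply: (@psum_frozen K) => //; lia.
rewrite yc_vec xc_vec mulr0; case: eqP => // h.
have E : (K + j)%N = u by apply: coli_inj (esym h); lia.
lia.
Qed.

Definition gen_mx e K : 'M[int]_(e, d + N) := \matrix_(j < e) genz K j.

Lemma row_gen_mx e K (j : 'I_e) : row j (real_mx (gen_mx e K)) = genv K j.
Proof. by rewrite -map_row rowK real_genz. Qed.

Lemma gen_mx_inj e K (c : 'rV[R]_e) : (e <= N)%N -> c *m real_mx (gen_mx e K) = 0 -> c = 0.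
Proof.
move=> eN h.
have cd (j : 'I_e) : (j < d)%N -> c 0 j = 0.
  move=> jd; have : xc (c *m real_mx (gen_mx e K)) (rowi (K + j)) = 0.
    by rewrite h /xc mxE.
  rewrite xc_mul (bigD1 j) //= big1 ?addr0; last first.
    move=> l lj; rewrite row_gen_mx /genv; case: ltnP => ld; rewrite xc_vec ?mulr0 //.
    case: eqP => [rE|_]; last by rewrite mul0r mulr0.
    case/eqP: lj; apply: val_inj => /=.
    have [lj|jl] := leqP l j.
      have E : (K + l = K + j)%N by apply: rowi_inj (esym rE); lia.
      lia.
    have E : (K + j = K + l)%N by apply: rowi_inj rE; lia.
    lia.
  rewrite row_gen_mx /genv jd xc_vec eqxx mul1r => /eqP.
  by rewrite mulf_eq0 (gt_eqF (pow2_gt0 _ _)) orbF => /eqP.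
apply/rowP => j; rewrite mxE; have [jd|jd] := ltnP j d; first exact: cd.
have : yc (c *m real_mx (gen_mx e K)) (coli (K + j)) = 0 by rewrite h /yc mxE.
rewrite yc_mul (bigD1 j) //= big1 ?addr0; last first.
  move=> l lj; have [ld|dl] := ltnP l d; first by rewrite cd ?mul0r.
  rewrite row_gen_mx /genv ltnNge dl /= yc_vec.
  case: eqP => [cE|_]; last by rewrite mulr0.
  case/eqP: lj; apply: val_inj => /=.
  have := ltn_ord j; have := ltn_ord l => le je.
  have [lj|jl] := leqP l j.
    have E : (K + l = K + j)%N by apply: coli_inj (esym cE); lia.
    lia.
  have E : (K + j = K + l)%N by apply: coli_inj cE; lia.
  lia.
by rewrite row_gen_mx /genv ltnNge jd /= yc_vec eqxx mulr1.
Qed.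

Lemma frozen_gen_mx e K B : row_basis (real_mx (gen_mx e K)) B -> frozen K (maxn d e) B.
Proof.
move=> [WB _] X /WB[c ->] u Kmu uK; rewrite xc_mul yc_mul mulr_sumr.
apply: eq_bigr => j _; rewrite row_gen_mx mulrCA; congr (_ * _).
by apply: frozen_genv Kmu uK; rewrite ?leq_maxl // (leq_trans (ltn_ord j)) ?leq_maxr.
Qed.

End Construction.

Lemma increasing_bounds e M (g : {ffun 'I_e -> 'I_M}) k0 :
  increasing_idx g -> (forall j, (k0 <= g j)%N) ->
  forall j : 'I_e, (k0 + j <= g j)%N /\ (g j + (e - j) <= M)%N.
Proof.
move=> /forallP gi gk0; have g_ltn (i j : 'I_e) : (i < j)%N -> (g i < g j)%N.
  by move=> ij; have /forallP/(_ j)/implyP := gi i; apply.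
have lo m (j : 'I_e) : (j = m :> nat) -> (k0 + m <= g j)%N.
  elim: m j => [|m IH] j jm; first by rewrite addn0.
  have me : (m < e)%N by have := ltn_ord j; lia.
  have := IH (Ordinal me) erefl; have := g_ltn (Ordinal me) j; rewrite /= jm; lia.
have hi m (j : 'I_e) : (e = j + m.+1 :> nat)%N -> (g j + m.+1 <= M)%N.
  elim: m j => [|m IH] j jm; first by have := ltn_ord (g j); lia.
  have me : (j.+1 < e)%N by lia.
  have := IH (Ordinal me); have := g_ltn j (Ordinal me); rewrite /=; lia.
move=> j; split; first exact: lo.
by have := hi (e - j).-1 j; have := ltn_ord j; lia.
Qed.

(** * Rational subspaces close to the constructed one *)
Section RowBasis.
Variables (R : realType) (n : nat).

Lemma row_basis_of_rows e (M : 'M[R]_(e, n)) (B : {vspace 'rV[R]_n}) :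
  \dim B = e -> (forall j, row j M \in B) ->
  (forall c : 'rV_e, c *m M = 0 -> c = 0) -> row_basis M B.
Proof.
move=> dB MB Minj; have [B' rb] := row_basis_exists Minj.
suff -> : B = B' by [].
apply/esym/eqP; rewrite eqEdim dB (row_basis_dim rb) leqnn andbT.
apply/subvP => X /rb.1[c ->]; rewrite mulmx_sum_row.
by apply: memv_suml => j _; apply: memvZ.
Qed.

End RowBasis.

Section Approximation.
Variables (R : realType) (d' N' : nat) (a : nat -> nat).
Local Notation d := d'.+1.
Local Notation N := N'.+1.
Hypothesis a_incr : forall k, (a k < a k.+1)%N.
Hypothesis dvd_dN : (d %| N)%N.
Local Notation V := 'rV[R]_(d + N).
Local Notation real_mx := (map_mx (intr : int -> R)).
Local Notation psum := (psum R a).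
Local Notation xi := (xi R a).
Local Notation rowi := (rowi d').
Local Notation coli := (coli N').
Local Notation A := (Aspace R d' N' a).
Local Notation frozen := (@frozen R d' N' a).
Implicit Types (X Y Z : V) (B : {vspace V}) (i : 'I_d) (t : 'I_N).

(** A bound for the number of coordinates, used to absorb all sums over them. *)
Definition dimS : R := (d + N).+1%:R.

Lemma dimS_gt0 : 0 < dimS. Proof. by rewrite /dimS ltr0n. Qed.
Lemma dimS_ge1 : 1 <= dimS. Proof. by rewrite /dimS ler1n. Qed.

(** The generator of A attached to the head coordinate i0. *)
Definition limv i0 : V :=
  vec (fun i => (i == i0)%:R) (fun t => (rowi t == i0)%:R * xi t).

Lemma limv_mem i0 : limv i0 \in A.
Proof. by apply/mem_Aspace => // t; rewrite yc_vec xc_vec mulrC. Qed.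

Lemma enorm_limv i0 : enorm (limv i0) <= 2 * dimS.
Proof.
apply: le_trans (enorm_le _) _.
apply: (@le_trans _ _ (\sum_(i < d) 1 + \sum_(t < N) 2)).
  apply: lerD; apply: ler_sum => j _.
    by rewrite xc_vec normr_nat lern1 leq_b1.
  rewrite yc_vec normrM normr_nat ger0_norm ?xi_ge0 // -[leRHS]mul1r.
  by apply: ler_pM; rewrite ?xi_ge0 ?xi_le2 // lern1 leq_b1.
rewrite !sumr_const !card_ord /dimS.
have -> : 1 *+ d + 2 *+ N = (d + 2 * N)%:R :> R.
  by rewrite natrD natrM mulr_natr.
by rewrite -natrM ler_nat; lia.
Qed.

Lemma truncv_limv k j : `|(truncv R d' N' a k - 2 ^+ a k *: limv (rowi k)) 0 j| <=
  2 * 2 ^+ a k / 2 ^+ a (k + d).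
Proof.
have bnd0 : 0 <= 2 * 2 ^+ a k / 2 ^+ a (k + d) :> R.
  by rewrite divr_ge0 ?mulr_ge0 // ltW ?pow2_gt0.
case: (split_ordP j) => l ->.
  rewrite -[_ 0 _]/(xc _ l) xcB xcZ !xc_vec [X in _ - X]mulrC subrr normr0 //.
rewrite -[_ 0 _]/(yc _ l) ycB ycZ !yc_vec.
have [rl|_] := eqVneq (rowi l) (rowi k); last by rewrite !mul0r mulr0 subrr normr0.
rewrite !mul1r -mulrBr normrM ger0_norm ?(ltW (pow2_gt0 _ _)) //.
rewrite (@psum_row_frozen R d' N' a dvd_dN k (k + d)) ?leqnn //; last by rewrite addnS ltnS leq_addr.
have /andP[h1 h2] := xi_tail R a_incr l (k + d).
by rewrite -normrN opprB (ger0_norm h1) [2 * _]mulrC -mulrA ler_pM2l ?pow2_gt0.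
Qed.

(** Large enough for the two error terms of [truncv_mem], and those of
    [frozen_of_close_below], to be at most 1/4 each. *)
Definition c_liouville : R := 12 * dimS ^+ 2.

(** The truncation of step k is close to A, hence to B; if it were not in B, this
    would contradict the Liouville inequality. *)
Lemma truncv_mem B delta k : rational_subspace B -> 0 <= delta -> near_sub delta A B ->
  c_liouville * height B * 2 ^+ a k <= 2 ^+ a (k + d) ->
  c_liouville * height B * 2 ^+ a k * delta < 1 -> truncv R d' N' a k \in B.
Proof.
move=> rB d0 nAB h1 h2; apply: contraT => XB.
have [Y YB hY] := nAB (2 ^+ a k *: limv (rowi k)) (memvZ _ (limv_mem _)).
have H1 := height_ge1 rB; have pk := pow2_gt0 R (a k).
have pd := pow2_gt0 R (a (k + d)).
set H := height B in h1 h2 H1; set p := 2 ^+ a k in h1 h2 pk hY.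
set q := 2 ^+ a (k + d) in h1 pd.
have hY' : enorm (p *: limv (rowi k) - Y) <= delta * (p * (2 * dimS)).
  apply: le_trans hY _; rewrite enormZ ger0_norm ?(ltW pk) //.
  by rewrite ler_wpM2l // ler_pM2l // enorm_limv.
have := @liouville R _ B (truncz d' N' a k) Y (2 * p / q + delta * (p * (2 * dimS))) rB.
rewrite real_truncz // => /(_ XB YB) L.
have {}L : 1 <= (\dim B).+1%:R * ((2 * p / q + delta * (p * (2 * dimS))) * H).
  apply: L => j; rewrite -(subrKA (p *: limv (rowi k))) mxE.
  apply: le_trans (ler_normD _ _) _; apply: lerD; first exact: truncv_limv.
  exact: le_trans (coord_le_enorm _ _) hY'.
have dimB : (\dim B).+1%:R <= dimS by rewrite ler_nat ltnS vspace_dim_le.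
have n1p := dimS_gt0; have n1g := dimS_ge1.
have T0 : 0 <= (2 * p / q + delta * (p * (2 * dimS))) * H.
  apply: mulr_ge0; last by lra.
  apply: addr_ge0; first by rewrite divr_ge0 ?mulr_ge0 // ltW.
  by do 2 (apply: mulr_ge0 => //); rewrite ?ltW //; lra.
have L2 : 1 <= dimS * ((2 * p / q + delta * (p * (2 * dimS))) * H).
  by apply: le_trans L _; rewrite ler_wpM2r.
have e1 : dimS * (2 * p / q * H) <= 1 / 6.
  have : c_liouville * H * p / q <= 1 by rewrite ler_pdivrMr // mul1r.
  have -> : dimS * (2 * p / q * H) = (2 * dimS) * (H * p / q) by ring.
  have -> : c_liouville * H * p / q = (12 * dimS * dimS) * (H * p / q) by rewrite /c_liouville; ring.
  set z := H * p / q; have z0 : 0 <= z by rewrite divr_ge0 ?mulr_ge0 // ltW //; lra.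
  have : dimS * z <= dimS * (dimS * z) by rewrite ler_wpM2l ?ler_peMl // ltW.
  lra.
have e2 : dimS * (delta * (p * (2 * dimS)) * H) <= 1 / 6.
  have -> : dimS * (delta * (p * (2 * dimS)) * H) = (c_liouville * H * p * delta) / 6.
    by rewrite /c_liouville; field.
  lra.
have : dimS * ((2 * p / q + delta * (p * (2 * dimS))) * H) =
  dimS * (2 * p / q * H) + dimS * (delta * (p * (2 * dimS)) * H) by ring.
lra.
Qed.

(** For e >= d, a subspace B close to A and of not too large height contains e
    independent truncations, hence is generated by them. *)
Lemma frozen_of_close_above e B delta K : (d <= e <= N)%N -> rational_subspace B ->
  \dim B = e -> 0 <= delta -> near_sub delta A B ->
  (forall k, (K <= k)%N -> c_liouville * height B * 2 ^+ a k <= 2 ^+ a (k + d)) ->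
  c_liouville * height B * 2 ^+ a (K + e).-1 * delta < 1 ->
  frozen K e B.
Proof.
move=> /andP[de eN] rB dB d0 nAB h1 h2.
have c1H : 0 <= c_liouville * height B.
  by rewrite mulr_ge0 ?(le_trans _ (height_ge1 rB)) // /c_liouville mulr_ge0 ?sqr_ge0.
have XB k : (K <= k)%N -> (k < K + e)%N -> truncv R d' N' a k \in B.
  move=> Kk kK; apply: (truncv_mem rB d0 nAB); first exact: h1.
  apply: le_lt_trans h2; rewrite ler_wpM2r // ler_wpM2l //.
  by rewrite ler_weXn2l ?ler1n // a_leq //; lia.
have rb : row_basis (real_mx (gen_mx d' N' a e K)) B.
  apply: (row_basis_of_rows dB) => [j|c]; last exact: gen_mx_inj.
  rewrite row_gen_mx // /genv; have je := ltn_ord j.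
  case: ltnP => jd; first by apply: XB; lia.
  have -> : (K + j = (K + j - d) + d)%N by lia.
  by rewrite (unitv_truncv R a dvd_dN) memvB ?memvZ // XB //; lia.
by have := frozen_gen_mx a_incr dvd_dN rb; rewrite (maxn_idPr de).
Qed.

(** For e <= d, the integer generators of B with entries at most H(B) are close to
    A; the truncated equations, once multiplied by 2^(a k), take at them integer
    values of absolute value less than 1. *)
Lemma frozen_of_close_below e B delta K : (e <= d)%N -> rational_subspace B ->
  \dim B = e -> 0 <= delta -> near_sub delta B A ->
  (forall k, (K <= k)%N -> c_liouville * height B * 2 ^+ a k <= 2 ^+ a (k + d)) ->
  c_liouville * height B * 2 ^+ a (K + d).-1 * delta < 1 ->
  frozen K d B.
Proof.
move=> ed rB dB d0 nBA h1 h2.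
have [P rbP Pb] := small_generators rB.
have H1 := height_ge1 rB.
set H := height B in h1 h2 H1 Pb.
have c1H : 0 <= c_liouville * H by rewrite mulr_ge0 ?(le_trans _ H1) // /c_liouville mulr_ge0 ?sqr_ge0.
suff key j t k : (K <= k < K + d)%N -> rowi t = rowi k ->
    yc (row j (real_mx P)) t = psum t k.+1 * xc (row j (real_mx P)) (rowi t).
  move=> X /rbP.1[c ->] u Ku uK; rewrite yc_mul xc_mul mulr_sumr.
  apply: eq_bigr => j _; rewrite mulrCA; congr (_ * _).
  have [k kK ku] := rowi_window K (rowi u).
  rewrite -(@psum_frozen R d' N' a dvd_dN K k u) //; last by lia.
  by rewrite (key j (coli u) k) ?rowi_coli.
move=> kK tk; set Z := row j (real_mx P).
have ZB : Z \in B by exact: row_basis_row.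
have enZ : enorm Z <= dimS * H.
  apply: le_trans (enorm_le_sum Z) _.
  apply: (@le_trans _ _ (\sum_(l < d + N) H)).
    by apply: ler_sum => l _; rewrite /Z mxE.
  rewrite sumr_const card_ord -[leLHS]mulr_natl ler_wpM2r ?(le_trans _ H1) //.
  by rewrite ler_nat.
have [Y YA ZY] := nBA Z ZB.
have F := form_le_dist a_incr Z t YA.
have pk := pow2_gt0 R (a k); have pd := pow2_gt0 R (a (k + d)).
have n1p := dimS_gt0; have n1g := dimS_ge1.
(* This is an integer, and it will be shown to be less than 1 in absolute value. *)
set z := 2 ^+ a k * (yc Z t - psum t k.+1 * xc Z (rowi t)).
have [zz zE] : exists zz : int, z = zz%:~R.
  exists (2 ^+ a k * P j (rshift d t) - (pnum a t k)%:R * P j (lshift N (rowi t))).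
  rewrite rmorphB !rmorphM rmorphXn /= !rmorph_nat pnumE // /z /yc /xc /Z !mxE.
  by ring.
suff z1 : `|z| < 1.
  have : z = 0.
    apply/eqP; apply: contraTT z1; rewrite zE -leNgt; exact: int_norm_ge1.
  move=> /eqP; rewrite mulf_eq0 (gt_eqF pk) /= subr_eq0 => /eqP -> //.
have zle : `|z| <= 2 ^+ a k * (3 * (delta * (dimS * H))) +
     2 ^+ a k * (2 / 2 ^+ a (k + d) * H).
  rewrite /z normrM (ger0_norm (ltW pk)) -mulrDr ler_pM2l //.
  have -> : yc Z t - psum t k.+1 * xc Z (rowi t) =
     (yc Z t - xi t * xc Z (rowi t)) + (xi t - psum t k.+1) * xc Z (rowi t) by ring.
  apply: le_trans (ler_normD _ _) _; apply: lerD.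
    apply: le_trans F _; rewrite ler_pM2l //; apply: le_trans ZY _.
    by rewrite ler_wpM2l.
  have kkd : (k < k + d)%N by rewrite addnS ltnS leq_addr.
  rewrite (@psum_row_frozen R d' N' a dvd_dN k (k + d)) //.
  have /andP[g1 g2] := xi_tail R a_incr t (k + d).
  rewrite normrM (ger0_norm g1); apply: ler_pM => //.
  by have := Pb j (lshift N (rowi t)); rewrite /xc /Z [row _ _ _ _]mxE.
apply: le_lt_trans zle _.
have h1k : c_liouville * H * 2 ^+ a k <= 2 ^+ a (k + d) by apply: h1; case/andP: kK.
have h2k : c_liouville * H * 2 ^+ a k * delta < 1.
  apply: le_lt_trans h2; rewrite ler_wpM2r // ler_wpM2l //.
  by rewrite ler_weXn2l ?ler1n // a_leq //; clear -kK; lia.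
set p := 2 ^+ a k in pk h1k h2k *; set q := 2 ^+ a (k + d) in pd h1k *.
have e1 : p * (3 * (delta * (dimS * H))) <= 1 / 4.
  have : c_liouville * H * p * delta = 4 * (dimS * (p * (3 * (delta * (dimS * H))))).
    by rewrite /c_liouville; ring.
  set w := p * _; have w0 : 0 <= w.
    by rewrite /w !mulr_ge0 ?(ltW pk) ?(ltW n1p) //; lra.
  have : w <= dimS * w by rewrite ler_peMl.
  lra.
have e2 : p * (2 / q * H) <= 1 / 6.
  have : c_liouville * H * p / q <= 1 by rewrite ler_pdivrMr // mul1r.
  have -> : c_liouville * H * p / q = 6 * (dimS ^+ 2 * (p * (2 / q * H))) by rewrite /c_liouville; ring.
  set w := p * _; have w0 : 0 <= w.
    rewrite /w; do 2 (rewrite mulr_ge0 ?(ltW pk) //); last lra.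
    by rewrite divr_ge0 ?ltW.
  have : w <= dimS ^+ 2 * w by rewrite ler_peMl // exprn_ege1.
  lra.
lra.
Qed.

End Approximation.

(** * Lower bounds for the height and the distance of close subspaces *)
Section Window.
Variables (R : realType) (d' N' : nat) (a : nat -> nat).
Local Notation d := d'.+1.
Local Notation N := N'.+1.
Hypothesis a_incr : forall k, (a k < a k.+1)%N.
Hypothesis dvd_dN : (d %| N)%N.
Local Notation V := 'rV[R]_(d + N).
Local Notation real_mx := (map_mx (intr : int -> R)).
Local Notation psum := (psum R a).
Local Notation xi := (xi R a).
Local Notation rowi := (rowi d').
Local Notation coli := (coli N').
Local Notation A := (Aspace R d' N' a).
Local Notation frozen := (@frozen R d' N' a).
Local Notation dimS := (dimS R d' N').
Implicit Types (X Y Z : V) (B : {vspace V}) (i : 'I_d) (t : 'I_N).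

(** At an integer point v of B, the equation of the step k + N reads
    2^(a k) y = p x with p odd. *)
Lemma frozen_dvd K m B (v : 'rV[int]_(d + N)) k : (d <= m <= N)%N -> frozen K m B ->
  real_mx v \in B -> (K <= k < K + d)%N ->
  (Posz (2 ^ a k) %| v ord0 (lshift N (rowi k)))%Z.
Proof.
move=> /andP[dm mN] eqB vB /andP[Kk kK].
have := eqB _ vB (k + N)%N; rewrite coliDN rowiDN // => h.
have {}h : yc (real_mx v) (coli k) = psum (coli k) (k + N) * xc (real_mx v) (rowi k).
  by apply: h; lia.
have frozen : psum (coli k) k.+1 = psum (coli k) (k + N).
  rewrite -[coli k in RHS](coliDN N') -(@psum_frozen R d' N' a dvd_dN K k) ?coliDN //; try lia.
  by rewrite rowiDN.
have /eqP : (2 ^+ a k : R) * yc (real_mx v) (coli k) =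
    (pnum a (coli k) k)%:R * xc (real_mx v) (rowi k).
  by rewrite h pnumE // frozen mulrA.
rewrite /yc /xc !mxE -natrX !pmulrn -!intrM eqr_int => /eqP E.
rewrite -(@Gauss_dvdzr _ (Posz (pnum a (coli k) k))).
  by rewrite -E dvdz_mulr.
rewrite /coprimez /gcdz /= eqz_nat; apply: (coprimeXl (a k)).
by rewrite coprime2n; exact: pnum_odd.
Qed.

(** Coordinates that determine the points of a subspace satisfying the equations
    [frozen K m], when k runs over K <= k < K + m. *)
Definition pivot K k : 'I_(d + N) :=
  if (k < K + d)%N then lshift N (rowi k) else rshift d (coli k).

Lemma pivot_inj K m B X : (d <= m <= N)%N -> frozen K m B -> X \in B ->
  (forall k, (K <= k < K + m)%N -> X 0 (pivot K k) = 0) -> X = 0.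
Proof.
move=> /andP[dm mN] eqB XB X0.
have xc0 i : xc X i = 0.
  have [k kK <-] := rowi_window K i.
  by have := X0 k; rewrite /pivot ifT; [apply; lia | lia].
apply: vec_ext => [i|t]; first by rewrite xc0 /xc mxE.
rewrite [RHS]/yc [RHS]mxE.
have [u uK <-] := coli_window (K + d) t.
have [uKm|Kmu] := ltnP u (K + m).
  by have := X0 u; rewrite /pivot ifF; [apply; lia | lia].
by rewrite (eqB _ XB) //; [rewrite xc0 mulr0 | lia].
Qed.

(** Exponent of the power of 2 that divides the pivot coordinate of index k at the
    integer points. *)
Definition weight K k := if (k < K + d)%N then a k else 0%N.

(** Divisibility of the pivot coordinates gives a lower bound for the height. The
    indices of the columns of the minor are listed in increasing order, so that g j
    can be compared with k0 + j. *)
Lemma height_window e K m B k0 k1 : (d <= m <= N)%N -> rational_subspace B ->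
  \dim B = e -> frozen K m B -> (K <= k0)%N -> (k1 <= K + m)%N ->
  (forall X, X \in B -> (forall k, (k0 <= k < k1)%N -> X 0 (pivot K k) = 0) -> X = 0) ->
  exists g : 'I_e -> nat,
    [/\ forall j : 'I_e, (k0 + j <= g j)%N,
        forall j : 'I_e, (g j + (e - j) <= k1)%N &
        2 ^+ (\sum_j weight K (g j)) <= height B].
Proof.
move=> /andP[dm mN] rB dB eqB Kk0 k1K Binj.
pose kof i := (K + (i + K * d') %% d)%N.
have kofE k : (K <= k < K + d)%N -> kof (rowi k) = k.
  move=> kK.
  have [h1 h2] : (K <= kof (rowi k) < K + d)%N /\ rowi (kof (rowi k)) = rowi k.
    split; first by rewrite /kof leq_addr ltn_add2l ltn_mod.
    apply: val_inj => /=; rewrite modnDmr addnCA -{1}(muln1 K) -mulnDr add1n.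
    by rewrite addnC modnMDl modn_mod.
  move: (kof (rowi k)) h1 h2 => z h1 h2; case/andP: h1 kK => h1 h1' /andP[h3 h4].
  have [hk|hk] := leqP z k.
    by apply: rowi_inj h2 => //; lia.
  by apply/esym; apply: rowi_inj (esym h2); lia.
pose w (x : 'I_(d + N)) : nat :=
  match fintype.split x with inl i => a (kof i) | inr _ => 0%N end.
pose D (x : 'I_(d + N)) := [exists k : 'I_k1, (k0 <= k)%N && (pivot K k == x)].
have Dw k : (k0 <= k < k1)%N -> w (pivot K k) = weight K k.
  move=> kk; rewrite /w /pivot /weight; case: ltnP => kK.
    by rewrite (unsplitK (inl (rowi k))) kofE //; lia.
  by rewrite (unsplitK (inr (coli k))).
have [X XB X0|v vB x /existsP[k /andP[k0k /eqP <-]]|f] :=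
  @height_ge_pow2 R _ B D w rB.
- apply: Binj => // k /andP[k0k kk1]; apply: X0.
  by apply/existsP; exists (Ordinal kk1); rewrite k0k eqxx.
- rewrite Dw ?k0k //= /weight /pivot; case: ltnP => kK.
    by apply: (frozen_dvd (m := m) _ eqB) => //; lia.
  by rewrite expn0 dvd1z.
rewrite dB in f *; case=> f_inj fD fH.
have /choice[q qP] : forall j, exists k : 'I_k1, (k0 <= k)%N && (pivot K k == f j).
  by move=> j; apply/existsP; exact: fD.
have q_inj : injective q.
  move=> j l jl; apply: f_inj; have /andP[_ /eqP <-] := qP j.
  by have /andP[_ /eqP <-] := qP l; rewrite jl.
have [s [g gi qE]] := inj_increasing q_inj.
have gk0 j : (k0 <= g j)%N.
  by have /andP[h _] := qP ((s^-1)%g j); rewrite qE permKV in h.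
have bd := increasing_bounds gi gk0.
exists (fun j => g j : nat); split; [by move=> j; case: (bd j) | by move=> j; case: (bd j) |].
suff -> : (\sum_j weight K (g j) = \sum_i w (f i))%N by [].
rewrite (reindex_inj (@perm_inj _ s)) /=; apply: eq_bigr => j _.
have /andP[h1 /eqP <-] := qP j.
by rewrite Dw ?h1 /= ?ltn_ord // qE.
Qed.

Definition c_defect : R := 6 * dimS.

(** For e >= d, the column of the step K + e is frozen on B but not on A, and this
    bounds the distance from below. *)
Lemma bounds_above e B delta K : (d <= e <= N)%N -> rational_subspace B ->
  \dim B = e -> 0 <= delta -> near_sub delta A B -> frozen K e B ->
  (2 ^+ a (K + e))^-1 <= c_defect * delta /\
  2 ^+ (\sum_(j < d) a (K + j)) <= height B.
Proof.
move=> deN rB dB d0 nAB eqB; have /andP[de eN] := deN; split.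
  set u := (K + e)%N; have [Z ZB YZ] := nAB _ (limv_mem R N' a (rowi u)).
  set Y := limv _ _ _ _ in YZ.
  have uE : yc Z (coli u) = psum (coli u) u * xc Z (rowi u) by apply: (eqB _ ZB); rewrite /u; lia.
  have h : xi (coli u) - psum (coli u) u =
      yc (Y - Z) (coli u) - psum (coli u) u * xc (Y - Z) (rowi u).
    rewrite ycB xcB uE yc_vec xc_vec rowi_coli // !eqxx /=.
    by rewrite mul1r mulrBr mulr1 opprB addrA subrK.
  apply: le_trans (xi_tail_ge R N' a_incr u) _; rewrite h.
  apply: le_trans (ler_norm _) _; apply: le_trans (ler_normB _ _) _.
  rewrite normrM (ger0_norm (psum_ge0 _ _ _ _)).
  have g1 := yc_le (Y - Z) (coli u); have g2 := xc_le (Y - Z) (rowi u).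
  have g3 : psum (coli u) u * `|xc (Y - Z) (rowi u)| <= 2 * enorm (Y - Z).
    by apply: ler_pM => //; [exact: psum_ge0 | exact: psum_le2].
  have g4 : enorm (Y - Z) <= delta * (2 * dimS).
    by apply: le_trans YZ _; rewrite ler_wpM2l // enorm_limv.
  rewrite /c_defect; lra.
have [X XB X0|g [g1 g2 gH]] :=
    @height_window e K e B K (K + e) deN rB dB eqB (leqnn _) (leqnn _).
  exact: pivot_inj XB X0.
apply: le_trans gH; rewrite ler_weXn2l ?ler1n //.
have gE (j : 'I_e) : g j = (K + j)%N.
  by have := g1 j; have := g2 j; have := ltn_ord j; lia.
rewrite (eq_bigr (fun j : 'I_e => weight K (K + j))); last by move=> j _; rewrite gE.
rewrite (big_ord_widen_cond e xpredT (fun j => a (K + j)) de) /=.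
rewrite big_mkcond /=; apply: leq_sum => j _.
by rewrite /weight ltn_add2l; case: ifP.
Qed.

(** For e <= d, let k be the step of the window whose row carries the largest head
    coordinate of a given point of B: the column of the step k + d shows that delta
    is at least of the order of 2^-(a (k + d)). Thus the points of B are determined
    by the rows of the steps k for which this holds; these are the k >= k0 of the
    window, and the height is bounded below by the e smallest of them. *)
Lemma bounds_below e B delta K : (1 <= e <= d)%N -> rational_subspace B ->
  \dim B = e -> 0 <= delta -> near_sub delta B A -> frozen K d B ->
  exists k0, [/\ (K <= k0)%N, (2 ^+ a (k0 + d))^-1 <= c_defect * delta &
    2 ^+ (\sum_(j < e) a (k0 + j)) <= height B].
Proof.
move=> /andP[e1 ed] rB dB d0 nBA eqB.
have dN := leq_dN dvd_dN.
pose good k := (2 ^+ a (k + d))^-1 <= c_defect * delta.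
have good_leq k k' : (k <= k')%N -> good k -> good k'.
  move=> kk' gk; apply: le_trans gk; rewrite lef_pV2 ?posrE ?pow2_gt0 //.
  by rewrite ler_weXn2l ?ler1n // a_leq // leq_add2r.
have key X : X \in B -> X != 0 ->
    exists2 k, (K <= k < K + d)%N & good k /\ xc X (rowi k) != 0.
  move=> XB X_neq0.
  pose i := [arg max_(j > ord0) `|xc X j|]%O.
  have imax j : `|xc X j| <= `|xc X i|.
    by rewrite /i; case: arg_maxP => // l _; apply.
  have [k kK ki] := rowi_window K i.
  have ymax t : `|yc X t| <= 2 * `|xc X i|.
    have [u uK <-] := coli_window (K + d) t.
    rewrite (eqB _ XB) //; try lia.
    rewrite normrM (ger0_norm (psum_ge0 _ _ _ _)).
    by apply: ler_pM => //; [exact: psum_ge0 | exact: psum_le2].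
  have eX : enorm X <= 2 * dimS * `|xc X i|.
    apply: le_trans (enorm_le X) _.
    apply: (@le_trans _ _ (\sum_(j < d) `|xc X i| + \sum_(t < N) 2 * `|xc X i|)).
      by apply: lerD; apply: ler_sum => j _.
    rewrite !sumr_const !card_ord -[_ *+ d]mulr_natl -[_ *+ N]mulr_natl mulrA -mulrDl.
    by rewrite ler_wpM2r // -natrM -natrD /dimS -natrM ler_nat; lia.
  have Mp : 0 < `|xc X i|.
    rewrite normr_gt0; apply: contra X_neq0 => /eqP xi_zero.
    rewrite -enorm_eq0 eq_le enorm_ge0 andbT; apply: le_trans eX _.
    by rewrite xi_zero normr0 mulr0.
  exists k => //; rewrite ki -normr_gt0; split=> //.
  have [Y YA XY] := nBA X XB.
  have F := form_le_dist a_incr X (coli (k + d)) YA.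
  have E : yc X (coli (k + d)) = psum (coli (k + d)) (k + d) * xc X i.
    by rewrite (eqB _ XB) ?rowiDd ?ki //; clear -kK dN; lia.
  rewrite E rowi_coli // rowiDd ki -mulrBl normrM distrC in F.
  have G := xi_tail_ge R N' a_incr (k + d).
  rewrite /good -(ler_pM2r Mp).
  apply: (@le_trans _ _ (`|xi (coli (k + d)) - psum (coli (k + d)) (k + d)| * `|xc X i|)).
    by rewrite ler_pM2r //; apply: le_trans G (ler_norm _).
  apply: le_trans F _.
  have : delta * enorm X <= delta * (2 * dimS * `|xc X i|) by rewrite ler_wpM2l.
  by rewrite /c_defect; lra.
have ex_good : exists k, (K <= k)%N && `[< good k >].
  have B0 : B != 0%VS by rewrite -dimv_eq0 dB -lt0n.
  have [] := key (vpick B) (memv_pick B); first by rewrite vpick0.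
  by move=> k /andP[Kk _] [gk _]; exists k; rewrite Kk; apply/asboolP.
case: (ex_minnP ex_good) => k0 /andP[Kk0 /asboolP gk0] k0min.
exists k0; split=> //.
have ddN : (d <= d <= N)%N by rewrite leqnn.
have [X XB X0|g [g1 g2 gH]] :=
    @height_window e K d B k0 (K + d) ddN rB dB eqB Kk0 (leqnn _).
  apply/eqP; apply: contraT => X_neq0.
  have [k kK [gk xk]] := key X XB X_neq0.
  have k0k : (k0 <= k)%N.
    by apply: k0min; apply/andP; split; [lia | apply/asboolP].
  have := X0 k; rewrite /pivot ifT; last lia.
  by move=> h; move: xk; rewrite /xc h ?eqxx //; lia.
apply: le_trans gH; rewrite ler_weXn2l ?ler1n //; apply: leq_sum => j _.
have gj := g2 j; have gj' := g1 j; have je := ltn_ord j.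
by rewrite /weight ifT; [apply: a_leq | lia].
Qed.

End Window.

(** * Good approximations, and the link with the exponents *)
Section Exponents.
Variables (R : realType) (d' N' : nat) (a : nat -> nat).
Local Notation d := d'.+1.
Local Notation N := N'.+1.
Hypothesis a_incr : forall k, (a k < a k.+1)%N.
Hypothesis dvd_dN : (d %| N)%N.
Local Notation V := 'rV[R]_(d + N).
Local Notation real_mx := (map_mx (intr : int -> R)).
Local Notation psum := (psum R a).
Local Notation xi := (xi R a).
Local Notation rowi := (rowi d').
Local Notation coli := (coli N').
Local Notation A := (Aspace R d' N' a).
Local Notation frozen := (@frozen R d' N' a).
Local Notation dimS := (dimS R d' N').
Local Notation c_liouville := (c_liouville R d' N').
Local Notation c_defect := (c_defect R d' N').
Implicit Types (X Y Z : V) (B : {vspace V}) (i : 'I_d) (t : 'I_N).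

(** B nearly contains A or is nearly contained in A, according to the dimensions;
    this is what the last principal sine measures. *)
Definition close_to e (delta : R) B :=
  if (d <= e)%N then near_sub delta A B else near_sub delta B A.

(** Common form of the bounds in the two cases: a close subspace B of dimension e is,
    as far as height and distance are concerned, no better than the subspace
    generated by the truncations of the steps k0 <= k < k0 + e. *)
Lemma close_bounds e B delta K : (1 <= e <= N)%N -> rational_subspaces e B ->
  0 <= delta -> close_to e delta B ->
  (forall k, (K <= k)%N -> c_liouville * height B * 2 ^+ a k <= 2 ^+ a (k + d)) ->
  c_liouville * height B * 2 ^+ a (K + maxn d e).-1 * delta < 1 ->
  exists k0, [/\ (K <= k0)%N, (2 ^+ a (k0 + maxn d e))^-1 <= c_defect * delta &
    2 ^+ (\sum_(j < minn d e) a (k0 + j)) <= height B].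
Proof.
move=> /andP[e1 eN] [rB dB] d0; rewrite /close_to; case: (leqP d e) => de nB h1 h2.
  have deN : (d <= e <= N)%N by rewrite de.
  have eqB := frozen_of_close_above a_incr dvd_dN deN rB dB d0 nB h1 h2.
  by have [g1 g2] := bounds_above a_incr dvd_dN deN rB dB d0 nB eqB; exists K.
have eqB := frozen_of_close_below a_incr dvd_dN (ltnW de) rB dB d0 nB h1 h2.
by apply: bounds_below nB eqB; rewrite // e1 ltnW.
Qed.

Lemma sum_minn e (F : nat -> nat) :
  (\sum_(j < e) (if j < d then F j else 0) = \sum_(j < minn d e) F j)%N.
Proof.
case: (leqP d e) => [de|/ltnW ed].
  rewrite -big_mkcond /=.
  by rewrite (big_ord_widen_cond e xpredT F de).
by apply: eq_bigr => j _; rewrite ifT // (leq_trans (ltn_ord j)).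
Qed.

Definition c_approx e : R :=
  (#|{ffun 'I_e -> 'I_(d + N)}| * e`!)%:R * 2 ^+ e + 2 * dimS.

Lemma height_gen_mx e K B : row_basis (real_mx (gen_mx d' N' a e K)) B ->
  height B <= c_approx e * 2 ^+ (\sum_(j < minn d e) a (K + j)).
Proof.
move=> rbW; apply: le_trans (height_le_int_basis rbW) _.
pose r (j : 'I_e) : R := 2 * 2 ^+ (if (j < d)%N then a (K + j) else 0%N).
have r_ge1 j : 1 <= r j.
  by rewrite /r -exprS exprn_ege1 // ler1n.
have Wr j l : `|real_mx (gen_mx d' N' a e K) j l| <= r j.
  have -> : real_mx (gen_mx d' N' a e K) j l = genv R d' N' a K j 0 l.
    by rewrite -row_gen_mx // [RHS]mxE.
  have bx (b : bool) (x : R) : 0 <= x -> x <= r j -> `|b%:R * x| <= r j.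
    move=> x0 xr; rewrite normrM normr_nat (ger0_norm x0).
    by case: b; rewrite ?mul1r // mul0r (le_trans _ (r_ge1 j)).
  have bn (b : bool) : `|b%:R : R| <= r j.
    by rewrite normr_nat (le_trans _ (r_ge1 j)) // lern1 leq_b1.
  have pa := pow2_gt0 R (a (K + j)).
  rewrite /genv; case: (split_ordP l) => l' ->; case: ltnP => jd.
  - rewrite -[_ 0 _]/(xc _ l') xc_vec; apply: bx; rewrite ?ltW //.
    by rewrite /r jd; lra.
  - by rewrite -[_ 0 _]/(xc _ l') xc_vec normr0 (le_trans _ (r_ge1 j)).
  - rewrite -[_ 0 _]/(yc _ l') yc_vec; apply: bx; first by rewrite mulr_ge0 ?psum_ge0 ?ltW.
    by rewrite /r jd mulrC ler_pM2r // psum_le2.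
  - by rewrite -[_ 0 _]/(yc _ l') yc_vec.
have r_ge0 j : 0 <= r j by apply: le_trans (r_ge1 j).
apply: le_trans (wedge_norm_le_prod r_ge0 Wr) _.
have -> : \prod_i r i = 2 ^+ e * 2 ^+ (\sum_(j < minn d e) a (K + j)).
  rewrite /r big_split /= prodr_const card_ord; congr (_ * _).
  by rewrite prodrXr (sum_minn e (fun j => a (K + j))).
rewrite mulrA ler_pM2r ?pow2_gt0 // /c_approx lerDl mulr_ge0 // ltW //; exact: dimS_gt0.
Qed.

Lemma near_sub_le n (A' B' : {vspace 'rV[R]_n}) x y :
  x <= y -> near_sub x A' B' -> near_sub y A' B'.
Proof.
move=> xy h X /h[Y YB XY]; exists Y => //; apply: le_trans XY _.
by rewrite ler_wpM2r ?enorm_ge0.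
Qed.

Lemma close_le e x y B : x <= y -> close_to e x B -> close_to e y B.
Proof. by move=> xy; rewrite /close_to; case: ifP => _; exact: near_sub_le. Qed.

Lemma enorm_tail (D : V) M b : (forall i, xc D i = 0) -> (forall t, `|yc D t| <= b * M) ->
  0 <= b * M -> enorm D <= dimS * b * M.
Proof.
move=> D0 Db b0; apply: le_trans (enorm_le D) _.
rewrite big1 ?add0r; last by move=> i _; rewrite D0 normr0.
apply: (@le_trans _ _ (\sum_(t < N) b * M)); first by apply: ler_sum.
rewrite sumr_const card_ord -[leLHS]mulr_natl -mulrA ler_wpM2r // ler_nat.
by rewrite ltnW // ltnS leq_addl.
Qed.

(** In both cases the point of A or B with the same pivot coordinates, respectively
    the same head coordinates, differs from the given one only in columns frozen
    until the step K + max(d, e). *)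
Lemma close_gen_mx e K B : (1 <= e <= N)%N -> row_basis (real_mx (gen_mx d' N' a e K)) B ->
  close_to e (2 * dimS / 2 ^+ a (K + maxn d e)) B.
Proof.
move=> /andP[e1 eN] rbW; have eqB := frozen_gen_mx a_incr dvd_dN rbW.
have dN := leq_dN dvd_dN.
set m := maxn d e in eqB *; have dm : (d <= m)%N by exact: leq_maxl.
have mN : (m <= N)%N by rewrite geq_max dN.
set b : R := 2 / 2 ^+ a (K + m).
have b0 : 0 <= b by rewrite divr_ge0 // ltW ?pow2_gt0.
have -> : 2 * dimS / 2 ^+ a (K + m) = dimS * b by rewrite /b mulrA [2 * _]mulrC.
have tail u x : (K + m <= u)%N -> `|(xi (coli u) - psum (coli u) u) * x| <= b * `|x|.
  move=> Ku; rewrite normrM ler_wpM2r //.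
  have /andP[g1 g2] := xi_tail R a_incr (coli u) u.
  rewrite (ger0_norm g1); apply: le_trans g2 _; rewrite ler_pM2l //.
  by rewrite lef_pV2 ?posrE ?pow2_gt0 // ler_weXn2l ?ler1n // a_leq.
rewrite /close_to; case: (leqP d e) => de X XAB.
  have me : m = e by exact/maxn_idPr.
  have XA : forall t, yc X t = xi t * xc X (rowi t) by apply/mem_Aspace.
  (* The point of B with the same pivot coordinates as X. *)
  have [Z ZB ZX] : exists2 Z, Z \in B &
      forall k, (K <= k < K + m)%N -> Z 0 (pivot d' N' K k) = X 0 (pivot d' N' K k).
    pose f (j : 'I_e) := pivot d' N' K (K + j).
    pose M := colsub f (real_mx (gen_mx d' N' a e K)).
    have Mu : M \in unitmx.
      rewrite -row_free_unit -kermx_eq0; apply/rowV0P => c /sub_kermxP cM.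
      apply: rbW.2; apply: (@pivot_inj R d' N' a dvd_dN K m B).
      - by rewrite dm.
      - by [].
      - by apply/rbW.1; exists c.
      move=> k kK; have ke : (k - K < e)%N by lia.
      have /rowP/(_ (Ordinal ke)) := cM; rewrite /M mulmx_colsub !mxE /f /=.
      by rewrite subnKC //; lia.
    exists ((\row_j X 0 (f j)) *m invmx M *m real_mx (gen_mx d' N' a e K)).
      by apply/rbW.1; eexists.
    move=> k kK; have ke : (k - K < e)%N by lia.
    have -> : k = (K + Ordinal ke)%N by rewrite /= subnKC //; lia.
    have /rowP/(_ (Ordinal ke)) h : colsub f ((\row_j X 0 (f j)) *m invmx M
        *m real_mx (gen_mx d' N' a e K)) = \row_j X 0 (f j).
      by rewrite -mulmx_colsub mulmxKV.
    by rewrite [LHS]mxE [RHS]mxE in h.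
  exists Z => //; apply: enorm_tail; last by rewrite mulr_ge0 ?enorm_ge0.
    move=> i; rewrite xcB; have [k kK <-] := rowi_window K i.
    have := ZX k; rewrite /pivot ifT /xc; last by lia.
    by move=> ->; [rewrite subrr | lia].
  have xZ i : xc Z i = xc X i.
    have [k kK <-] := rowi_window K i.
    have := ZX k; rewrite /pivot ifT /xc; last by lia.
    by apply; lia.
  move=> t; rewrite ycB; have [u uK <-] := coli_window (K + d) t.
  have [uKm|Kmu] := ltnP u (K + m).
    have := ZX u; rewrite /pivot ifF /yc; last by lia.
    move=> ->; last by lia.
    by rewrite subrr normr0 mulr_ge0 ?enorm_ge0.
  rewrite XA (eqB _ ZB) //; last by lia.
  rewrite xZ rowi_coli // -mulrBl; apply: le_trans (tail _ _ Kmu) _.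
  by rewrite ler_wpM2l // xc_le.
have me : m = d by apply/maxn_idPl; exact: ltnW.
exists (vec (xc X) (fun t => xi t * xc X (rowi t))).
  by apply/mem_Aspace => // t; rewrite yc_vec xc_vec.
apply: enorm_tail; last by rewrite mulr_ge0 ?enorm_ge0.
  by move=> i; rewrite xcB xc_vec subrr.
move=> t; have [u uK <-] := coli_window (K + d) t.
rewrite ycB yc_vec rowi_coli // (eqB _ XAB); [|lia..].
rewrite -mulrBl -normrN -mulNr opprB.
apply: le_trans (tail u _ _) _; first lia.
by rewrite ler_wpM2l // xc_le.
Qed.

Lemma good_approximations e : (1 <= e <= N)%N ->
  forall K, exists B, [/\ rational_subspaces e B,
    height B <= c_approx e * 2 ^+ (\sum_(j < minn d e) a (K + j)) &
    close_to e (c_approx e / 2 ^+ a (K + maxn d e)) B].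
Proof.
move=> eN K; have /andP[e1 eN'] := eN.
have [B rb] := row_basis_exists (fun c => @gen_mx_inj R d' N' a a_incr dvd_dN e K c eN').
exists B; split; last first.
- apply: close_le (close_gen_mx eN rb); rewrite ler_pM2r ?invpow2_gt0 //.
  by rewrite /c_approx lerDr mulr_ge0 // exprn_ge0.
- exact: height_gen_mx.
- by split; [exact: int_basis_rational rb | exact: row_basis_dim rb].
Qed.

Lemma gdef0 e : (e <= N)%N -> gdef (d + N) d e = 0%N.
Proof. by rewrite /gdef; lia. Qed.

Lemma psi_close e B : (1 <= e <= N)%N -> \dim B = e ->
  close_to e (dimS * psi (minn d e) A B) B.
Proof.
move=> /andP[e1 eN] dB.
have dA : \dim A = d by exact: dim_Aspace.
rewrite /psi dA dB gdef0 // addn0 /close_to; case: (leqP d e) => de.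
  apply: near_sub_le (near_omega_le dA _); last by rewrite dB.
  rewrite ler_wpM2r ?omega_ge0 // ler_nat; lia.
case: e => // e' in e1 eN dB de *.
apply: near_sub_le (near_omega_ge dB _); last by rewrite dA ltnW.
rewrite ler_wpM2r ?omega_ge0 // ler_nat; lia.
Qed.

Lemma psi_le e B delta : (1 <= e <= N)%N -> \dim B = e ->
  close_to e delta B -> psi (minn d e) A B <= delta.
Proof.
move=> /andP[e1 eN] dB.
have dA : \dim A = d by exact: dim_Aspace.
rewrite /psi dA dB gdef0 // addn0 /close_to; case: (leqP d e) => de nB.
  by apply: omega_le_near nB; rewrite ?dA ?dB.
case: e => // e' in e1 eN dB de nB *.
by apply: omega_le_near_sym nB; rewrite ?dA ?dB // ltnW.
Qed.

Lemma psi_ge0 j B : 0 <= psi j A B. Proof. exact: omega_ge0. Qed.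

Lemma le_pow2 (x : R) : exists m : nat, x <= 2 ^+ m.
Proof.
exists (Num.bound `|x|); apply: le_trans (ler_norm x) _.
apply: le_trans (ltW (archi_boundP (normr_ge0 x))) _.
by rewrite -natrX ler_nat ltnW // ltn_expl.
Qed.

Hypothesis a_gaps : forall m, exists K, forall k, (K <= k)%N -> (a k + m <= a (k + d))%N.

(** A distance zero would contradict the lower bound of [close_bounds]; this is the
    irrationality of A. *)
Lemma not_close0 e B : (1 <= e <= N)%N -> rational_subspaces e B -> ~ close_to e 0 B.
Proof.
move=> eN rB nB; have [m hm] := le_pow2 (c_liouville * height B).
have [K hK] := a_gaps m.
have [||k0 [_ h _]] := close_bounds eN rB (lexx 0) nB (K := K).
- move=> k /hK h; apply: (@le_trans _ _ (2 ^+ m * 2 ^+ a k)).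
    by rewrite ler_pM2r ?pow2_gt0.
  by rewrite -exprD ler_weXn2l ?ler1n // addnC.
- by rewrite mulr0.
by move: h; rewrite mulr0 leNgt invpow2_gt0.
Qed.

Lemma A_irrational e : (1 <= e <= N)%N ->
  irrational_subspaces d e (minn d e) A.
Proof.
move=> eN; split; first exact: dim_Aspace.
have /andP[e1 eN'] := eN; have dA : \dim A = d by exact: dim_Aspace.
move=> B rB; rewrite gdef0 // addn0 ltnNge; apply/negP => h.
apply: (not_close0 eN rB); have [_ dB] := rB; rewrite /close_to; case: (leqP d e) h => de h X XAB.
  exists X; rewrite ?subrr ?mul0r; last by rewrite /enorm dot0l sqrtr0.
  have /eqP E : (A :&: B)%VS == A by rewrite eqEdim capvSl dA.
  have : X \in (A :&: B)%VS by rewrite E.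
  by rewrite memv_cap => /andP[].
exists X; rewrite ?subrr ?mul0r; last by rewrite /enorm dot0l sqrtr0.
have /eqP E : (A :&: B)%VS == B by rewrite eqEdim capvSr dB.
have : X \in (A :&: B)%VS by rewrite E.
by rewrite memv_cap => /andP[].
Qed.

Lemma psi_gt0 e B : (1 <= e <= N)%N -> rational_subspaces e B ->
  0 < psi (minn d e) A B.
Proof.
move=> eN rB; rewrite lt0r psi_ge0 andbT; apply/eqP => h.
have := psi_close eN rB.2; rewrite h mulr0; exact: not_close0.
Qed.

End Exponents.

(** * The value of the exponents *)
Section ExponentValue.
Variables (R : realType) (d' N' : nat) (alpha : nat -> R).
Local Notation d := d'.+1.
Local Notation N := N'.+1.
Hypothesis alpha_ge1 : 1 <= alpha 0.
Hypothesis alpha_growth : forall k, 4 * alpha k <= alpha k.+1.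
Hypothesis dvd_dN : (d %| N)%N.
Local Notation V := 'rV[R]_(d + N).
Local Notation dimS := (dimS R d' N').
Local Notation c_liouville := (c_liouville R d' N').
Local Notation c_defect := (c_defect R d' N').
Implicit Types (B : {vspace V}).

(** The steps are the integer parts of alpha. The ratio of the two tends to 1, so
    that the exponents depend on alpha only. *)
Definition steps k : nat := Num.truncn (alpha k).
Local Notation a := steps.
Local Notation A := (Aspace R d' N' a).

Lemma alpha_lb k : 1 <= alpha k /\ k%:R <= alpha k.
Proof.
elim: k => [|k [h1 h2]]; first by split=> //; exact: le_trans alpha_ge1.
by have := alpha_growth k; split; rewrite -?natr1; lra.
Qed.

Lemma alpha_le k k' : (k <= k')%N -> alpha k <= alpha k'.
Proof.
elim: k' => [|k' IH]; first by rewrite leqn0 => /eqP->.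
rewrite leq_eqVlt => /orP[/eqP->//|/IH h]; apply: le_trans h _.
by have := alpha_growth k'; have [] := alpha_lb k'; lra.
Qed.

Lemma steps_bounds k : alpha k - 1 < (a k)%:R <= alpha k.
Proof.
have [a1 _] := alpha_lb k; have /truncn_itv/andP[h1 h2] : 0 <= alpha k by lra.
by rewrite h1 andbT; move: h2; rewrite -natr1 /steps; lra.
Qed.

Lemma steps_incr k : (a k < a k.+1)%N.
Proof.
rewrite -(ltr_nat R); have /andP[h1 h2] := steps_bounds k.
have /andP[h3 h4] := steps_bounds k.+1.
by have := alpha_growth k; have [] := alpha_lb k; lra.
Qed.

Lemma steps_gaps m : exists K, forall k, (K <= k)%N -> (a k + m <= a (k + d))%N.
Proof.
exists m.+1 => k mk; rewrite -(ler_nat R) natrD.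
have /andP[h1 h2] := steps_bounds k.
have /andP[h3 h4] := steps_bounds (k + d).
have h5 : alpha k.+1 <= alpha (k + d) by apply: alpha_le; rewrite addnS ltnS leq_addr.
have h6 : m%:R <= k%:R :> R by rewrite ler_nat ltnW.
by have := alpha_growth k; have [] := alpha_lb k; lra.
Qed.

Let L : R := ln 2.

Lemma ln2_gt0 : 0 < L. Proof. by rewrite ln_gt0 // ltr1n. Qed.

Lemma ln_pow2 k : ln (2 ^+ k) = k%:R * L :> R.
Proof. by rewrite lnXn // mulr_natl. Qed.

Lemma ln_le_pow2 (x y : R) k k' : 0 < x -> 0 < y ->
  (x * 2 ^+ k <= y * 2 ^+ k') = (ln x + k%:R * L <= ln y + k'%:R * L).
Proof.
move=> x0 y0; have pk := pow2_gt0 R k; have pk' := pow2_gt0 R k'.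
by rewrite -!ln_pow2 -!lnM ?posrE // ler_ln ?posrE // mulr_gt0.
Qed.

Lemma c_liouville_ge1 : 1 <= c_liouville.
Proof.
have : 1 <= dimS ^+ 2 by rewrite exprn_ege1 // dimS_ge1.
by rewrite /c_liouville; lra.
Qed.

Lemma c_defect_ge1 : 1 <= c_defect.
Proof. by rewrite /c_defect; have := dimS_ge1 R d' N'; lra. Qed.

Section FixedDimension.
Variables (e : nat) (kappa : R).
Hypothesis eN : (1 <= e <= N)%N.
Local Notation mx := (maxn d e).
Local Notation mn := (minn d e).
Hypothesis kappa_ub : forall K,
  alpha (K + mx) <= kappa * \sum_(j < mn) alpha (K + j).

Let mn_gt0 : (0 < mn)%N. Proof. by case/andP: eN => h _; rewrite leq_min. Qed.
Let mn_d : (mn <= d)%N. Proof. exact: geq_minl. Qed.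
Let d_mx : (d <= mx)%N. Proof. exact: leq_maxl. Qed.

Lemma sum_alpha_le K m : \sum_(j < m.+1) alpha (K + j) <= 4 / 3 * alpha (K + m).
Proof.
elim: m => [|m IH]; first by rewrite big_ord1 addn0; have [] := alpha_lb K; lra.
rewrite big_ord_recr /= addnS; have := alpha_growth (K + m).
by have [] := alpha_lb (K + m); lra.
Qed.

Lemma sum_alpha_ge0 K : 0 < \sum_(j < mn) alpha (K + j).
Proof.
rewrite -(prednK mn_gt0) big_ord_recr /=.
apply: ltr_wpDl; last by have [] := alpha_lb (K + mn.-1); lra.
by apply: sumr_ge0 => j _; have [] := alpha_lb (K + j); lra.
Qed.

Lemma kappa_gt0 : 0 < kappa.
Proof.
rewrite -(pmulr_lgt0 _ (sum_alpha_ge0 0)); apply: lt_le_trans (kappa_ub 0).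
by have [] := alpha_lb (0 + mx); lra.
Qed.

Lemma kappa_lb k : 3 * alpha (k + mx) <= kappa * alpha (k + d).
Proof.
have h1 := kappa_ub k.+1; have h2 := alpha_growth (k + mx).
have h3 := sum_alpha_le k.+1 mn.-1; rewrite (prednK mn_gt0) in h3.
have h4 : alpha (k.+1 + mn.-1) <= alpha (k + d).
  by apply: alpha_le; rewrite addSnnS (prednK mn_gt0) leq_add2l.
have h5 : kappa * \sum_(j < mn) alpha (k.+1 + j) <= kappa * (4 / 3 * alpha (k + d)).
  by rewrite ler_pM2l ?kappa_gt0 //; lra.
by move: h1; rewrite addSn; lra.
Qed.

Lemma kappa_ge3 : 3 <= kappa.
Proof.
have h := kappa_lb 0; have h1 : alpha (0 + d) <= alpha (0 + mx) by apply: alpha_le.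
have [h2 _] := alpha_lb (0 + d).
have : 3 * alpha (0 + d) <= kappa * alpha (0 + d) by lra.
by rewrite ler_pM2r //; lra.
Qed.

(** The margin of the argument: since alpha grows by a factor at least 4 at each
    step, kappa is so large that a subspace with exponent kappa has a height that
    forces all its generators to be truncations. *)
Lemma gap_lb k : 3 / 2 * alpha (k + mx) <= (kappa - 1) * (alpha (k + d) - alpha k).
Proof.
have h := kappa_lb k; have h3 := kappa_ge3.
have h1 : alpha (k + d) <= alpha (k + mx) by apply: alpha_le; rewrite leq_add2l.
have h2 : 4 * alpha k <= alpha (k + d).
  apply: le_trans (alpha_growth k) _; apply: alpha_le.
  by rewrite addnS ltnS leq_addr.
have h4 : (kappa - 1) * (3 / 4 * alpha (k + d)) <= (kappa - 1) * (alpha (k + d) - alpha k).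
  by rewrite ler_wpM2l; lra.
lra.
Qed.

Let c := ln c_liouville + ln dimS + ln c_defect.

Let lnc1 : 0 <= ln c_liouville. Proof. by rewrite ln_ge0 // c_liouville_ge1. Qed.
Let lnn1 : 0 <= ln dimS. Proof. by rewrite ln_ge0 // dimS_ge1. Qed.
Let lnc2 : 0 <= ln c_defect. Proof. by rewrite ln_ge0 // c_defect_ge1. Qed.

(** Let K be the first index from which the height condition of [close_bounds]
    holds; its minimality bounds the height from below, and [gap_lb] then gives the
    condition on the distance. The bounds of [close_bounds] at k0 >= K, compared with
    the definition of kappa and with m > kappa, bound k0, hence K, hence the
    height. *)
Lemma height_bound m : kappa < m -> exists H : R, forall B,
  rational_subspaces e B -> psi mn A B <= height B `^ (- m) -> height B <= H.
Proof.
move=> km; have L0 := ln2_gt0; have k3 := kappa_ge3.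
have lc1 := lnc1; have ln1' := lnn1; have lc2 := lnc2.
pose good B k := c_liouville * height B * 2 ^+ a k <= 2 ^+ a (k + d) :> R.
(* Thresholds beyond which the asymptotic inequalities hold. *)
pose T1 : R := 2 / L * (kappa * (L + c) + c + 1).
pose K1 := (Num.bound `|T1|).+1.
have K1P k : (K1 <= k.+1)%N -> kappa * (L + c) + c < L / 2 * alpha k.
  rewrite ltnS => hk; have [_ ak] := alpha_lb k.
  have h0 : `|T1| < (Num.bound `|T1|)%:R by exact: archi_boundP.
  have h1 : T1 < alpha k.
    apply: le_lt_trans (ler_norm _) _; apply: lt_le_trans h0 _.
    by apply: le_trans ak; rewrite ler_nat.
  have : L / 2 * T1 < L / 2 * alpha k by rewrite ltr_pM2l // divr_gt0.
  have -> : L / 2 * T1 = kappa * (L + c) + c + 1 by rewrite /T1; field; rewrite gt_eqF.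
  by lra.
pose T2 : R := (L * kappa * mn%:R + c) / ((m - kappa) * L).
pose K2 := (Num.bound `|T2|).+1.
pose Kmax := maxn K1 K2.
exists (2 ^+ a (Kmax + d)) => B rB psiB.
have H1 := height_ge1 rB.1; have lnH : 0 <= ln (height B) by rewrite ln_ge0.
set h := ln (height B) in lnH.
have psi0 := psi_gt0 steps_incr dvd_dN steps_gaps eN rB.
set p := - ln (psi mn A B).
have Hp : 0 < height B by lra.
have pmh : m * h <= p.
  rewrite /p lerNr -mulNr /h -ln_powR ler_ln ?posrE // powR_gt0 //.
have goodE k : good B k <-> ln c_liouville + h + (a k)%:R * L <= (a (k + d))%:R * L.
  have c1p : 0 < c_liouville by apply: lt_le_trans c_liouville_ge1.
  have c1H : 0 < c_liouville * height B by exact: mulr_gt0.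
  rewrite /good -[leRHS]mul1r ln_le_pow2 // ln1 add0r.
  by rewrite (lnM (x := c_liouville) (y := height B)) ?posrE.
have ex_good : exists K, `[< forall k, (K <= k)%N -> good B k >].
  have [q hq] := le_pow2 (c_liouville * height B); have [K hK] := steps_gaps q.
  exists K; apply/asboolP => k /hK hk; apply: (@le_trans _ _ (2 ^+ q * 2 ^+ a k)).
    by rewrite ler_pM2r ?pow2_gt0.
  by rewrite -exprD ler_weXn2l ?ler1n // addnC.
case: (ex_minnP ex_good) => K /asboolP goodK Kmin.
suff KKmax : (K <= Kmax)%N.
  have := goodK _ KKmax; apply: le_trans; rewrite /good.
  have g1 : 1 <= 2 ^+ a Kmax :> R by rewrite exprn_ege1 // ler1n.
  rewrite -mulrA mulrCA ler_peMr ?(ltW Hp) //.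
  by rewrite mulr_ege1 // c_liouville_ge1.
rewrite leqNgt; apply/negP; rewrite gtn_max => /andP[K1K K2K].
have K_gt0 : (0 < K)%N by exact: leq_trans K1K.
(* Minimality of K bounds the height from below. *)
have hlow : (a (K.-1 + d))%:R * L < ln c_liouville + h + (a K.-1)%:R * L.
  rewrite ltNge; apply/negP => /goodE gK.
  have : (K <= K.-1)%N.
    apply: Kmin; apply/asboolP => k; rewrite leq_eqVlt => /orP[/eqP<-//|].
    by rewrite prednK // => /goodK.
  by rewrite -ltnS prednK // ltnn.
have cond : c_liouville * height B * 2 ^+ a (K + mx).-1 * (dimS * psi mn A B) < 1.
  have n1p := dimS_gt0 R d' N'; have c1p : 0 < c_liouville by apply: lt_le_trans c_liouville_ge1.
  have c1H : 0 < c_liouville * height B by exact: mulr_gt0.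
  have nps : 0 < dimS * psi mn A B by exact: mulr_gt0.
  suff g0 : ln c_liouville + h + (ln dimS - p) + (a (K + mx).-1)%:R * L < 0.
    rewrite ltNge; apply/negP => ge1.
    have : 1 * 2 ^+ 0 <= c_liouville * height B * (dimS * psi mn A B) * 2 ^+ a (K + mx).-1 :> R.
      by rewrite mulr1 [leRHS]mulrAC.
    rewrite ln_le_pow2 //; last exact: mulr_gt0.
    rewrite ln1 mul0r addr0 (lnM (x := c_liouville * height B) (y := dimS * psi mn A B)) ?posrE //.
    rewrite (lnM (x := c_liouville) (y := height B)) ?posrE //.
    rewrite (lnM (x := dimS) (y := psi mn A B)) ?posrE //.
    by move: g0; rewrite /h /p; lra.
  have -> : ((K + mx).-1 = K.-1 + mx)%N by rewrite -[in LHS](prednK K_gt0) addSn.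
  have g1 := gap_lb K.-1.
  have /andP[_ g2] := steps_bounds (K.-1 + mx).
  have /andP[g3 _] := steps_bounds (K.-1 + d).
  have /andP[_ g4] := steps_bounds K.-1.
  have g5 : kappa * (L + c) + c < L / 2 * alpha (K.-1 + mx).
    apply: lt_le_trans (K1P K.-1 _) _; first by rewrite prednK // ltnW.
    by rewrite ler_pM2l ?divr_gt0 // alpha_le // leq_addr.
  have c0 : 0 <= c by rewrite /c; lra.
  have g6 : (kappa - 1) * h <= p - h.
    have : kappa * h <= m * h by rewrite ler_wpM2r // ltW.
    lra.
  have g7 : (alpha (K.-1 + d) - alpha K.-1 - 1) * L - c <= h.
    have : (alpha (K.-1 + d) - alpha K.-1 - 1) * L <=
           ((a (K.-1 + d))%:R - (a K.-1)%:R) * L by rewrite ler_pM2r //; lra.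
    rewrite /c; lra.
  have g8 : (kappa - 1) * ((alpha (K.-1 + d) - alpha K.-1 - 1) * L - c) <= (kappa - 1) * h.
    by rewrite ler_wpM2l //; lra.
  have g9 : 3 / 2 * alpha (K.-1 + mx) * L <= (kappa - 1) * (alpha (K.-1 + d) - alpha K.-1) * L.
    by rewrite ler_pM2r.
  have g10 : (a (K.-1 + mx))%:R * L <= alpha (K.-1 + mx) * L by rewrite ler_pM2r.
  have g11 : ln c_liouville + ln dimS <= c by rewrite /c; lra.
  have g12 : 0 <= kappa * c by rewrite mulr_ge0 //; lra.
  lra.
have nB := @psi_close R d' N' a dvd_dN e B eN rB.2.
have d0 : 0 <= dimS * psi mn A B by rewrite mulr_ge0 ?(ltW (dimS_gt0 _ _ _)) // ltW.
have [k0 [Kk0 psik0 Hk0]] := close_bounds steps_incr dvd_dN eN rB d0 nB goodK cond.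
have lnpsi : p - ln c_defect - ln dimS <= (a (k0 + mx))%:R * L.
  have n1p := dimS_gt0 R d' N'; have c2p : 0 < c_defect by apply: lt_le_trans c_defect_ge1.
  have nps : 0 < dimS * psi mn A B by exact: mulr_gt0.
  have : 1 * 2 ^+ 0 <= c_defect * (dimS * psi mn A B) * 2 ^+ a (k0 + mx) :> R.
    by rewrite mulr1 -ler_pdivrMr ?pow2_gt0 // mul1r.
  rewrite ln_le_pow2 //; last exact: mulr_gt0.
  rewrite ln1 mul0r addr0 (lnM (x := c_defect) (y := dimS * psi mn A B)) ?posrE //.
  rewrite (lnM (x := dimS) (y := psi mn A B)) ?posrE //.
  by rewrite /p; lra.
pose S : R := \sum_(j < mn) (a (k0 + j))%:R.
have lnHS : S * L <= h.
  rewrite /S -natr_sum -ln_pow2 /h ler_ln ?posrE ?pow2_gt0 //.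
have alphaS : \sum_(j < mn) alpha (k0 + j) <= S + mn%:R.
  have -> : S + mn%:R = \sum_(j < mn) ((a (k0 + j))%:R + 1).
    by rewrite big_split /= sumr_const card_ord.
  by apply: ler_sum => j _; have /andP[] := steps_bounds (k0 + j); lra.
have Sk0 : (a k0)%:R <= S.
  have i0 : (0 < mn)%N := mn_gt0.
  rewrite /S (bigD1 (Ordinal i0)) //= addn0 lerDl.
  by apply: sumr_ge0.
have f1 : (m - kappa) * L * S <= L * kappa * mn%:R + c.
  have /andP[_ g1] := steps_bounds (k0 + mx); have g2 := kappa_ub k0.
  have g3 : kappa * \sum_(j < mn) alpha (k0 + j) <= kappa * (S + mn%:R).
    by rewrite ler_pM2l ?kappa_gt0.
  have g4 : (a (k0 + mx))%:R * L <= kappa * (S + mn%:R) * L.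
    by rewrite ler_pM2r //; lra.
  have g5 : m * (S * L) <= m * h by rewrite ler_wpM2l //; lra.
  rewrite /c; lra.
have mkL : 0 < (m - kappa) * L by rewrite mulr_gt0 // subr_gt0.
have f2 : S <= T2 by rewrite /T2 ler_pdivlMr // mulrC.
have f3 : `|T2| < (Num.bound `|T2|)%:R by exact: archi_boundP.
have f4 : (Num.bound `|T2|).+1%:R <= k0%:R :> R.
  by rewrite ler_nat; apply: leq_trans Kk0; exact: ltnW.
have [_ f5] := alpha_lb k0; have /andP[f6 _] := steps_bounds k0.
have := ler_norm T2; rewrite -natr1 in f4; lra.
Qed.

Hypothesis kappa_attained : forall K0, exists2 K, (K0 <= K)%N &
  alpha (K + mx) = kappa * \sum_(j < mn) alpha (K + j).

(** The subspaces generated by truncations at the indices where kappa is attained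
    have arbitrarily small, but nonzero, distance to A; so there are infinitely many
    of them. *)
Lemma infinite_approximations m : 0 < m < kappa ->
  infinite_set [set B | rational_subspaces e B /\ psi mn A B <= height B `^ (- m)].
Proof.
move=> /andP[m0 mk] /finite_seqP[s sE]; have L0 := ln2_gt0.
have [eps eps0 epsP] : exists2 eps : R, 0 < eps &
    forall B, B \in s -> eps <= psi mn A B.
  have : forall B, B \in s -> 0 < psi mn A B.
    move=> B Bs; have : [set` s] B by [].
    by rewrite -sE => -[rB _]; have := psi_gt0 steps_incr dvd_dN steps_gaps eN rB.
  elim: s {sE} => [|B s IH] sp; first by exists 1.
  have [|eps e0 he] := IH; first by move=> B' B's; apply: sp; rewrite in_cons B's orbT.
  exists (Num.min eps (psi mn A B)).
    by rewrite lt_min e0 sp // mem_head.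
  move=> B'; rewrite in_cons => /orP[/eqP->|/he h]; rewrite ge_min ?lexx ?orbT //.
  by rewrite h.
set C := c_approx R d' N' e.
have n1g := dimS_ge1 R d' N'.
have c_ge1 : 1 <= C.
  have : 0 <= (#|{ffun 'I_e -> 'I_(d + N)}| * e`!)%:R * 2 ^+ e :> R.
    by rewrite mulr_ge0 // exprn_ge0.
  by rewrite /C /c_approx; lra.
have cp : 0 < C by lra.
have lnc : 0 <= ln C by rewrite ln_ge0.
pose T : R := (L + (m + 1) * ln C) / ((kappa - m) * L).
have [q hq] := le_pow2 (C / eps).
have [K KK0 KE] := kappa_attained (maxn (Num.bound `|T|).+1 q.+1).
move: KK0; rewrite geq_max => /andP[KT Kq].
have [B [rB HB nB]] := @good_approximations R d' N' a steps_incr dvd_dN e eN K.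
rewrite -/C in HB nB.
have psiB := @psi_le R d' N' a dvd_dN e B _ eN rB.2 nB.
have psi0 := psi_gt0 steps_incr dvd_dN steps_gaps eN rB.
have Hp : 0 < height B by apply: lt_le_trans (height_ge1 rB.1).
pose S : R := \sum_(j < mn) (a (K + j))%:R.
have Bs : B \in s.
  suff : [set` s] B by [].
  rewrite -sE; split=> //.
  rewrite -ler_ln ?posrE ?powR_gt0 // ln_powR.
  have h1 : ln (psi mn A B) <= ln C - (a (K + mx))%:R * L.
    have : psi mn A B * 2 ^+ a (K + mx) <= C * 2 ^+ 0.
      by rewrite mulr1 -ler_pdivlMr ?pow2_gt0.
    by rewrite ln_le_pow2 // mul0r addr0; lra.
  have h2 : ln (height B) <= ln C + S * L.
    have : height B * 2 ^+ 0 <= C * 2 ^+ (\sum_(j < mn) a (K + j)) by rewrite mulr1.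
    by rewrite ln_le_pow2 // mul0r addr0 natr_sum.
  have h3 : m * ln (height B) <= m * (ln C + S * L) by rewrite ler_pM2l.
  have /andP[h4 _] := steps_bounds (K + mx).
  have h5 : kappa * S <= alpha (K + mx).
    rewrite KE ler_pM2l ?kappa_gt0 //; apply: ler_sum => j _.
    by have /andP[] := steps_bounds (K + j).
  have h6 : (kappa * S - 1) * L <= (a (K + mx))%:R * L by rewrite ler_pM2r //; lra.
  have kmL : 0 < (kappa - m) * L by rewrite mulr_gt0 // subr_gt0.
  have h7 : L + (m + 1) * ln C <= (kappa - m) * L * S.
    have SK : (a K)%:R <= S.
      have i0 : (0 < mn)%N := mn_gt0.
      rewrite /S (bigD1 (Ordinal i0)) //= addn0 lerDl.
      by apply: sumr_ge0.
    have [_ f5] := alpha_lb K; have /andP[f6 _] := steps_bounds K.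
    have f3 : `|T| < (Num.bound `|T|)%:R by exact: archi_boundP.
    have f4 : (Num.bound `|T|).+1%:R <= K%:R :> R by rewrite ler_nat.
    have TS : T <= S by have := ler_norm T; rewrite -natr1 in f4; lra.
    by move: TS; rewrite /T ler_pdivrMr // [S * _]mulrC.
  lra.
have := epsP _ Bs; rewrite leNgt => /negP; apply.
apply: le_lt_trans psiB _.
rewrite ltr_pdivrMr ?pow2_gt0 // mulrC -ltr_pdivrMr //.
apply: le_lt_trans hq _; rewrite ltr_eXn2l ?ltr1n //.
rewrite -(ltr_nat R).
have /andP[f6 _] := steps_bounds (K + mx).
have [_ f5] := alpha_lb (K + mx).
have f7 : q.+1%:R <= (K + mx)%:R :> R by rewrite ler_nat (leq_trans Kq) ?leq_addr.
rewrite -natr1 in f7; lra.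
Qed.

Theorem mu_exponent_value : mu_exponent e mn A = kappa%:E.
Proof.
have k0 := kappa_gt0; rewrite /mu_exponent.
set E := [set _ | _ in _]; have supE : ereal_sup E = kappa%:E.
  apply/le_anti/andP; split.
    apply: ge_ereal_sup => _ [m [m0 inf] <-]; rewrite lee_fin leNgt.
    apply/negP => km; apply: inf; have [H HB] := height_bound km.
    apply: sub_finite_set (@finite_bounded_height R (d + N) e H).
    by move=> B [rB psiB]; split=> //; exact: HB.
  apply/lee_addgt0Pr => eps eps0.
  pose m := Num.max (kappa / 2) (kappa - eps / 2).
  have m0 : 0 < m by rewrite lt_max divr_gt0.
  have mk : m < kappa by rewrite gt_max; apply/andP; split; lra.
  apply: (@le_trans _ _ (m%:E + eps%:E)%E).
    rewrite -EFinD lee_fin; have : kappa - eps / 2 <= m by rewrite le_max lexx orbT.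
    lra.
  apply: leeD => //; apply: ereal_sup_ubound; exists m => //; split=> //.
  by apply: infinite_approximations; rewrite m0.
by rewrite supE; apply/max_idPr; rewrite lee_fin ltW.
Qed.

End FixedDimension.

End ExponentValue.

(** * Log-convex parameters *)
Section LogConvex.
Variables (R : realType) (N : nat) (y : nat -> R).
Hypothesis y_gt0 : forall k, (k <= N)%N -> 0 < y k.
Hypothesis y_convex : forall k, (k.+2 <= N)%N -> y k.+1 ^+ 2 <= y k * y k.+2.

Lemma convex_ratio p r : (p <= r < N)%N -> y p.+1 * y r <= y p * y r.+1.
Proof.
move=> /andP[]; elim: r => [|r IH].
  by rewrite leqn0 => /eqP-> _; rewrite mulrC.
rewrite leq_eqVlt => /orP[/eqP<- _|pr rN]; first by rewrite mulrC.
have h := IH pr (ltnW rN); have c := y_convex rN.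
have yr : 0 < y r by apply: y_gt0; lia.
have yr1 : 0 < y r.+1 by apply: y_gt0; lia.
have yp : 0 < y p by apply: y_gt0; lia.
rewrite -(ler_pM2l yr).
have h1 : y p.+1 * y r * y r.+1 <= y p * y r.+1 * y r.+1 by rewrite ler_pM2r.
have h2 : y p * y r.+1 ^+ 2 <= y p * (y r * y r.+2) by rewrite ler_pM2l.
lra.
Qed.

(** For a log-convex sequence, the growth over a window of given length increases
    when the window moves to the right. *)
Lemma convex_shift p r i : (p <= r)%N -> (r + i <= N)%N ->
  y (p + i) * y r <= y p * y (r + i).
Proof.
move=> pr; elim: i => [|i IH] rN; first by rewrite !addn0 mulrC.
rewrite !addnS; have h := IH ltac:(lia).
have c := @convex_ratio (p + i) (r + i) ltac:(lia).
have yri : 0 < y (r + i) by apply: y_gt0; lia.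
have yr : 0 < y r by apply: y_gt0; lia.
have yr1 : 0 < y (r + i).+1 by apply: y_gt0; lia.
rewrite -(ler_pM2l yri).
have h1 : y (p + i).+1 * y (r + i) * y r <= y (p + i) * y (r + i).+1 * y r.
  by rewrite ler_pM2r.
have h2 : y (p + i) * y r * y (r + i).+1 <= y p * y (r + i) * y (r + i).+1.
  by rewrite ler_pM2r.
lra.
Qed.

End LogConvex.

Section PeriodicFamily.
Variables (R : realType) (d' N' : nat) (y : nat -> R).
Local Notation d := d'.+1.
Local Notation N := N'.+1.
Hypothesis dvd_dN : (d %| N)%N.
Hypothesis y_0 : 0 < y 0.
Hypothesis y_growth : forall k, (k < N)%N -> 4 * y k <= y k.+1.
Hypothesis y_convex : forall k, (k.+2 <= N)%N -> y k.+1 ^+ 2 <= y k * y k.+2.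
Hypothesis y_N : y N = 1.

(** The extension of y_0, ..., y_(N-1), y_N = 1 with alpha (k + N) = alpha k / y_0,
    normalized by alpha 0 = 1. *)
Definition alpha k : R := (y 0)^-1 ^+ (k %/ N).+1 * y (k %% N).

Lemma y_gt0 k : (k <= N)%N -> 0 < y k.
Proof.
elim: k => // k IH kN; apply: lt_le_trans (y_growth kN).
by rewrite mulr_gt0 // IH // ltnW.
Qed.

Lemma alphaDN k : alpha (k + N) = (y 0)^-1 * alpha k.
Proof.
rewrite /alpha modnDr divnDr ?dvdnn // divnn addn1.
by rewrite [in LHS]exprS mulrA.
Qed.

Lemma alphaE k : (k <= N)%N -> alpha k = (y 0)^-1 * y k.
Proof.
rewrite leq_eqVlt => /orP[/eqP->|kN].
  rewrite -[X in alpha X]add0n alphaDN y_N mulr1.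
  by rewrite /alpha div0n mod0n expr1 mulVf ?mulr1 // gt_eqF.
by rewrite /alpha divn_small // modn_small // expr1.
Qed.

Lemma alpha0 : alpha 0 = 1.
Proof. by rewrite alphaE // mulVf // gt_eqF. Qed.

Lemma alpha_step k : 4 * alpha k <= alpha k.+1.
Proof.
have i0 : 0 < (y 0)^-1 by rewrite invr_gt0.
have [q [r [-> rN]]] : exists q r, k = (r + q * N)%N /\ (r < N)%N.
  by exists (k %/ N)%N, (k %% N)%N; rewrite addnC -divn_eq ltn_mod.
elim: q => [|q IH].
  rewrite mul0n addn0 !alphaE ?(ltnW rN) // mulrCA ler_pM2l //; exact: y_growth.
by rewrite mulSn addnCA addnC -[(_ + N).+1]addSn !alphaDN mulrCA ler_pM2l.
Qed.

(** Among the windows of length j <= N, alpha grows most over those that end at a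
    multiple of N. A window that crosses a multiple of N is split there: its two
    pieces are compared with the pieces of [N - j, N] by log-convexity. *)
Lemma alpha_window K j : (j <= N)%N -> alpha (K + j) * y (N - j) <= alpha K.
Proof.
move=> jN; have i0 : 0 < (y 0)^-1 by rewrite invr_gt0.
have [q [r [-> rN]]] : exists q r, K = (r + q * N)%N /\ (r < N)%N.
  by exists (K %/ N)%N, (K %% N)%N; rewrite addnC -divn_eq ltn_mod.
elim: q => [|q IH]; last first.
  have E : (r + q.+1 * N = r + q * N + N)%N by rewrite mulSn addnCA addnC.
  by rewrite E addnAC !alphaDN -mulrA ler_pM2l.
rewrite mul0n addn0; have [rj|rj] := leqP (r + j) N.
  rewrite !alphaE //; last exact: ltnW.
  rewrite -mulrA ler_pM2l //.
  have := @convex_shift R N y y_gt0 y_convex r (N - j) j ltac:(lia) ltac:(lia).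
  by rewrite subnK // y_N mulr1.
have -> : (r + j = (r + j - N) + N)%N by lia.
rewrite alphaDN !alphaE //; try lia.
have := @convex_shift R N y y_gt0 y_convex 0 (N - j) (r + j - N) ltac:(lia) ltac:(lia).
have -> : (N - j + (r + j - N) = r)%N by lia.
rewrite add0n => h.
have h2 := ler_wpM2l (ltW i0) h.
have y0n : y 0 != 0 by rewrite gt_eqF.
have h3 : (y 0)^-1 * (y (r + j - N) * y (N - j)) <= y r.
  by apply: le_trans h2 _; rewrite mulKf.
by rewrite -!mulrA ler_pM2l.
Qed.

Lemma alpha_window_eq q j : (j <= N)%N -> (0 < q)%N ->
  alpha (q * N) * y (N - j) = alpha (q * N - j).
Proof.
move=> jN; case: q => // q _; elim: q => [|q IH].
  by rewrite mul1n !alphaE ?leq_subr // y_N mulr1.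
have -> : (q.+2 * N = q.+1 * N + N)%N by rewrite mulSn addnC.
rewrite alphaDN -mulrA IH -alphaDN; congr alpha; rewrite mulSn; lia.
Qed.

(** The inverse of the exponent in dimension e. *)
Definition window_sum e := \sum_(j < minn d e) y (N - maxn d e + j).

Lemma mu_exponent_param e : (1 <= e <= N)%N ->
  mu_exponent e (minn d e) (Aspace R d' N' (steps alpha)) = ((window_sum e)^-1)%:E.
Proof.
move=> eN; have /andP[e1 eN'] := eN; have dN := leq_dN dvd_dN.
have mxN : (maxn d e <= N)%N by rewrite geq_max dN.
have mn0 : (0 < minn d e)%N by rewrite leq_min.
have mnmx : (minn d e <= maxn d e)%N by rewrite geq_min leq_maxl.
have S0 : 0 < window_sum e.
  rewrite /window_sum (bigD1 (Ordinal mn0)) //=; apply: ltr_wpDr.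
    by apply: sumr_ge0 => j _; apply/ltW/y_gt0; have := ltn_ord j; lia.
  by apply: y_gt0; lia.
apply: mu_exponent_value => //; first by rewrite alpha0.
- exact: alpha_step.
- move=> K; rewrite mulrC ler_pdivlMr // /window_sum mulr_sumr; apply: ler_sum => j _.
  have jm := ltn_ord j.
  have := @alpha_window (K + j) (maxn d e - j) ltac:(lia).
  have -> : (K + j + (maxn d e - j) = K + maxn d e)%N by lia.
  by have -> : (N - (maxn d e - j) = N - maxn d e + j)%N by lia.
- move=> K0; exists (K0.+1 * N - maxn d e)%N.
    by rewrite mulSn; have : (K0 <= K0 * N)%N by [rewrite leq_pmulr]; lia.
  have -> : (K0.+1 * N - maxn d e + maxn d e = K0.+1 * N)%N.
    by rewrite subnK // mulSn; lia.
  apply: (mulfI (lt0r_neq0 S0)); rewrite mulVKf ?gt_eqF //.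
  rewrite mulrC /window_sum mulr_sumr; apply: eq_bigr => j _; have jm := ltn_ord j.
  have -> : (N - maxn d e + j = N - (maxn d e - j))%N by lia.
  rewrite alpha_window_eq //; last by lia.
  by congr alpha; rewrite mulSn; lia.
Qed.

Lemma irrational_param e : (1 <= e <= N)%N ->
  irrational_subspaces d e (minn d e) (Aspace R d' N' (steps alpha)).
Proof.
move=> eN; have a1 : 1 <= alpha 0 by rewrite alpha0.
by apply: A_irrational => //; [apply: steps_incr | apply: steps_gaps] => //;
  exact: alpha_step.
Qed.

End PeriodicFamily.

Lemma submersion_not_locally_zero (R : realType) k (h : 'rV[R]_k -> R)
    (x : 'rV[R]_k) :
  submersion h -> ~ (\forall z \near x, h z = 0).
Proof.
move=> [smooth_h subm_h] h0; have [v vE] := subm_h x 1.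
have dh : differentiable h x by exact: (smooth_h [::] x).
have : 'D_v h x = 'D_v (cst 0) x by apply: near_eq_derive.
by rewrite deriveE // vE derive_cst => /eqP; rewrite oner_eq0.
Qed.

(** * The spectrum contains an open set *)
Section WindowSums.
Variables (R : realType) (d' N' : nat).
Local Notation d := d'.+1.
Local Notation N := N'.+1.

(** The value 1 is the normalization y_N = 1. *)
Definition extend (v : 'rV[R]_N) k : R := if (k < N)%N then v 0 (inord k) else 1.

(** Strict versions of the conditions on the parameters, so that they are open. *)
Definition admissible (v : 'rV[R]_N) :=
  [/\ 0 < extend v 0, forall k : 'I_N, 4 * extend v k < extend v k.+1 &
      forall k : 'I_N, (k.+2 <= N)%N ->
        extend v k.+1 ^+ 2 < extend v k * extend v k.+2].

(** The sequence 2^((k + 1)^2), normalized at k = N: its successive ratios are the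
    powers 2^(2 k + 3), which increase and are at least 8. *)
Lemma admissible_exists : exists v, admissible v.
Proof.
pose q k : R := 2 ^+ (k.+1 ^ 2)%N / 2 ^+ (N.+1 ^ 2)%N.
have p0 m : 0 < 2 ^+ m :> R by rewrite exprn_gt0.
exists (\row_(k < N) q k).
have qE k : (k <= N)%N -> extend (\row_(k < N) q k) k = q k.
  rewrite /extend leq_eqVlt => /orP[/eqP->|kN].
    by rewrite ltnn /q divff // gt_eqF.
  by rewrite kN mxE inordK.
split=> [|k|k kN]; rewrite !qE ?(ltn_ord k) ?(ltnW (ltn_ord k)) //; try lia.
- by rewrite divr_gt0.
- rewrite /q mulrA ltr_pM2r ?invr_gt0 // -[4]/(4%:R) (natrX _ 2 2) -exprD.
  by rewrite ltr_eXn2l ?ltr1n //; lia.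
- rewrite /q expr_div_n mulrACA -invfM -expr2 ltr_pM2r ?invr_gt0 ?exprn_gt0 //.
  by rewrite -exprM -exprD ltr_eXn2l ?ltr1n //; lia.
Qed.

Hypothesis leq_dN : (d <= N)%N.

Definition in_window e k := (N - maxn d e <= k < N - maxn d e + minn d e)%N.

Definition window_mx : 'M[R]_N := \matrix_(k, i) (in_window i.+1 k)%:R.

Lemma window_sumE (v : 'rV[R]_N) (i : 'I_N) :
  window_sum d' N' (extend v) i.+1 = (v *m window_mx) 0 i.
Proof.
have iN := ltn_ord i.
rewrite mxE (eq_bigr (fun k : 'I_N => if in_window i.+1 k then extend v k else 0)); last first.
  move=> k _; rewrite !mxE /extend ltn_ord inord_val.
  by case: in_window; rewrite ?mulr1 ?mulr0.
rewrite -big_mkcond /= /window_sum /in_window.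
set p := (N - maxn d i.+1)%N; set q := minn d i.+1.
have pqN : (p + q <= N)%N by rewrite /p /q; lia.
rewrite -(big_mkord (fun k => (p <= k < p + q)%N) (extend v)).
rewrite -(big_mkord xpredT (fun j => extend v (p + j))).
apply/esym; rewrite (big_cat_nat _ (n := p)) //=; last by lia.
rewrite big_nat_cond big1 ?add0r; last by move=> k h; exfalso; lia.
rewrite (big_cat_nat _ (n := (p + q)%N)) //=; last by lia.
rewrite [X in _ + X = _]big_nat_cond [X in _ + X = _]big1 ?addr0; last first.
  by move=> k h; exfalso; lia.
rewrite -{1}[p]add0n big_addn addKn big_nat_cond [RHS]big_nat_cond.
by apply: eq_big => [k|k _]; [lia | rewrite addnC].
Qed.

(** The windows of length at most d share their left end N - d and determine the last
    d parameters one by one; the windows of length d ending further and further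
    to the left determine the others. *)
Lemma window_mx_unit : window_mx \in unitmx.
Proof.
rewrite -row_free_unit -kermx_eq0; apply/rowV0P => v /sub_kermxP vS.
have S0 e : (1 <= e <= N)%N -> window_sum d' N' (extend v) e = 0.
  case: e => // e /= eN; have := window_sumE v (Ordinal eN).
  by rewrite vS mxE.
(* The last d entries, from the windows of length at most d. *)
have top i : (i < d)%N -> extend v (N - d + i) = 0.
  elim/ltn_ind: i => i IH id.
  have := S0 i.+1 ltac:(lia); rewrite /window_sum.
  have -> : minn d i.+1 = i.+1 by lia.
  have -> : maxn d i.+1 = d by lia.
  rewrite big_ord_recr /= big1 ?add0r // => j _.
  by apply: IH; have := ltn_ord j; lia.
(* The others, from the windows of length d moving to the left. *)
have all m : (m <= N)%N -> forall k, (N - m <= k < N)%N -> extend v k = 0.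
  elim: m => [|m IH] mN k kN; first by lia.
  have [dm|md] := leqP m.+1 d.
    have := top (k - (N - d))%N ltac:(lia).
    by have -> : (N - d + (k - (N - d)) = k)%N by lia.
  have [km|km] := leqP (N - m) k; first by apply: IH; lia.
  have := S0 m.+1 ltac:(lia); rewrite /window_sum.
  have -> : minn d m.+1 = d by lia.
  have -> : maxn d m.+1 = m.+1 by lia.
  rewrite big_ord_recl /= big1 ?addr0; last first.
    by move=> j _; apply: IH; rewrite /bump /=; have := ltn_ord j; lia.
  by have -> : (N - m.+1 + 0 = k)%N by lia.
apply/rowP => k; rewrite mxE; have kN := ltn_ord k.
by have := all N (leqnn _) k ltac:(lia); rewrite /extend kN inord_val.
Qed.

(** The parameters for which the exponents are the coordinates of x. *)
Definition params (x : 'rV[R]_N) : 'rV[R]_N := (\row_i (x 0 i)^-1) *m invmx window_mx.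

Lemma window_sum_params x (i : 'I_N) :
  window_sum d' N' (extend (params x)) i.+1 = (x 0 i)^-1.
Proof. by rewrite window_sumE /params mulmxKV ?window_mx_unit // mxE. Qed.

Lemma extend_params_continuous (x : 'rV[R]_N) k : (forall i, x 0 i != 0) ->
  {for x, continuous (fun z => extend (params z) k)}.
Proof.
move=> x0; have [Nk|kN] := leqP N k.
  have -> : (fun z : 'rV[R]_N => extend (params z) k) = cst 1.
    by apply/funext => z; rewrite /extend ltnNge Nk.
  exact: cst_continuous.
have -> : (fun z => extend (params z) k) =
    fun z : 'rV[R]_N => \sum_i (z 0 i)^-1 * invmx window_mx i (inord k).
  apply/funext => z; rewrite /extend kN mxE.
  by apply: eq_bigr => i _; rewrite mxE.
apply: (@cvg_big R^o 'I_N (fun u v => u + v) 0 xpredT _ _ (nbhs x) _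
   (fun i z => (z 0 i)^-1 * invmx window_mx i (inord k))) => [|i _].
  exact: (@add_continuous R^o).
apply: cvgM; last exact: cvg_cst.
by apply: cvgV => //; exact: (@coord_continuous _ 1 N 0 i x).
Qed.

Lemma admissible_near (x : 'rV[R]_N) : (forall i, x 0 i != 0) -> admissible (params x) ->
  \forall z \near x, admissible (params z).
Proof.
move=> x0 [a1 a2 a3].
have ct k : {for x, continuous (fun z => extend (params z) k)}.
  exact: extend_params_continuous.
have lt_near (f g : 'rV[R]_N -> R) : {for x, continuous f} -> {for x, continuous g} ->
    f x < g x -> \forall z \near x, f z < g z.
  move=> cf cg fg.
  have cgf : (fun z => g z - f z) @ x --> g x - f x.
    by apply: cvgB; [exact: nbhs_filter | exact: cg | exact: cf].
  have pos : 0 < g x - f x by rewrite subr_gt0.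
  by apply: filterS (cvgr_gt _ cgf _ pos) => z; rewrite subr_gt0.
have ctM (f g : 'rV[R]_N -> R) : {for x, continuous f} -> {for x, continuous g} ->
    {for x, continuous (fun z => f z * g z)}.
  by move=> cf cg; apply: cvgM; [exact: nbhs_filter | exact: cf | exact: cg].
near=> z; split; near: z.
- apply: (lt_near (cst 0)); [exact: cst_continuous | exact: ct | exact: a1].
- apply: filter_forall => k; apply: lt_near; [|exact: ct|exact: a2].
  by apply: ctM; [exact: cst_continuous | exact: ct].
- apply: filter_forall => k; have [kN|kN] := leqP k.+2 N; last first.
    by apply: nearW => z h; lia.
  apply: filterS (lt_near (fun z => extend (params z) k.+1 * extend (params z) k.+1)
    (fun z => extend (params z) k * extend (params z) k.+2) _ _ _) => //.
  + by apply: ctM; exact: ct.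
  + by apply: ctM; exact: ct.
  + exact: a3.
Unshelve. all: by end_near. Qed.

End WindowSums.

Definition attained (R : realType) (d' N' : nat) (x : 'rV[R]_N'.+1) :=
  exists A : {vspace 'rV[R]_(d'.+1 + N'.+1)},
    (forall e, (1 <= e <= N'.+1)%N -> irrational_subspaces d'.+1 e (minn d'.+1 e) A) /\
    forall i : 'I_N'.+1, mu_exponent i.+1 (minn d'.+1 i.+1) A = (x 0 i)%:E.

(** The inverses of the exponents are the images of the parameters by an invertible
    linear map, and the admissible parameters form an open set. *)
Lemma spectrum_interior (R : realType) (d' N' : nat) : (d'.+1 %| N'.+1)%N ->
  exists x0 : 'rV[R]_N'.+1, \forall x \near x0, attained d' x.
Proof.
move=> dvd; have dN : (d'.+1 <= N'.+1)%N by exact: dvdn_leq.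
have [v adm] := admissible_exists R N'.
have sum_gt0 (w : 'rV[R]_N'.+1) i : (i < N'.+1)%N -> admissible w ->
    0 < window_sum d' N' (extend w) i.+1.
  move=> iN [w1 w2 w3].
  have wpos k : (k <= N'.+1)%N -> 0 < extend w k.
    by apply: y_gt0 => // l lN; exact: ltW (w2 (Ordinal lN)).
  rewrite /window_sum; have mn0 : (0 < minn d'.+1 i.+1)%N by lia.
  rewrite (bigD1 (Ordinal mn0)) //=; apply: ltr_wpDr.
    by apply: sumr_ge0 => j _; apply/ltW/wpos; have := ltn_ord j; lia.
  by apply: wpos; lia.
pose x0 : 'rV[R]_N'.+1 := \row_i (window_sum d' N' (extend v) i.+1)^-1.
have x0_neq0 i : x0 0 i != 0.
  by rewrite mxE invr_eq0 gt_eqF // sum_gt0.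
have px0 : params d' x0 = v.
  rewrite /params; have -> : \row_i (x0 0 i)^-1 = v *m window_mx R d' N'.
    by apply/rowP => i; rewrite !mxE invrK window_sumE // mxE.
  by rewrite mulmxK // window_mx_unit.
have near_adm : \forall z \near x0, admissible (params d' z).
  by apply: admissible_near => //; rewrite px0.
exists x0; apply: filterS near_adm.
move=> x admx; have [w1 w2 w3] := admx.
set y := extend (params d' x) in w1 w2 w3.
have y_growth k : (k < N'.+1)%N -> 4 * y k <= y k.+1.
  by move=> kN; exact: ltW (w2 (Ordinal kN)).
have y_convex k : (k.+2 <= N'.+1)%N -> y k.+1 ^+ 2 <= y k * y k.+2.
  by move=> kN; exact: ltW (w3 (Ordinal (ltnW kN)) kN).
have yN : y N'.+1 = 1 by rewrite /y /extend ltnn.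
exists (Aspace R d' N' (steps (alpha N' y))); split=> [e eN|i].
  by apply: irrational_param.
rewrite mu_exponent_param //; last by rewrite /= ltn_ord.
by rewrite /y window_sum_params // invrK.
Qed.

Theorem theorem1p5 (R : realType) (n d : nat) (hn : (2 <= n)%N)
    (hd : (1 <= d <= n - 1)%N) (hdn : (d %| n)%N) :
  smoothly_independent
    (\bigcap_(e in [set e : nat | (1 <= e <= n - d)%N])
        @irrational_subspaces R n d e (minn d e))
    (fun (i : 'I_(n - d)) (A : {vspace 'rV[R]_n}) =>
       mu_exponent i.+1 (minn d i.+1) A).
Proof.
have nE : n = (d + (n - d))%N by lia.
have N0 : (0 < n - d)%N by lia.
have dvdN : (d %| n - d)%N by rewrite dvdn_subr //; lia.
move: (n - d)%N nE N0 dvdN => N nE N0 dvdN; subst n.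
case: d => // d' in hn hd hdn dvdN *; case: N => // N' in hn hd hdn N0 dvdN *.
case=> h [subm h0]; have [x0 spec] := @spectrum_interior R d' N' dvdN.
apply: (submersion_not_locally_zero (x := x0) subm).
apply: filterS spec => x [A [irrA muA]].
by apply: (h0 A) => // e /= eN; exact: irrA.
Qed.
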